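(* Let $R$ be a right Morita ring. The map $C\mapsto\mathcal{Y}_C={}^{\perp}C\cap\mathrm{cogen}^*(C)$ establishes a one-to-one correspondence (bijection) between (a) the isomorphism classes of finitely generated, basic, product-complete, Wakamatsu cotilting right $R$-modules; and (b) the resolving subcategories $\mathcal{C}$ of $\mathrm{mod}\text{-}R$ that possess a product-complete Ext-injective cogenerator $C$ and are maximal (with respect to inclusion) among the resolving subcategories of $\mathrm{mod}\text{-}R$ with the same Ext-injective cogenerator $C$.
   Context: Rings are associative with identity $1\ne0$ and modules are unitary. $\mathrm{Mod}\text{-}R$ is the category of all right $R$-modules; $\mathrm{mod}\text{-}R$ (resp. $S\text{-mod}$) is the category of finitely generated right $R$-modules (resp. left $S$-modules). Subcategories are understood to be full and closed under isomorphism. $\mathrm{Add}(C)$ (resp. $\mathrm{add}(C)$) is the class of right $R$-modules isomorphic to a direct summand of a direct sum of copies (resp. finitely many copies) of $C$; $\mathrm{Prod}(C)$ is the class of right $R$-modules isomorphic to a direct summand of a direct product of copies of $C$. $C$ is product-complete if $\mathrm{Prod}(C)\subseteq\mathrm{Add}(C)$. $R$ is right Morita if there are a ring $S$ and a bimodule ${}_SU_R$ such that the functors $\mathrm{Hom}_R(-,U):\mathrm{mod}\text{-}R\to S\text{-mod}$ and $\mathrm{Hom}_S(-,U):S\text{-mod}\to\mathrm{mod}\text{-}R$ induce a duality of categories. $\mathrm{cogen}^*(C)$ is the class of right $R$-modules $M$ for which there is an exact sequence $0\to M\xrightarrow{f^{-1}}C^0\xrightarrow{f^0}C^1\xrightarrow{f^1}\cdots$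 with all $C^i\in\mathrm{add}(C)$ and $\mathrm{Ext}^1_R(\mathrm{Coker} f^i,C)=0$ for all $i\ge -1$. For a subcategory $\mathcal{D}$ of $\mathrm{Mod}\text{-}R$, $\mathrm{gen}^*(\mathcal{D})$ is the class of right $R$-modules $M$ for which there is an exact sequence $\cdots\to D_1\xrightarrow{f_1}D_0\xrightarrow{f_0}M\to0$ with all $D_i\in\mathcal{D}$ and $\mathrm{Ext}^1_R(X,\mathrm{Ker} f_i)=0$ for all $X\in\mathcal{D}$, $i\ge0$. ${}^{\perp}C=\{M:\mathrm{Ext}^i_R(M,C)=0\text{ for all }i\ge1\}$; for a class $\mathcal{C}$, $\mathcal{C}^{\perp}=\{M:\mathrm{Ext}^i_R(X,M)=0\text{ for all }X\in\mathcal{C},i\ge1\}$. A right $R$-module $C$ is Wakamatsu cotilting if $\mathrm{Ext}^i_R(C^I,C)=0$ for every set $I$ and all $i\ge1$, and there is an injective cogenerator $Q$ for $\mathrm{Mod}\text{-}R$ with $Q\in\mathrm{gen}^*(\mathrm{Prod}(C))$. A nonzero module $X$ is basic if $X\cong X_1\oplus\cdots\oplus X_n$ with each $X_i$ indecomposable and $X_i\not\cong X_j$ for $i\ne j$. A subcategory $\mathcal{C}$ of $\mathrm{mod}\text{-}R$ is resolving if it is closed under direct summands, extensions and kernels of epimorphisms and contains all finitely generated projective right $R$-modules. A module $C\in\mathcal{C}$ is an Ext-injective cogenerator for $\mathcal{C}$ if $C\in\mathcal{C}^{\perp}$ and for every $M\in\mathcal{C}$ there is an exact sequence $0\to M\to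 C'\to M'\to0$ with $C'\in\mathrm{add}(C)$ and $M'\in\mathcal{C}$. *)

(* Defs.v *)
From HB Require Import structures.
From mathcomp Require Import all_boot all_algebra.
From mathcomp Require Import boolp classical_sets cardinality.
From mathcomp Require Import ring_quotient.

Set Implicit Arguments.
Unset Strict Implicit.
Unset Printing Implicit Defensive.

Import GRing.Theory.
Local Open Scope ring_scope.

(* General notions are stated for left modules over a ring A; a right           *)
(* R-module is a left module over the converse ring R^c.                        *)
Notation rmodType R := (lmodType R^c).

Section SubQuotient.
Variables (A : nzRingType) (V : lmodType A) (K : submodClosed V).

Definition submod : Type := {x : V | x \in K}.
HB.instance Definition _ := SubChoice.on submod.
HB.instance Definition _ := [SubChoice_isSubLmodule of submod by <:].

Definition submod_pred : {pred V} := fun x => x \in K.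
HB.instance Definition _ :=
  GRing.isZmodClosed.Build V submod_pred (GRing.submod_closedB (submodClosedP K)).

Definition quotmod : Type := {ideal_quot submod_pred}.
HB.instance Definition _ := GRing.Zmodule.on quotmod.

Definition quot_proj (x : V) : quotmod := \pi_{ideal_quot submod_pred}%qT x.

Definition quot_scale (a : A) (x : quotmod) : quotmod :=
  quot_proj (a *: repr x).

Lemma quot_projK (x : quotmod) : quot_proj (repr x) = x.
Proof. exact: reprK. Qed.

Lemma quot_projD x y : quot_proj (x + y) = quot_proj x + quot_proj y.
Proof. exact: raddfD. Qed.

Lemma quot_projP x y : quot_proj x = quot_proj y <-> x - y \in K.
Proof.
rewrite /quot_proj -[x - y \in K]/(x - y \in submod_pred) Quotient.idealrBE.
by split=> /eqP.
Qed.

Lemma quot_scaleE a x : quot_scale a (quot_proj x) = quot_proj (a *: x).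
Proof.
by apply/quot_projP; rewrite -scalerBr rpredZ //; apply/quot_projP/quot_projK.
Qed.

Lemma quot_scalerA a b x :
  quot_scale a (quot_scale b x) = quot_scale (a * b) x.
Proof. by rewrite -[x]quot_projK !quot_scaleE scalerA. Qed.
Lemma quot_scale1r : left_id 1 quot_scale.
Proof. by move=> x; rewrite -[x]quot_projK quot_scaleE scale1r. Qed.
Lemma quot_scalerDr : right_distributive quot_scale +%R.
Proof.
move=> a x y; rewrite -[x]quot_projK -[y]quot_projK.
by rewrite -quot_projD !quot_scaleE -quot_projD scalerDr.
Qed.
Lemma quot_scalerDl x : {morph quot_scale^~ x : a b / a + b}.
Proof. by move=> a b /=; rewrite -[x]quot_projK !quot_scaleE -quot_projD scalerDl. Qed.

HB.instance Definition _ := GRing.Zmodule_isLmodule.Build A quotmod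
  quot_scalerA quot_scale1r quot_scalerDr quot_scalerDl.
End SubQuotient.

Section KerCoker.
Variables (A : nzRingType) (U V : lmodType A) (f : {linear U -> V}).

Definition ker_pred : {pred U} := fun x => f x == 0.
Lemma ker_pred_closed : submod_closed ker_pred.
Proof.
split=> [|a x y]; first by rewrite unfold_in linear0.
by rewrite !unfold_in => /eqP fx /eqP fy; rewrite linearP fx fy scaler0 addr0.
Qed.
HB.instance Definition _ :=
  GRing.isSubmodClosed.Build A U ker_pred ker_pred_closed.

Definition im_pred : {pred V} := fun y => `[< exists x, f x = y >].
Lemma im_pred_closed : submod_closed im_pred.
Proof.
split=> [|a x y]; first by apply/asboolP; exists 0; rewrite linear0.
move=> /asboolP[u <-] /asboolP[v <-].
by apply/asboolP; exists (a *: u + v); rewrite linearP.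
Qed.
HB.instance Definition _ :=
  GRing.isSubmodClosed.Build A V im_pred im_pred_closed.

Definition Ker : lmodType A := submod ker_pred.
Definition Coker : lmodType A := quotmod im_pred.
End KerCoker.

Section ProductSum.
Variables (A : nzRingType) (I : Type) (X : I -> lmodType A).

Definition dprod : Type := forall i, X i.
HB.instance Definition _ := gen_eqMixin dprod.
HB.instance Definition _ := gen_choiceMixin dprod.

Let add (f g : dprod) : dprod := fun i => f i + g i.
Let opp (f : dprod) : dprod := fun i => - f i.
Let zero : dprod := fun i => 0.
Let scale (a : A) (f : dprod) : dprod := fun i => a *: f i.

Lemma dprod_addA : associative add.
Proof. by move=> f g h; apply: functional_extensionality_dep => i; apply: addrA. Qed.
Lemma dprod_addC : commutative add.
Proof. by move=> f g; apply: functional_extensionality_dep => i; apply: addrC. Qed.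
Lemma dprod_add0 : left_id zero add.
Proof. by move=> f; apply: functional_extensionality_dep => i; apply: add0r. Qed.
Lemma dprod_addN : left_inverse zero opp add.
Proof. by move=> f; apply: functional_extensionality_dep => i; apply: addNr. Qed.
HB.instance Definition _ := GRing.isZmodule.Build dprod
  dprod_addA dprod_addC dprod_add0 dprod_addN.

Lemma dprod_scaleA a b f : scale a (scale b f) = scale (a * b) f.
Proof. by apply: functional_extensionality_dep => i; apply: scalerA. Qed.
Lemma dprod_scale1 : left_id 1 scale.
Proof. by move=> f; apply: functional_extensionality_dep => i; apply: scale1r. Qed.
Lemma dprod_scaleDr : right_distributive scale +%R.
Proof.
by move=> a f g; apply: functional_extensionality_dep => i; apply: scalerDr.
Qed.
Lemma dprod_scaleDl f : {morph scale^~ f : a b / a + b}.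
Proof. by move=> a b; apply: functional_extensionality_dep => i; apply: scalerDl. Qed.
HB.instance Definition _ := GRing.Zmodule_isLmodule.Build A dprod
  dprod_scaleA dprod_scale1 dprod_scaleDr dprod_scaleDl.

Definition finsupp_pred : {pred dprod} :=
  fun f => `[< finite_set [set i | f i <> 0]%classic >].
Lemma finsupp_closed : submod_closed finsupp_pred.
Proof.
split=> [|a f g].
  apply/asboolP; apply: (@sub_finite_set _ _ set0%classic).
    by move=> i h; case: h.
  exact: finite_set0.
move=> /asboolP hf /asboolP hg; apply/asboolP.
apply: (@sub_finite_set _ _ ([set i | f i <> 0] `|` [set i | g i <> 0])%classic).
  move=> i /= hfg; apply: contrapT => /not_orP[/contrapT fi /contrapT gi].
  by apply: hfg; rewrite /GRing.add /GRing.scale /= /add /scale fi gi scaler0 addr0.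
by rewrite finite_setU.
Qed.
HB.instance Definition _ :=
  GRing.isSubmodClosed.Build A dprod finsupp_pred finsupp_closed.

Definition DProd : lmodType A := dprod.
Definition DSum : lmodType A := submod finsupp_pred.
End ProductSum.

Section Modules.
Variable A : nzRingType.
Implicit Types (M N C : lmodType A) (D : lmodType A -> Prop).

Definition surj (U V : Type) (f : U -> V) := forall y, exists x, f x = y.

Definition isom M N := exists f : {linear M -> N}, bijective f.

Definition fingen M := exists n (g : 'I_n -> M),
  forall x, exists a : 'I_n -> A, x = \sum_(i < n) a i *: g i.

Definition exact_at (M1 M2 M3 : lmodType A)
    (f : {linear M1 -> M2}) (g : {linear M2 -> M3}) :=
  forall y, g y = 0 <-> exists x, f x = y.

Definition short_exact (M1 M2 M3 : lmodType A)
    (f : {linear M1 -> M2}) (g : {linear M2 -> M3}) :=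
  [/\ injective f, exact_at f g & surj g].

Definition iso_to_summand M N := exists M', isom N (M * M')%type.

Definition inAdd C M := exists I : Type, iso_to_summand M (DSum (fun _ : I => C)).
Definition inadd C M := exists n, iso_to_summand M (DSum (fun _ : 'I_n => C)).
Definition inProd C M := exists I : Type, iso_to_summand M (DProd (fun _ : I => C)).

Definition product_complete C := forall M, inProd C M -> inAdd C M.

Definition projective M := forall (X Y : lmodType A)
  (p : {linear X -> Y}) (f : {linear M -> Y}),
  surj p -> exists g : {linear M -> X}, forall x, p (g x) = f x.

Definition injective_module M := forall (X Y : lmodType A)
  (j : {linear X -> Y}) (f : {linear X -> M}),
  injective j -> exists g : {linear Y -> M}, forall x, g (j x) = f x.

Definition cogenerator M := forall N, exists (I : Type)
  (j : {linear N -> DProd (fun _ : I => M)}), injective j.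

(* ... -> lobj 1 -> lobj 0 -> M -> 0, with maps ldiff n : lobj n.+1 -> lobj n   *)
Record left_resolution M := LeftResolution {
  lobj : nat -> lmodType A;
  ldiff : forall n, {linear lobj n.+1 -> lobj n};
  laug : {linear lobj 0%N -> M};
  laug_surj : surj laug;
  laug_exact : exact_at (ldiff 0%N) laug;
  ldiff_exact : forall n, exact_at (ldiff n.+1) (ldiff n) }.

(* 0 -> M -> robj 0 -> robj 1 -> ..., with maps rdiff n : robj n -> robj n.+1   *)
Record right_resolution M := RightResolution {
  robj : nat -> lmodType A;
  raug : {linear M -> robj 0%N};
  rdiff : forall n, {linear robj n -> robj n.+1};
  raug_inj : injective raug;
  raug_exact : exact_at raug (rdiff 0%N);
  rdiff_exact : forall n, exact_at (rdiff n) (rdiff n.+1) }.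

(* Ext^i(M, N) = 0: the i-th cohomology of Hom(P, N) vanishes, P a projective   *)
(* resolution of M. Every M has one, and the choice of P does not matter.       *)
Definition Ext_vanishes (i : nat) M N :=
  forall P : left_resolution M, (forall n, projective (lobj P n)) ->
  forall f : {linear lobj P i -> N}, (forall x, f (ldiff P i x) = 0) ->
  match i return ({linear lobj P i -> N} -> Prop) with
  | 0%N => fun f => forall x, f x = 0
  | j.+1 => fun f =>
      exists g : {linear lobj P j -> N}, forall x, f x = g (ldiff P j x)
  end f.

Definition left_perp C M := forall i, (1 <= i)%N -> Ext_vanishes i M C.
Definition right_perp D M := forall X, D X ->
  forall i, (1 <= i)%N -> Ext_vanishes i X M.

Definition cogen_star C M := exists E : right_resolution M,
  [/\ forall n, inadd C (robj E n),
      Ext_vanishes 1 (Coker (raug E)) C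
    & forall n, Ext_vanishes 1 (Coker (rdiff E n)) C].

Definition gen_star D M := exists E : left_resolution M,
  [/\ forall n, D (lobj E n),
      forall X, D X -> Ext_vanishes 1 X (Ker (laug E))
    & forall n X, D X -> Ext_vanishes 1 X (Ker (ldiff E n))].

Definition wakamatsu_cotilting C :=
  (forall (I : Type) i, (1 <= i)%N -> Ext_vanishes i (DProd (fun _ : I => C)) C)
  /\ exists Q, [/\ injective_module Q, cogenerator Q & gen_star (inProd C) Q].

Definition nonzero M := exists x : M, x <> 0.
Definition indecomposable M := nonzero M /\
  forall M1 M2, isom M (M1 * M2)%type -> ~ (nonzero M1 /\ nonzero M2).

Definition basic M := nonzero M /\ exists n (X : 'I_n -> lmodType A),
  [/\ isom M (DSum X), forall i, indecomposable (X i)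
    & forall i j, i <> j -> ~ isom (X i) (X j)].

Definition subcategory_of_fingen D :=
  (forall M, D M -> fingen M) /\ (forall M N, isom M N -> D M -> D N).

Definition closed_summands D := forall M N, D N -> iso_to_summand M N -> D M.

Definition closed_extensions D := forall (M1 M2 M3 : lmodType A)
  (f : {linear M1 -> M2}) (g : {linear M2 -> M3}),
  short_exact f g -> D M1 -> D M3 -> D M2.

Definition closed_epi_kernels D := forall (M N : lmodType A)
  (g : {linear M -> N}), surj g -> D M -> D N -> D (Ker g).

Definition resolving D :=
  [/\ subcategory_of_fingen D, closed_summands D, closed_extensions D,
      closed_epi_kernels D & forall M, fingen M -> projective M -> D M].

Definition ext_injective_cogenerator D C :=
  [/\ D C, right_perp D C
    & forall M, D M -> exists (C' M' : lmodType A)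
        (f : {linear M -> C'}) (g : {linear C' -> M'}),
        [/\ short_exact f g, inadd C C' & D M']].

Definition Ycal C M := left_perp C M /\ cogen_star C M.

Definition maximal_resolving_for D C :=
  [/\ resolving D, ext_injective_cogenerator D C
    & forall D', resolving D' -> ext_injective_cogenerator D' C ->
        (forall M, D M -> D' M) -> forall M, D' M -> D M].

Definition bpw_cotilting C :=
  [/\ fingen C, basic C, product_complete C & wakamatsu_cotilting C].

Definition maximal_pc_resolving D :=
  exists2 C, product_complete C & maximal_resolving_for D C.

End Modules.

(* An S-R-bimodule, given as a right R-module with a commuting left S-action;   *)
(* bim_left is the same abelian group seen as a left S-module.                  *)
Record bimodule (S R : nzRingType) := Bimodule {
  bim_right : rmodType R;
  lact : S -> bim_right -> bim_right;
  lactA : forall s t u, lact s (lact t u) = lact (s * t) u;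
  lact1 : left_id 1 lact;
  lactDr : right_distributive lact +%R;
  lactDl : forall u, {morph lact^~ u : s t / s + t};
  lactZ : forall s (r : R^c) u, lact s (r *: u) = r *: lact s u }.

Section HomModules.
Variables (S R : nzRingType) (U : bimodule S R).

Definition bim_left_type : Type := bim_right U.
HB.instance Definition _ := GRing.Zmodule.on bim_left_type.
HB.instance Definition _ := GRing.Zmodule_isLmodule.Build S bim_left_type
  (@lactA _ _ U) (@lact1 _ _ U) (@lactDr _ _ U) (@lactDl _ _ U).
Definition bim_left : lmodType S := bim_left_type.

Section HomR.
Variable M : rmodType R.
Definition homR_pred : {pred DProd (fun _ : M => bim_left)} :=
  fun f => `[< linear (f : M -> bim_right U) >].
Lemma homR_closed : submod_closed homR_pred.
Proof.
split=> [|s f g].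
  by apply/asboolP => r x y; rewrite scaler0 addr0.
move=> /asboolP hf /asboolP hg; apply/asboolP => r x y.
have E z : (s *: f + g) z = lact s (f z : bim_right U) + g z :> bim_right U by [].
rewrite !E hf hg lactDr lactZ scalerDr -!addrA; congr (_ + _).
by rewrite addrCA.
Qed.
HB.instance Definition _ := GRing.isSubmodClosed.Build S
  (DProd (fun _ : M => bim_left)) homR_pred homR_closed.

Definition HomR : lmodType S := submod homR_pred.
End HomR.

Section HomS.
Variable N : lmodType S.
Definition homS_pred : {pred DProd (fun _ : N => bim_right U)} :=
  fun f => `[< linear (f : N -> bim_left) >].
Lemma homS_closed : submod_closed homS_pred.
Proof.
split=> [|r f g].
  by apply/asboolP => s x y; rewrite scaler0 addr0.
move=> /asboolP hf /asboolP hg; apply/asboolP => s x y.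
have {}hf : f (s *: x + y) = lact s (f x) + f y by apply: hf.
have {}hg : g (s *: x + y) = lact s (g x) + g y by apply: hg.
have E z : (r *: f + g) z = r *: f z + g z by [].
rewrite !E hf hg [RHS]/(lact s (r *: f x + g x) + (r *: f y + g y)).
by rewrite lactDr lactZ scalerDr addrACA.
Qed.
HB.instance Definition _ := GRing.isSubmodClosed.Build R^c
  (DProd (fun _ : N => bim_right U)) homS_pred homS_closed.

Definition HomS : rmodType R := submod homS_pred.
End HomS.

End HomModules.

Arguments HomR {S R} U M.
Arguments HomS {S R} U N.

Section HomFunctors.
Variables (S R : nzRingType) (U : bimodule S R).

Lemma homR_comp_closed (M M' : rmodType R) (h : {linear M -> M'})
    (f : HomR U M') : (fun x => val f (h x)) \in @homR_pred S R U M.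
Proof.
apply/asboolP => r x y; rewrite linearP.
by have /asboolP := valP f; apply.
Qed.
Definition HomR_map (M M' : rmodType R) (h : {linear M -> M'})
    (f : HomR U M') : HomR U M := Sub (fun x => val f (h x)) (homR_comp_closed h f).
Lemma HomR_map_linear (M M' : rmodType R) (h : {linear M -> M'}) :
  linear (HomR_map h).
Proof. by move=> s f g; apply: val_inj. Qed.
HB.instance Definition _ (M M' : rmodType R) (h : {linear M -> M'}) :=
  GRing.isLinear.Build S (HomR U M') (HomR U M) _ (HomR_map h) (HomR_map_linear h).

Lemma homS_comp_closed (N N' : lmodType S) (h : {linear N -> N'})
    (f : HomS U N') : (fun x => val f (h x)) \in @homS_pred S R U N.
Proof.
apply/asboolP => r x y; rewrite linearP.
by have /asboolP := valP f; apply.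
Qed.
Definition HomS_map (N N' : lmodType S) (h : {linear N -> N'})
    (f : HomS U N') : HomS U N := Sub (fun x => val f (h x)) (homS_comp_closed h f).
Lemma HomS_map_linear (N N' : lmodType S) (h : {linear N -> N'}) :
  linear (HomS_map h).
Proof. by move=> r f g; apply: val_inj. Qed.
HB.instance Definition _ (N N' : lmodType S) (h : {linear N -> N'}) :=
  GRing.isLinear.Build R^c (HomS U N') (HomS U N) _ (HomS_map h) (HomS_map_linear h).
End HomFunctors.

(* Hom_R(-, U) and Hom_S(-, U) restrict to the finitely generated modules, and  *)
(* both composites are naturally isomorphic to the identity functors there.     *)
Definition hom_duality (S R : nzRingType) (U : bimodule S R) :=
  [/\ forall M : rmodType R, fingen M -> fingen (HomR U M),
      forall N : lmodType S, fingen N -> fingen (HomS U N),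
      exists eta : forall M : rmodType R, {linear M -> HomS U (HomR U M)},
        (forall M, fingen M -> bijective (eta M)) /\
        (forall (M M' : rmodType R) (h : {linear M -> M'}),
           fingen M -> fingen M' ->
           forall x, eta M' (h x) = HomS_map (HomR_map h) (eta M x))
    & exists theta : forall N : lmodType S, {linear N -> HomR U (HomS U N)},
        (forall N, fingen N -> bijective (theta N)) /\
        (forall (N N' : lmodType S) (h : {linear N -> N'}),
           fingen N -> fingen N' ->
           forall x, theta N' (h x) = HomR_map (HomS_map h) (theta N x))].

Definition right_morita (R : nzRingType) :=
  exists (S : nzRingType) (U : bimodule S R), hom_duality U.

(* Main.v *)
Require Import Defs.
From HB Require Import structures.
From mathcomp Require Import all_boot all_algebra.
From mathcomp Require Import boolp classical_sets cardinality.

(** Over a right Morita ring R with duality bimodule U, finitely generated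
    right modules satisfy both chain conditions and U is an injective
    cogenerator.  For every C with Ext^i(C, C) = 0 (i >= 1), Y_C is the largest
    class of modules M in ^perp C admitting 0 -> M -> C' -> M' -> 0 with C' in
    add C and M' in the class; all closure properties of Y_C, and its maximality,
    follow by coinduction.

    If C is finitely generated and product-complete, the evaluation
    M -> C^Hom(M,C) of a finitely generated M factors through a finite power of
    C, so left add C-approximations exist.  When C is Wakamatsu cotilting, lifting
    along the Prod C-resolution of the injective cogenerator shows that iterated
    approximations of projectives stay injective, i.e. projectives lie in Y_C.

    Conversely, let C be a product-complete Ext-injective cogenerator of D.
    Maximality gives D = Y_C, and C may be replaced by its basic part.
    The modules N with Ext^1(L, N) = 0 for all finitely generated L in cogen*(C)
    with Ext^1(L, C) = 0 are generated by C, and the kernel of the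
    approximation C^(Hom(C,N)) -> N is again of this kind; so U is in
    gen*(Add C).  Finally C^(I) is a summand of C^I: C^I is a summand of some
    C^(J), inside which C^(I) is locally split, and a locally split sum of finite
    length indecomposables has a complement because radical maps between them
    are nilpotent.  Injectivity of C |-> Y_C is the Krull-Schmidt theorem. *)

Set Implicit Arguments.
Unset Strict Implicit.
Unset Printing Implicit Defensive.

Import GRing.Theory.
Local Open Scope ring_scope.

(** * Linear maps, kernels and cokernels *)

(** Ext is never formed as a group and no long exact sequence is set up: vanishing of Ext^1 is an
    extension property of maps, higher vanishing is stability of a class under syzygies, and each
    exact stretch that is used becomes one diagram chase. Infinite resolutions are opened by a
    one-step unfolding and built by a coinduction principle, so later arguments handle a single
    short exact sequence. For Y_C, closure under extensions is proved before closure under summands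
    and kernels, because there the cokernel of the new embedding is controlled through an extension
    of members of Y_C.

    The converse meets a mismatch: the definition of Wakamatsu cotilting resolves Q by products of
    C, whereas the cover of a module assembled from all maps out of C is a direct sum.
    Product-completeness puts Prod C inside Add C; the splitting of C^(I) in C^I supplies the
    opposite direction. *)

Definition mklin (A : nzRingType) (U V : lmodType A) (f : U -> V)
    (h : linear f) : {linear U -> V} :=
  HB.pack f (GRing.isLinear.Build A U V _ f h).

Section LinearMaps.
Variable A : nzRingType.
Implicit Types U V W M N : lmodType A.

Definition lcomp U V W (g : {linear V -> W}) (f : {linear U -> V}) :
  {linear U -> W} := g \o f.
Definition lid U : {linear U -> U} := idfun.
Definition lzero U V : {linear U -> V} := \0.
Definition ladd U V (f g : {linear U -> V}) : {linear U -> V} := f \+ g.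

Lemma lsub_linear U V (f g : {linear U -> V}) : linear (fun x => f x - g x).
Proof. by move=> a x y /=; rewrite (linearP f) (linearP g) scalerBr opprD addrACA. Qed.
Definition lsub U V (f g : {linear U -> V}) := mklin (lsub_linear f g).

Lemma lsum_linear U V (I : Type) (s : seq I) (f : I -> {linear U -> V}) :
  linear (fun x => \sum_(i <- s) f i x).
Proof.
move=> a x y /=; rewrite scaler_sumr -big_split /=.
by apply: eq_bigr => i _; rewrite linearP.
Qed.
Definition lsum U V (I : Type) (s : seq I) (f : I -> {linear U -> V}) :=
  mklin (lsum_linear s f).

Lemma lin_lift U V W (j : {linear U -> V}) (h : {linear W -> V}) :
  injective j -> (forall w, exists u, j u = h w) ->
  exists h' : {linear W -> U}, forall w, j (h' w) = h w.
Proof.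
move=> jI /choice[g gE].
have gl : linear g by move=> a x y; apply: jI; rewrite linearP !gE linearP.
by exists (mklin gl) => w; rewrite gE.
Qed.

Lemma lin_desc U V W (p : {linear U -> V}) (h : {linear U -> W}) :
  surj p -> (forall x, p x = 0 -> h x = 0) ->
  exists h' : {linear V -> W}, forall x, h' (p x) = h x.
Proof.
move=> pS ph; have /choice[g gE] := pS.
have hE x y : p x = p y -> h x = h y.
  by move=> e; apply/eqP; rewrite -subr_eq0 -linearB ph // linearB e subrr.
have gl : linear (h \o g).
  by move=> a x y /=; rewrite -linearP; apply: hE; rewrite linearP !gE.
by exists (mklin gl) => x; apply: hE; rewrite gE.
Qed.

Lemma lin_inv U V (f : {linear U -> V}) : bijective f ->
  exists g : {linear V -> U}, cancel f g /\ cancel g f.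
Proof.
move=> [g fg gf]; have gl : linear g.
  by move=> a x y; apply: (can_inj fg); rewrite linearP !gf.
by exists (mklin gl).
Qed.

Lemma inj_surj_bij U V (f : {linear U -> V}) :
  injective f -> surj f -> bijective f.
Proof.
by move=> fI /choice[g gE]; exists g => // x; apply: fI; rewrite gE.
Qed.

Lemma lin_injP U V (f : {linear U -> V}) :
  (forall x, f x = 0 -> x = 0) -> injective f.
Proof.
move=> h x y e; apply/eqP; rewrite -subr_eq0; apply/eqP/h.
by rewrite linearB e subrr.
Qed.

Lemma bij_surj U V (f : {linear U -> V}) : bijective f -> surj f.
Proof. by move=> [g _ gf] y; exists (g y). Qed.

Lemma isom_refl M : isom M M.
Proof. by exists (lid M); exists id. Qed.
Lemma isom_sym M N : isom M N -> isom N M.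
Proof. by move=> [f /lin_inv[g [fg gf]]]; exists g; exists f. Qed.
Lemma isom_trans M N U : isom M N -> isom N U -> isom M U.
Proof. by move=> [f bf] [g bg]; exists (lcomp g f); apply: bij_comp. Qed.

(** Summands are used in this form because it composes without carrying complements; [retractP]
    recovers a complement as the kernel of the retraction. *)
Definition retract M N := exists (i : {linear M -> N}) (r : {linear N -> M}),
  forall x, r (i x) = x.

Lemma retract_refl M : retract M M.
Proof. by exists (lid M), (lid M). Qed.
Lemma retract_trans M N U : retract M N -> retract N U -> retract M U.
Proof.
move=> [i [r ri]] [j [s sj]]; exists (lcomp j i), (lcomp r s) => x /=.
by rewrite sj ri.
Qed.
Lemma isom_retract M N : isom M N -> retract M N.
Proof. by move=> [f /lin_inv[g [fg gf]]]; exists f, g. Qed.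

(** Inclusions, projections and induced maps are extracted from opaque sigma types, here and below,
    so that later proofs see their characteristic properties and never the carriers. *)
Lemma kerval_sig U V (f : {linear U -> V}) :
  {k : {linear Ker f -> U} | injective k /\ exact_at k f}.
Proof.
have kl : linear (val : Ker f -> U) by [].
exists (mklin kl); split=> [|y]; first exact: val_inj.
split=> [/eqP fx|[x <-]]; last by apply/eqP; apply: (valP x).
have xK : y \in ker_pred f by [].
by exists (Sub y xK).
Qed.
Definition kerval U V (f : {linear U -> V}) : {linear Ker f -> U} :=
  sval (kerval_sig f).
Lemma kerval_inj U V (f : {linear U -> V}) : injective (kerval f).
Proof. by case: (svalP (kerval_sig f)). Qed.
Lemma ker_exact U V (f : {linear U -> V}) : exact_at (kerval f) f.
Proof. by case: (svalP (kerval_sig f)). Qed.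
Lemma kerval_ex U V (f : {linear U -> V}) x :
  f x = 0 -> exists y, kerval f y = x.
Proof. by move/ker_exact. Qed.
Lemma kervalK U V (f : {linear U -> V}) x : f (kerval f x) = 0.
Proof. by apply/ker_exact; exists x. Qed.
Lemma ker_short_exact U V (f : {linear U -> V}) :
  surj f -> short_exact (kerval f) f.
Proof. by split=> //; [exact: kerval_inj|exact: ker_exact]. Qed.

Lemma cokerproj_sig U V (f : {linear U -> V}) :
  {p : {linear V -> Coker f} | exact_at f p /\ surj p}.
Proof.
have pl : linear (@quot_proj A V (im_pred f) : V -> Coker f).
  by move=> a x y; rewrite quot_projD; congr (_ + _); rewrite -quot_scaleE.
exists (mklin pl); split=> [y|y]; last by exists (repr y); apply: quot_projK.
rewrite -(linear0 (mklin pl)); split.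
  by move=> /quot_projP; rewrite subr0 => /asboolP.
by move=> h; apply/quot_projP; rewrite subr0; apply/asboolP.
Qed.
Definition cokerproj U V (f : {linear U -> V}) : {linear V -> Coker f} :=
  sval (cokerproj_sig f).
Lemma coker_exact U V (f : {linear U -> V}) : exact_at f (cokerproj f).
Proof. by case: (svalP (cokerproj_sig f)). Qed.
Lemma cokerproj_surj U V (f : {linear U -> V}) : surj (cokerproj f).
Proof. by case: (svalP (cokerproj_sig f)). Qed.
Lemma coker_short_exact U V (f : {linear U -> V}) :
  injective f -> short_exact f (cokerproj f).
Proof. by split=> //; [exact: coker_exact|exact: cokerproj_surj]. Qed.

Lemma pair1_linear U V : linear (fun x : U => (x, 0 : V)).
Proof. by move=> a x y; apply: injective_projections; rewrite /= ?scaler0 ?addr0. Qed.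
Definition pair1 U V : {linear U -> (U * V)%type} := mklin (@pair1_linear U V).
Lemma pair2_linear U V : linear (fun x : V => (0 : U, x)).
Proof. by move=> a x y; apply: injective_projections; rewrite /= ?scaler0 ?addr0. Qed.
Definition pair2 U V : {linear V -> (U * V)%type} := mklin (@pair2_linear U V).
Definition lfst U V : {linear (U * V)%type -> U} := fst.
Definition lsnd U V : {linear (U * V)%type -> V} := snd.
Lemma lpair_linear U V W (f : {linear W -> U}) (g : {linear W -> V}) :
  linear (fun x => (f x, g x)).
Proof. by move=> a x y; apply: injective_projections; rewrite /= linearP. Qed.
Definition lpair U V W (f : {linear W -> U}) (g : {linear W -> V}) :
  {linear W -> (U * V)%type} := mklin (lpair_linear f g).
Definition lcopair U V W (f : {linear U -> W}) (g : {linear V -> W}) :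
  {linear (U * V)%type -> W} := ladd (lcomp f (@lfst U V)) (lcomp g (@lsnd U V)).

Lemma retractP M N : iso_to_summand M N <-> retract M N.
Proof.
split=> [[M' [f /lin_inv[g [fg gf]]]]|[i [r ri]]].
  exists (lcomp g (pair1 M M')), (lcomp (@lfst M M') f) => x /=.
  by rewrite gf.
exists (Ker r).
have [q qE] : exists q : {linear N -> Ker r},
    forall x, kerval r (q x) = lsub (lid N) (lcomp i r) x.
  apply: lin_lift; first exact: kerval_inj.
  by move=> w; apply: kerval_ex; rewrite linearB /= ri subrr.
exists (lpair r q); exists (lcopair i (kerval r)) => [x|[x y]] /=.
  by rewrite qE /= addrC subrK.
have rx : r (i x + kerval r y) = x by rewrite linearD ri kervalK addr0.
congr pair; first exact: rx.
by apply: (@kerval_inj _ _ r); rewrite qE /= rx addrC addKr.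
Qed.

Lemma fingen_surj M N (f : {linear M -> N}) : surj f -> fingen M -> fingen N.
Proof.
move=> fS [n [g gE]]; exists n, (fun i => f (g i)) => y.
have [x <-] := fS y; have [a ->] := gE x; exists a.
by rewrite linear_sum; apply: eq_bigr => i _; rewrite linearZ.
Qed.
Lemma fingen_retract M N : retract M N -> fingen N -> fingen M.
Proof. by move=> [i [r ri]]; apply: (@fingen_surj _ _ r) => x; exists (i x). Qed.

Lemma fingen_prod M N : fingen M -> fingen N -> fingen (M * N)%type.
Proof.
move=> [n [g gE]] [m [h hE]].
exists (n + m)%N, (fun k => match split k with
  | inl i => pair1 M N (g i) | inr j => pair2 M N (h j) end) => -[x y].
have [a ->] := gE x; have [b ->] := hE y.
exists (fun k => match split k with inl i => a i | inr j => b j end).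
have eL i : split (lshift m i) = inl i := unsplitK (inl i).
have eR i : split (rshift n i) = inr i := unsplitK (inr i).
rewrite big_split_ord /=.
rewrite [X in _ = X + _](_ : _ = pair1 M N (\sum_(i < n) a i *: g i)); last first.
  by rewrite linear_sum; apply: eq_bigr => i _; rewrite eL linearZ.
rewrite [X in _ = _ + X](_ : _ = pair2 M N (\sum_(i < m) b i *: h i)); last first.
  by rewrite linear_sum; apply: eq_bigr => i _; rewrite eR linearZ.
by apply: injective_projections; rewrite /= ?addr0 ?add0r.
Qed.

Definition issub M (P : M -> Prop) :=
  P 0 /\ forall a x y, P x -> P y -> P (a *: x + y).

Lemma issubD M (P : M -> Prop) x y : issub P -> P x -> P y -> P (x + y).
Proof. by move=> [_ h] px py; rewrite -[x]scale1r; apply: h. Qed.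
Lemma issubZ M (P : M -> Prop) a x : issub P -> P x -> P (a *: x).
Proof. by move=> [h0 h] px; rewrite -[a *: x]addr0; apply: h. Qed.
Lemma issubB M (P : M -> Prop) x y : issub P -> P x -> P y -> P (x - y).
Proof. by move=> h px py; rewrite addrC -scaleN1r; apply: h.2. Qed.
Lemma issub_sum M (P : M -> Prop) (I : Type) (s : seq I) (F : I -> M) :
  issub P -> (forall i, P (F i)) -> P (\sum_(i <- s) F i).
Proof.
move=> h hF; elim/big_ind: _ => //; first exact: h.1.
by move=> x y; apply: issubD.
Qed.

(** The closure proof is an argument so that the submodule structure can be inferred from the term
    [sub_pred h] itself. *)
Definition sub_pred M (P : M -> Prop) (_ : issub P) : {pred M} :=
  fun x => `[< P x >].
Lemma sub_pred_closed M (P : M -> Prop) (h : issub P) :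
  submod_closed (sub_pred h).
Proof.
split=> [|a x y]; first by apply/asboolP; apply: h.1.
by move=> /asboolP px /asboolP py; apply/asboolP; apply: h.2.
Qed.
HB.instance Definition _ M (P : M -> Prop) (h : issub P) :=
  GRing.isSubmodClosed.Build A M (sub_pred h) (sub_pred_closed h).
Definition subm M (P : M -> Prop) (h : issub P) : lmodType A :=
  submod (sub_pred h).
Lemma subval_sig M (P : M -> Prop) (h : issub P) :
  {j : {linear subm h -> M} |
    injective j /\ forall x, P x <-> exists y, j y = x}.
Proof.
have kl : linear (val : subm h -> M) by [].
exists (mklin kl); split=> [|y]; first exact: val_inj.
split=> [px|[x <-]]; last by apply/asboolP; apply: (valP x).
have xK : y \in sub_pred h by apply/asboolP.
by exists (Sub y xK).
Qed.
Definition subval M (P : M -> Prop) (h : issub P) : {linear subm h -> M} :=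
  sval (subval_sig h).
Lemma subval_inj M (P : M -> Prop) (h : issub P) : injective (subval h).
Proof. by case: (svalP (subval_sig h)). Qed.
Lemma subvalE M (P : M -> Prop) (h : issub P) x :
  P x <-> exists y, subval h y = x.
Proof. by case: (svalP (subval_sig h)). Qed.
Lemma subvalP M (P : M -> Prop) (h : issub P) x : P (subval h x).
Proof. by apply/(subvalE h); exists x. Qed.
Lemma subval_ex M (P : M -> Prop) (h : issub P) x :
  P x -> exists y, subval h y = x.
Proof. by move/(subvalE h). Qed.

End LinearMaps.

(** * Sums, products and projectives *)

Section SumsProducts.
Variables (A : nzRingType) (J : Type) (X : J -> lmodType A).

Lemma pproj_sig j : {p : {linear DProd X -> X j} | forall f, p f = f j}.
Proof.
have pl : linear (fun f : DProd X => f j) by [].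
by exists (mklin pl).
Qed.
Definition pproj j := sval (pproj_sig j).
Lemma pprojE j f : pproj j f = f j.
Proof. exact: (svalP (pproj_sig j)). Qed.

Lemma dprod_ext (x y : DProd X) : (forall j, pproj j x = pproj j y) -> x = y.
Proof.
by move=> h; apply: functional_extensionality_dep => j; move: (h j); rewrite !pprojE.
Qed.

Lemma ptuple_sig (W : lmodType A) (f : forall j, {linear W -> X j}) :
  {g : {linear W -> DProd X} | forall j w, pproj j (g w) = f j w}.
Proof.
have gl : linear (fun w => (fun j => f j w) : DProd X).
  by move=> a x y; apply: functional_extensionality_dep => j; rewrite linearP.
by exists (mklin gl) => j w; rewrite pprojE.
Qed.
Definition ptuple (W : lmodType A) (f : forall j, {linear W -> X j}) :=
  sval (ptuple_sig f).
Lemma ptupleE (W : lmodType A) (f : forall j, {linear W -> X j}) j w :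
  pproj j (ptuple f w) = f j w.
Proof. exact: (svalP (ptuple_sig f)). Qed.

(** Equality of indices is decided classically, and the value is transported because [X] depends on
    the index; [Prop_irrelevance] erases the transport along a loop. *)
Definition inj_fun j (x : X j) : DProd X := fun k =>
  match pselect (j = k) with
  | left e => eq_rect j (fun k => X k) x k e
  | right _ => 0
  end.
Lemma inj_fun_id j (x : X j) : inj_fun x j = x.
Proof.
by rewrite /inj_fun; case: pselect => // e; rewrite (Prop_irrelevance e (erefl j)).
Qed.
Lemma inj_fun_neq j k (x : X j) : j <> k -> inj_fun x k = 0.
Proof. by rewrite /inj_fun; case: pselect. Qed.
Lemma inj_fun_linear j : linear (@inj_fun j).
Proof.
move=> a x y; apply: dprod_ext => k; rewrite linearP !pprojE.
have [e|e] := pselect (j = k); last by rewrite !inj_fun_neq // scaler0 addr0.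
by case: k / e; rewrite !inj_fun_id.
Qed.
Lemma inj_fun_supp j (x : X j) : inj_fun x \in @finsupp_pred A J X.
Proof.
apply/asboolP; apply: (@sub_finite_set _ _ [set j]%classic); last first.
  exact: finite_set1.
by move=> k /= h; apply: contrapT => e; apply: h; rewrite inj_fun_neq // => /esym.
Qed.

Lemma sinj_linear j : linear (fun x : X j => Sub (inj_fun x) (inj_fun_supp x) : DSum X).
Proof. by move=> a x y; apply: val_inj; rewrite /= inj_fun_linear. Qed.

Lemma sincl_sig : {i : {linear DSum X -> DProd X} | forall x, i x = val x}.
Proof.
have il : linear (val : DSum X -> DProd X) by [].
by exists (mklin il).
Qed.
Definition sincl := sval sincl_sig.
Lemma sinclE x : sincl x = val x.
Proof. exact: (svalP sincl_sig). Qed.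
Lemma sincl_inj : injective sincl.
Proof. by move=> x y; rewrite !sinclE => /val_inj. Qed.

Lemma sproj_sig j : {p : {linear DSum X -> X j} | forall x, p x = val x j}.
Proof.
have pl : linear (fun x : DSum X => val x j) by [].
by exists (mklin pl).
Qed.
Definition sproj j := sval (sproj_sig j).
Lemma sprojE j x : sproj j x = val x j.
Proof. exact: (svalP (sproj_sig j)). Qed.
Lemma pproj_sincl j x : pproj j (sincl x) = sproj j x.
Proof. by rewrite pprojE sinclE sprojE. Qed.

Lemma sinj_sig j : {i : {linear X j -> DSum X} |
  (forall x, sproj j (i x) = x) /\ (forall k x, j <> k -> sproj k (i x) = 0)}.
Proof.
exists (mklin (@sinj_linear j)); split=> [x|k x]; rewrite sprojE.
  exact: inj_fun_id.
exact: inj_fun_neq.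
Qed.
Definition sinj j := sval (sinj_sig j).
Lemma sinjK j x : sproj j (sinj j x) = x.
Proof. by case: (svalP (sinj_sig j)). Qed.
Lemma sinj0 j k x : j <> k -> sproj k (sinj j x) = 0.
Proof. by case: (svalP (sinj_sig j)) => _; apply. Qed.

Lemma dsum_ext (x y : DSum X) : (forall j, sproj j x = sproj j y) -> x = y.
Proof.
by move=> h; apply: sincl_inj; apply: dprod_ext => j; rewrite !pproj_sincl.
Qed.

(** [{classic J}] equips the arbitrary index type with decidable equality, so that lists of indices
    have membership and [uniq]. *)
Lemma dsum_supp (x : DSum X) : exists2 s : seq {classic J}, uniq s &
  forall j, sproj j x <> 0 -> (j : {classic J}) \in s.
Proof.
have /asboolP := valP x; move=> /(@finite_seqP {classic J})[s sE].
exists (undup s); first exact: undup_uniq.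
move=> j xj; rewrite mem_undup.
have: [set j : {classic J} | val x j <> 0]%classic j by rewrite /= -sprojE.
by rewrite sE.
Qed.

Lemma sproj_sum (s : seq {classic J}) (F : forall j, X j) k : uniq s ->
  sproj k (\sum_(j <- s) sinj j (F j)) = if (k : {classic J}) \in s then F k else 0.
Proof.
rewrite linear_sum; elim: s => [|j s IH] /=; first by rewrite big_nil.
move=> /andP[js us]; rewrite big_cons IH // in_cons; case: eqP => [e|e].
  by case: j / e js => /negPf ->; rewrite sinjK addr0.
by rewrite sinj0 ?add0r // => /esym.
Qed.

Lemma dsum_sumE (x : DSum X) (s : seq {classic J}) : uniq s ->
  (forall j, sproj j x <> 0 -> (j : {classic J}) \in s) ->
  x = \sum_(j <- s) sinj j (sproj j x).
Proof.
move=> us h; apply: dsum_ext => k.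
rewrite (sproj_sum (fun j => sproj j x)) //; case: ifP => // /negP ks.
by apply: contrapT => /h.
Qed.

Lemma dsum_sum (x : DSum X) : exists s : seq J,
  x = \sum_(j <- s) sinj j (sproj j x).
Proof. by have [s us h] := dsum_supp x; exists s; apply: dsum_sumE. Qed.

Lemma dsum_ind (P : DSum X -> Prop) : issub P ->
  (forall j x, P (sinj j x)) -> forall x, P x.
Proof. by move=> h hi x; have [s ->] := dsum_sum x; apply: issub_sum. Qed.

(** The map sums over a chosen list containing the support. Linearity requires independence of the
    list, since the lists chosen for [x], [y] and [a *: x + y] are unrelated. *)
Lemma dsum_desc (N : lmodType A) (f : forall j, {linear X j -> N}) :
  {g : {linear DSum X -> N} | forall j x, g (sinj j x) = f j x}.
Proof.
apply: cid.
have /choice[s sP] : forall x : DSum X, exists s : seq {classic J}, uniq s /\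
    forall j, sproj j x <> 0 -> (j : {classic J}) \in s.
  by move=> x; have [s us h] := dsum_supp x; exists s.
pose g (x : DSum X) := \sum_(j <- s x) f j (sproj j x).
have gE x (t : seq {classic J}) : uniq t ->
    (forall j, sproj j x <> 0 -> (j : {classic J}) \in t) ->
    g x = \sum_(j <- t) f j (sproj j x).
  move=> ut ht; have [us hs] := sP x.
  (* Once the zero terms are dropped, both lists are duplicate-free with the same members, hence
     permutations of each other. *)
  have E (r : seq {classic J}) : \sum_(j <- r) f j (sproj j x) =
      \sum_(j <- [seq j <- r | sproj j x != 0]) f j (sproj j x).
    rewrite big_filter [RHS]big_mkcond; apply: eq_bigr => j _.
    by case: ifP => // /negbFE/eqP ->; rewrite linear0.
  rewrite /g (E (s x)) (E t); apply: (perm_big (I := {classic J})); apply: uniq_perm.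
  - exact: filter_uniq.
  - exact: filter_uniq.
  move=> j; rewrite !mem_filter; case: eqP => //= /[dup] /ht -> /hs -> //.
have gl : linear g.
  move=> a x y; pose t := undup (s x ++ s y).
  have ut : uniq t by apply: undup_uniq.
  have hx j : sproj j x <> 0 -> (j : {classic J}) \in t.
    by move=> /(sP x).2 h; rewrite mem_undup mem_cat h.
  have hy j : sproj j y <> 0 -> (j : {classic J}) \in t.
    by move=> /(sP y).2 h; rewrite mem_undup mem_cat h orbT.
  rewrite (gE x t) // (gE y t) // (gE _ t) //.
    rewrite scaler_sumr -big_split; apply: eq_bigr => j _ /=.
    by rewrite !linearP.
  move=> j; rewrite linearP => h; apply: contrapT => jt; apply: h.
  have -> : sproj j x = 0 by apply: contrapT => /hx.
  have -> : sproj j y = 0 by apply: contrapT => /hy.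
  by rewrite scaler0 addr0.
exists (mklin gl) => j x /=.
rewrite (gE _ [:: j : {classic J}]) // ?big_seq1 ?sinjK //.
move=> k h; rewrite inE; apply/eqP; apply: contrapT => e.
by apply: h; apply: sinj0 => /esym.
Qed.
Definition sdesc (N : lmodType A) (f : forall j, {linear X j -> N}) :=
  sval (dsum_desc f).
Lemma sdescE (N : lmodType A) (f : forall j, {linear X j -> N}) j x :
  sdesc f (sinj j x) = f j x.
Proof. exact: (svalP (dsum_desc f)). Qed.

Lemma dsum_eq (N : lmodType A) (f g : {linear DSum X -> N}) :
  (forall j x, f (sinj j x) = g (sinj j x)) -> forall x, f x = g x.
Proof.
move=> h; apply: dsum_ind => //; split=> [|a x y fx fy]; first by rewrite !linear0.
by rewrite !linearP fx fy.
Qed.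

Lemma projective_dsum : (forall j, projective (X j)) -> projective (DSum X).
Proof.
move=> hX U V p f pS.
(* This form of choice has a fixed codomain, so each index receives a whole family of maps, of which
   only the diagonal member [g j j] is used. *)
have /boolp.choice[g gE] : forall j : J, exists g : forall j, {linear X j -> U},
    forall x, p (g j x) = f (sinj j x).
  move=> j.
  have [g gE] := hX j U V p (lcomp f (sinj j)) pS.
  suff [h hE] : exists h : forall k, {linear X k -> U}, h j = g.
    by exists h; rewrite hE.
  exists (fun k => match pselect (j = k) with
    | left e => eq_rect j (fun k => {linear X k -> U}) g k e
    | right _ => lzero _ _ end).
  by case: pselect => // e; rewrite (Prop_irrelevance e (erefl j)).
exists (sdesc (fun j => g j j)) => x.
rewrite -[LHS]/(lcomp p (sdesc (fun j => g j j)) x); move: x.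
by apply: dsum_eq => j x /=; rewrite sdescE gE.
Qed.
End SumsProducts.

Arguments pproj {A J X} j.
Arguments sproj {A J X} j.
Arguments sinj {A J X} j.
Arguments sincl {A J} X.

Section Projectives.
Variable A : nzRingType.
Implicit Types U V W M N P : lmodType A.

Definition reg : lmodType A := A^o.
Definition reg1 : reg := (1 : A).

Lemma elt_linear M (m : M) : linear (fun a : reg => (a : A) *: m).
Proof. by move=> a x y; rewrite scalerDl -scalerA. Qed.
Definition elt M (m : M) : {linear reg -> M} := mklin (elt_linear m).
Lemma elt1 M (m : M) : elt m reg1 = m.
Proof. exact: scale1r. Qed.
Lemma regE (a : reg) : a = (a : A) *: reg1 :> reg.
Proof. by rewrite -[RHS]/((a : A) * 1) mulr1. Qed.

Lemma reg_eq N (f g : {linear reg -> N}) : f reg1 = g reg1 -> forall x, f x = g x.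
Proof. by move=> e x; rewrite [x]regE !linearZ; congr (_ *: _). Qed.

Lemma projective_reg : projective reg.
Proof.
move=> U V p f pS; have [u uE] := pS (f reg1); exists (elt u) => x.
rewrite -[LHS]/(lcomp p (elt u) x); move: x; apply: reg_eq.
by rewrite -uE /= scale1r.
Qed.

Lemma fingen_reg : fingen reg.
Proof.
exists 1%N, (fun _ => reg1) => x; exists (fun _ => x).
by rewrite big_ord1 -regE.
Qed.

Lemma projective_retract M N : retract M N -> projective N -> projective M.
Proof.
move=> [i [r ri]] hN U V p f pS.
have [g gE] := hN U V p (lcomp f r) pS.
by exists (lcomp g i) => x; rewrite /= gE /= ri.
Qed.

Lemma projective_prod M N : projective M -> projective N -> projective (M * N)%type.
Proof.
move=> hM hN U V p f pS.
have [g gE] := hM U V p (lcomp f (pair1 M N)) pS.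
have [h hE] := hN U V p (lcomp f (pair2 M N)) pS.
exists (lcopair g h) => -[x y] /=; rewrite linearD gE hE /= -linearD.
by congr (f _); apply: injective_projections; rewrite /= ?addr0 ?add0r.
Qed.

Lemma projective_split M N (p : {linear N -> M}) : projective M -> surj p ->
  exists s : {linear M -> N}, forall x, p (s x) = x.
Proof. by move=> hM pS; apply: (hM N M p (lid M) pS). Qed.

Lemma enough_projectives M : exists P (p : {linear P -> M}), projective P /\ surj p.
Proof.
exists (DSum (fun _ : M => reg)), (sdesc (fun m => elt m)); split.
  by apply: projective_dsum => _; apply: projective_reg.
by move=> m; exists (sinj m reg1); rewrite sdescE elt1.
Qed.

Lemma fingen_dsum n (X : 'I_n -> lmodType A) :
  (forall i, fingen (X i)) -> fingen (DSum X).
Proof.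
elim: n X => [|n IH] X hX.
  exists 0%N, (fun i => 0) => x; exists (fun i => 0); rewrite big_ord0.
  by apply: dsum_ext => -[].
pose X' i := X (lift ord0 i).
pose f := lcopair (sinj (X := X) ord0)
  (sdesc (X := X') (fun i => sinj (X := X) (lift ord0 i))).
apply: (@fingen_surj _ _ _ f); last first.
  by apply: fingen_prod => //; apply: IH => i; apply: hX.
move=> y; move: y; apply: dsum_ind.
  split; first by exists 0; rewrite linear0.
  by move=> a _ _ [x <-] [y <-]; exists (a *: x + y); rewrite linearP.
move=> j; case: (unliftP ord0 j) => [k ->|->] x.
  exists (pair2 _ _ (sinj (X := X') k x)); rewrite /= linear0 add0r.
  by rewrite sdescE.
by exists (pair1 _ _ x); rewrite /= linear0 addr0.
Qed.

Lemma fingen_projective_cover M : fingen M ->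
  exists P (p : {linear P -> M}), [/\ projective P, fingen P & surj p].
Proof.
move=> [n [g gE]].
exists (DSum (fun _ : 'I_n => reg)), (sdesc (fun i => elt (g i))); split.
- by apply: projective_dsum => _; apply: projective_reg.
- by apply: fingen_dsum => _; apply: fingen_reg.
move=> m; have [a ->] := gE m.
exists (\sum_(i < n) a i *: sinj i reg1); rewrite linear_sum.
by apply: eq_bigr => i _; rewrite linearZ /= sdescE elt1.
Qed.
End Projectives.

(** * Vanishing of Ext and the classes cogen* and gen* *)

Section Ext.
Variable A : nzRingType.
Implicit Types B C K E U V W M N P Z L : lmodType A.

(* Ext^1(M, N) = 0, without reference to projective resolutions. *)
Definition ext1_zero M N := forall K E (i : {linear K -> E}) (p : {linear E -> M}),
  short_exact i p -> forall f : {linear K -> N},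
  exists g : {linear E -> N}, forall x, g (i x) = f x.

Lemma short_exact0 K E M (i : {linear K -> E}) (p : {linear E -> M}) x :
  short_exact i p -> p (i x) = 0.
Proof. by case=> _ h _; apply/h; exists x. Qed.

(** [Z] is the kernel of [(e, m) |-> p e - h m]. The last clause is the universal property, through
    which alone later proofs map into [Z]. *)
Lemma pullback_se K E M M' (i : {linear K -> E}) (p : {linear E -> M})
    (h : {linear M' -> M}) : short_exact i p ->
  exists Z (i' : {linear K -> Z}) (p' : {linear Z -> M'}) (u : {linear Z -> E}),
  [/\ short_exact i' p', forall x, u (i' x) = i x, forall z, p (u z) = h (p' z)
    & forall W (a : {linear W -> E}) (b : {linear W -> M'}),
      (forall w, p (a w) = h (b w)) ->
      exists c : {linear W -> Z}, forall w, u (c w) = a w /\ p' (c w) = b w].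
Proof.
move=> hse; have [iI ex pS] := hse.
pose d := lsub (lcomp p (@lfst A E M')) (lcomp h (@lsnd A E M')).
pose k := kerval d.
have kE z : p (k z).1 = h (k z).2.
  by apply/eqP; rewrite -subr_eq0; apply/eqP; apply: (kervalK (f := d)).
have univ W (a : {linear W -> E}) (b : {linear W -> M'}) :
    (forall w, p (a w) = h (b w)) ->
    exists c : {linear W -> Ker d}, forall w, k (c w) = (a w, b w).
  move=> e; apply: (lin_lift (h := lpair a b)); first exact: kerval_inj.
  by move=> w; apply: kerval_ex; rewrite /= e subrr.
have [i' i'E] : exists c : {linear K -> Ker d}, forall w, k (c w) = (i w, 0).
  by apply: (univ K i (lzero K M')) => w; rewrite (short_exact0 _ hse) linear0.
exists (Ker d), i', (lcomp (@lsnd A E M') k), (lcomp (@lfst A E M') k).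
split=> [|x|z|W a b e] /=; last 3 first.
- by rewrite i'E.
- exact: kE.
- by have [c cE] := univ W a b e; exists c => w; rewrite cE.
split=> [x y e|y|m] /=.
- by apply: iI; have := congr1 fst (congr1 k e); rewrite !i'E.
- split=> [k2|[x <-]]; last by rewrite i'E.
  have /ex[x xE] : p (k y).1 = 0 by rewrite kE k2 linear0.
  exists x; apply: (@kerval_inj _ _ _ d); rewrite -/k i'E xE -k2.
  by case: (k y).
have [e eE] := pS (h m).
have [z zE] : exists z, k z = (e, m) by apply: kerval_ex; rewrite /= eE subrr.
by exists z; rewrite zE.
Qed.

(** The extension pulled back along [f] splits; correcting [u] by the retraction makes it vanish on
    the copy of [K], so it descends to [M]. *)
Lemma ext1_zero_lift K E M N (i : {linear K -> E}) (p : {linear E -> N}) :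
  short_exact i p -> ext1_zero M K -> forall f : {linear M -> N},
  exists g : {linear M -> E}, forall x, p (g x) = f x.
Proof.
move=> hse hx f; have [Z [i' [p' [u [hse' ui pu _]]]]] := pullback_se f hse.
have [r rE] := hx _ _ _ _ hse' (lid K); have [_ ex pS] := hse'.
have [g gE] : exists g : {linear M -> E},
    forall z, g (p' z) = lsub u (lcomp i r) z.
  by apply: lin_desc => // z /ex[x <-] /=; rewrite ui rE subrr.
exists g => x; have [z <-] := pS x.
by rewrite gE linearB /= (short_exact0 _ hse) subr0 pu.
Qed.

(** Pull an extension of [M] back along [r]. Since [r j = 1], the module [E] maps into the pullback
    by [w |-> (w, j (p w))], which is the identity on [K]. *)
Lemma ext1_zero_retract M M' N : retract M M' -> ext1_zero M' N -> ext1_zero M N.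
Proof.
move=> [j [r rj]] hx K E i p hse f.
have [Z [i' [p' [u [hse' ui pu univ]]]]] := pullback_se r hse.
have [c cE] : exists c : {linear E -> Z},
    forall w, u (c w) = w /\ p' (c w) = j (p w).
  by apply: (univ E (lid E) (lcomp j p)) => w /=; rewrite rj.
have [g gE] := hx _ _ _ _ hse' f.
exists (lcomp g c) => x /=; rewrite -gE; congr (g _).
have [_ ex _] := hse'.
have /ex[y yE] : p' (c (i x)) = 0 by rewrite (cE _).2 (short_exact0 _ hse) linear0.
have [iI _ _] := hse.
by rewrite -yE; congr (i' _); apply: iI; rewrite -ui yE (cE _).1.
Qed.

(** One projective presentation tests all extensions: any [E] is a quotient of [K' * P], and the map
    [(f, g)] kills the relations [(- t y, i y)]. *)
Lemma ext1_zero_cover K P M N (i : {linear K -> P}) (p : {linear P -> M}) :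
  short_exact i p -> projective P ->
  (forall f : {linear K -> N}, exists g : {linear P -> N}, forall x, g (i x) = f x) ->
  ext1_zero M N.
Proof.
move=> hse hP h K' E i' p' hse' f; have [iI ex pS] := hse; have [iI' ex' pS'] := hse'.
have [l lE] := hP _ _ p' p pS'.
have [t tE] : exists t : {linear K -> K'}, forall x, i' (t x) = lcomp l i x.
  by apply: lin_lift => // w; apply/ex'; rewrite /= lE (short_exact0 _ hse).
have [g gE] := h (lcomp f t).
have qS : surj (lcopair i' l).
  move=> e; have [x xE] := pS (p' e).
  have /ex'[k kE] : p' (e - l x) = 0 by rewrite linearB lE xE subrr.
  by exists (k, x); rewrite /= kE subrK.
have [g' g'E] : exists g' : {linear E -> N},
    forall x, g' (lcopair i' l x) = lcopair f g x.
  apply: lin_desc => // -[k x] /= e.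
  have /ex[y yE] : p x = 0.
    have := congr1 p' e; rewrite linearD (short_exact0 _ hse') add0r lE linear0 //.
  have kE : k = - t y.
    apply: iI'; rewrite linearN tE /= yE; apply/eqP.
    by rewrite -subr_eq0 opprK e.
  by rewrite kE -yE gE /= linearN addNr.
exists g' => x; have := g'E (x, 0); rewrite /= !linear0 !addr0; exact.
Qed.

(** A chosen projective mapping onto [M]; no minimality is meant. *)
Definition pcov M : lmodType A := sval (cid (enough_projectives M)).
Definition pmap M : {linear pcov M -> M} :=
  sval (cid (svalP (cid (enough_projectives M)))).
Lemma pcov_projective M : projective (pcov M).
Proof. by case: (svalP (cid (svalP (cid (enough_projectives M))))). Qed.
Lemma pmap_surj M : surj (pmap M).
Proof. by case: (svalP (cid (svalP (cid (enough_projectives M))))). Qed.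
Lemma pmap_se M : short_exact (kerval (pmap M)) (pmap M).
Proof. exact: ker_short_exact (@pmap_surj M). Qed.

(** This is exactness of Hom(V,N) -> Hom(U,N) -> Ext^1(W,N) -> Ext^1(V,N). The kernel of the cover
    of [W] through [V] contains [Ker (pmap V)] with quotient [U]: extend [f] from the smaller kernel
    first, then correct by a map coming from [U]. *)
Lemma ext1_zero_coker U V W N (i : {linear U -> V}) (p : {linear V -> W}) :
  short_exact i p -> ext1_zero V N ->
  (forall f : {linear U -> N}, exists g : {linear V -> N}, forall x, g (i x) = f x) ->
  ext1_zero W N.
Proof.
move=> hse hV h; have [iI ex pS] := hse.
pose q := lcomp p (pmap V).
have qS : surj q.
  by move=> w; have [v <-] := pS w; have [z <-] := pmap_surj v; exists z.
apply: (ext1_zero_cover (ker_short_exact qS)); first exact: pcov_projective.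
move=> f.
have [j jE] : exists j : {linear Ker (pmap V) -> Ker q},
    forall x, kerval q (j x) = kerval (pmap V) x.
  apply: lin_lift; first exact: kerval_inj.
  by move=> w; apply: kerval_ex; rewrite /= kervalK linear0.
have [g gE] := hV _ _ _ _ (pmap_se V) (lcomp f j).
have [t tE] : exists t : {linear Ker q -> U},
    forall x, i (t x) = lcomp (pmap V) (kerval q) x.
  by apply: lin_lift => // w; apply/ex; apply: (kervalK (f := q)).
have tS : surj t.
  move=> u; have [z zE] := pmap_surj (i u).
  have [w wE] : exists w, kerval q w = z.
    by apply: kerval_ex; rewrite /= zE (short_exact0 _ hse).
  by exists w; apply: iI; rewrite tE /= wE zE.
have [a aE] : exists a : {linear U -> N},
    forall x, a (t x) = lsub f (lcomp g (kerval q)) x.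
  apply: lin_desc => // x tx /=.
  have [y yE] : exists y, kerval (pmap V) y = kerval q x.
    by apply: kerval_ex; rewrite -[LHS]/(lcomp (pmap V) (kerval q) x) -tE tx linear0.
  have xE : j y = x by apply: (@kerval_inj _ _ _ q); rewrite jE yE.
  by rewrite -yE gE /= xE subrr.
have [b bE] := h a.
exists (ladd g (lcomp b (pmap V))) => x /=.
rewrite -[pmap V _]/(lcomp (pmap V) (kerval q) x) -tE bE aE /=.
by rewrite addrC subrK.
Qed.

(** The preimage of [U] in [E] is the kernel of the composite, and it is an extension of [U] by
    [K]. *)
Lemma kernel_comp_short_exact K E U V W (i : {linear U -> V})
    (p : {linear V -> W}) (j : {linear K -> E}) (q : {linear E -> V}) :
  short_exact i p -> short_exact j q ->
  surj (lcomp p q) /\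
  exists (j' : {linear K -> Ker (lcomp p q)}) (q' : {linear Ker (lcomp p q) -> U}),
    short_exact j' q' /\ forall x, kerval (lcomp p q) (j' x) = j x.
Proof.
move=> hse hse'; have [iI ex pS] := hse; have [jI ex' qS] := hse'.
pose r := lcomp p q; split.
  by move=> w; have [v <-] := pS w; have [e <-] := qS v; exists e.
have [j' j'E] : exists j' : {linear K -> Ker r}, forall x, kerval r (j' x) = j x.
  apply: lin_lift; first exact: kerval_inj.
  by move=> w; apply: kerval_ex; rewrite /= (short_exact0 _ hse') linear0.
have [q' q'E] : exists q' : {linear Ker r -> U},
    forall x, i (q' x) = lcomp q (kerval r) x.
  by apply: lin_lift => // w; apply/ex; apply: (kervalK (f := r)).
exists j', q'; split=> //; split=> [x y e|y|u].
- by apply: jI; rewrite -!j'E e.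
- split=> [e|[x <-]].
    have /ex'[x xE] : q (kerval r y) = 0.
      by rewrite -[LHS]/(lcomp q (kerval r) y) -q'E e linear0.
    by exists x; apply: (@kerval_inj _ _ _ r); rewrite j'E.
  by apply: iI; rewrite q'E /= j'E (short_exact0 _ hse') linear0.
have [e eE] := qS (i u).
have [z zE] : exists z, kerval r z = e.
  by apply: kerval_ex; rewrite /= eE (short_exact0 _ hse).
by exists z; apply: iI; rewrite q'E /= zE.
Qed.

(** A map on [K] is extended in two stages, first to the preimage of [U] in [E] and then to [E],
    whose quotient by that preimage is [W]. *)
Lemma ext1_zero_ext U V W N (i : {linear U -> V}) (p : {linear V -> W}) :
  short_exact i p -> ext1_zero U N -> ext1_zero W N -> ext1_zero V N.
Proof.
move=> hse hU hW K E j q hse' f.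
have [rS [j' [q' [hse1 j'E]]]] := kernel_comp_short_exact hse hse'.
have [g gE] := hU _ _ _ _ hse1 f.
have [g' g'E] := hW _ _ _ _ (ker_short_exact rS) g.
by exists g' => x; rewrite -j'E g'E gE.
Qed.

(** This is exactness of Hom(M,B) -> Hom(M,N) -> Ext^1(M,K) -> Ext^1(M,B), with the first map
    onto. *)
Lemma ext1_zero_kernel K B N M (i : {linear K -> B}) (p : {linear B -> N}) :
  short_exact i p -> ext1_zero M B ->
  (forall f : {linear M -> N}, exists g : {linear M -> B}, forall x, p (g x) = f x) ->
  ext1_zero M K.
Proof.
move=> hse hM h U E j q hse' f; have [iI ex pS] := hse; have [jI ex' qS] := hse'.
have [g gE] := hM _ _ _ _ hse' (lcomp i f).
have [a aE] : exists a : {linear M -> N}, forall x, a (q x) = lcomp p g x.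
  by apply: lin_desc => // x /ex'[y <-] /=; rewrite gE (short_exact0 _ hse).
have [b bE] := h a.
have [c cE] : exists c : {linear E -> K}, forall x, i (c x) = lsub g (lcomp b q) x.
  by apply: lin_lift => // w; apply/ex; rewrite linearB /= bE aE subrr.
exists c => x; apply: iI; rewrite cE /= (short_exact0 _ hse') linear0 subr0 gE //.
Qed.

Lemma ext1_zero_projective M N : projective M -> ext1_zero M N.
Proof.
move=> hM K E i p hse f; have [iI ex pS] := hse.
have [s sE] := projective_split hM pS.
have [r rE] : exists r : {linear E -> K},
    forall x, i (r x) = lsub (lid E) (lcomp s p) x.
  by apply: lin_lift => // w; apply/ex; rewrite linearB /= sE subrr.
exists (lcomp f r) => x /=; congr (f _); apply: iI.
by rewrite rE /= (short_exact0 _ hse) linear0 subr0.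
Qed.

Lemma ext1_zero_injective M N : injective_module N -> ext1_zero M N.
Proof. by move=> hN K E i p [iI _ _] f; apply: hN. Qed.

Lemma dmap_sig (J : Type) (X Y : J -> lmodType A)
    (f : forall j, {linear X j -> Y j}) :
  {g : {linear DSum X -> DSum Y} | (forall j x, sproj j (g x) = f j (sproj j x)) /\
    forall j x, g (sinj j x) = sinj j (f j x)}.
Proof.
exists (sdesc (fun j => lcomp (sinj j) (f j))); split=> j x; last by rewrite sdescE.
rewrite -[LHS]/(lcomp (sproj j) (sdesc (fun j => lcomp (sinj j) (f j))) x).
rewrite -[RHS]/(lcomp (f j) (sproj j) x); move: x.
apply: dsum_eq => k x /=; rewrite sdescE /=.
have [e|e] := pselect (k = j); last by rewrite !sinj0 // linear0.
by move: x; case: _ / e => x; rewrite !sinjK.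
Qed.
Definition dmap (J : Type) (X Y : J -> lmodType A)
  (f : forall j, {linear X j -> Y j}) := sval (dmap_sig f).
Lemma dmap_proj (J : Type) (X Y : J -> lmodType A)
  (f : forall j, {linear X j -> Y j}) j x : sproj j (dmap f x) = f j (sproj j x).
Proof. by case: (svalP (dmap_sig f)). Qed.
Lemma dmap_inj (J : Type) (X Y : J -> lmodType A)
  (f : forall j, {linear X j -> Y j}) j x : dmap f (sinj j x) = sinj j (f j x).
Proof. by case: (svalP (dmap_sig f)). Qed.

Lemma dsum_short_exact (J : Type) (X Y Z : J -> lmodType A)
    (i : forall j, {linear X j -> Y j}) (p : forall j, {linear Y j -> Z j}) :
  (forall j, short_exact (i j) (p j)) -> short_exact (dmap i) (dmap p).
Proof.
move=> h; split=> [x y e|y|z].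
- apply: dsum_ext => j; have [iI _ _] := h j; apply: iI.
  by rewrite -!dmap_proj e.
- split=> [e|[x <-]]; last first.
    by apply: dsum_ext => j; rewrite !dmap_proj (short_exact0 _ (h j)) linear0.
  have hx j : exists x, i j x = sproj j y.
    by have [_ ex _] := h j; apply/ex; rewrite -dmap_proj e linear0.
  pose x j := sval (cid (hx j)).
  have xE j : i j (x j) = sproj j y by apply: (svalP (cid (hx j))).
  have [s sE] := dsum_sum y.
  exists (\sum_(j <- s) sinj j (x j)); rewrite [RHS]sE linear_sum.
  by apply: eq_bigr => j _; rewrite dmap_inj xE.
move: z; apply: dsum_ind.
  split; first by exists 0; rewrite linear0.
  by move=> a _ _ [x <-] [y <-]; exists (a *: x + y); rewrite linearP.
move=> j z; have [_ _ pS] := h j; have [y <-] := pS z.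
by exists (sinj j y); rewrite dmap_inj.
Qed.

Lemma ext1_zero_dsum (J : Type) (X : J -> lmodType A) N :
  (forall j, ext1_zero (X j) N) -> ext1_zero (DSum X) N.
Proof.
move=> h; apply: (ext1_zero_cover (dsum_short_exact (fun j => pmap_se (X j)))).
  by apply: projective_dsum => j; apply: pcov_projective.
move=> f.
have hg j : exists g : {linear pcov (X j) -> N},
    forall x, g (kerval (pmap (X j)) x) = f (sinj j x).
  exact: (h j _ _ _ _ (pmap_se (X j)) (lcomp f (sinj j))).
exists (sdesc (fun j => sval (cid (hg j)))) => x.
set g := sdesc _; set k := dmap _.
rewrite -[LHS]/(lcomp g k x); move: x; apply: dsum_eq => j x /=.
by rewrite dmap_inj sdescE (svalP (cid (hg j))).
Qed.

(* Ext^i(M, N) = 0 for all i >= 1, phrased coinductively through Ext^1 and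
   arbitrary syzygies. *)
Definition perp N M := exists W : lmodType A -> Prop,
  [/\ W M, forall M', W M' -> ext1_zero M' N &
      forall M', W M' -> forall K P (i : {linear K -> P}) (p : {linear P -> M'}),
        short_exact i p -> projective P -> W K].

Lemma perp_coind N (W : lmodType A -> Prop) :
  (forall M, W M -> ext1_zero M N) ->
  (forall M, W M -> forall K P (i : {linear K -> P}) (p : {linear P -> M}),
     short_exact i p -> projective P -> W K) ->
  forall M, W M -> perp N M.
Proof. by move=> h1 h2 M wM; exists W. Qed.

Lemma perp_ext1_zero N M : perp N M -> ext1_zero M N.
Proof. by move=> [W [wM h _]]; apply: h. Qed.
Lemma perp_syz N M K P (i : {linear K -> P}) (p : {linear P -> M}) :
  perp N M -> short_exact i p -> projective P -> perp N K.
Proof. by move=> [W [wM h h']] hse hP; exists W; split=> //; apply: h' hse hP. Qed.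

(** The witness class is [perp N] with [M] itself adjoined. *)
Lemma perp_intro N M : ext1_zero M N ->
  (forall K P (i : {linear K -> P}) (p : {linear P -> M}),
     short_exact i p -> projective P -> perp N K) -> perp N M.
Proof.
move=> h1 h2; apply: (@perp_coind N (fun M' => perp N M' \/ M' = M)); last by right.
  by move=> M' [/perp_ext1_zero|->].
move=> M' [hM'|e]; last by case: _ / (esym e) => K P i p hse hP; left; apply: h2 hse hP.
by move=> K P i p hse hP; left; apply: perp_syz hM' hse hP.
Qed.

(** Lifting [q] through [p] gives [s : P -> V], and then 0 -> L -> U * P -> V -> 0. Up to a
    projective summand, [U] thus becomes an extension of [V] by a syzygy of [W]. *)
Lemma mapping_cone_se U V W L P (i : {linear U -> V}) (p : {linear V -> W})
    (j : {linear L -> P}) (q : {linear P -> W}) :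
  short_exact i p -> short_exact j q -> projective P ->
  exists (a : {linear L -> (U * P)%type}) (s : {linear P -> V}),
    short_exact a (lcopair i s).
Proof.
move=> hse hse' hP; have [iI ex pS] := hse; have [jI ex' qS] := hse'.
have [s sE] := hP _ _ p q pS.
have [t tE] : exists t : {linear L -> U}, forall x, i (t x) = lcomp s j x.
  by apply: lin_lift => // w; apply/ex; rewrite /= sE (short_exact0 _ hse').
exists (lpair (lsub (lzero _ _) t) j), s; split=> [x y [_ /jI]//|[u x] /=|v].
  split=> [e|[y /= [<- <-]]]; last by rewrite sub0r linearN tE addNr.
  have /ex'[y yE] : q x = 0.
    by rewrite -sE -[s x](addKr (i u)) e addr0 linearN (short_exact0 _ hse) oppr0.
  exists y; rewrite /= sub0r yE; congr pair; apply: iI; rewrite linearN tE /= yE.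
  by apply/eqP; rewrite eqr_oppLR -addr_eq0 addrC e.
have [x xE] := qS (p v).
have /ex[u uE] : p (v - s x) = 0 by rewrite linearB sE xE subrr.
by exists (u, x); rewrite /= uE subrK.
Qed.

Lemma retract_fst U V : retract U (U * V)%type.
Proof. by exists (pair1 U V), (@lfst A U V). Qed.
Lemma retract_snd U V : retract V (U * V)%type.
Proof. by exists (pair2 U V), (@lsnd A U V). Qed.

(** The coinductive class consists of all kernels of epimorphisms between members of [perp N]. Ext^1
    vanishes because [U] is a summand of the mapping cone, an extension of [V] by a syzygy of
    [W]. *)
Lemma perp_left U V W N (i : {linear U -> V}) (p : {linear V -> W}) :
  short_exact i p -> perp N V -> perp N W -> perp N U.
Proof.
move=> hse hV hW.
apply: (@perp_coind N (fun U => exists V W (i : {linear U -> V}) (p : {linear V -> W}),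
  [/\ short_exact i p, perp N V & perp N W])); last by exists V, W, i, p.
  move=> {}U [{}V [{}W [{}i [{}p [{}hse {}hV {}hW]]]]].
  have hP := @pcov_projective W.
  have [a [s as_se]] := mapping_cone_se hse (pmap_se W) hP.
  apply: (ext1_zero_retract (@retract_fst U (pcov W))).
  apply: (ext1_zero_ext as_se); last exact: perp_ext1_zero.
  by apply: perp_ext1_zero; apply: perp_syz hW (pmap_se W) _.
move=> {}U [{}V [{}W [{}i [{}p [{}hse {}hV {}hW]]]]] K P j q hse' hP'.
have hP := @pcov_projective W.
have [a [s as_se]] := mapping_cone_se hse (pmap_se W) hP.
have hL := perp_syz hW (pmap_se W) hP.
have [jI exj qS] := hse'; have [aI exa asS] := as_se.
(* [Ker r] is a syzygy of [V], and 0 -> K -> Ker r -> Ker (pmap W) -> 0 presents [K] again as the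
   kernel of an epimorphism between members of [perp N]. *)
pose r := lcomp (lcopair i s) (lpair (lcomp q (@lfst A P (pcov W))) (@lsnd A P (pcov W))).
have rS : surj r.
  move=> v; have [[u x] <-] := asS v; have [y <-] := qS u.
  by exists (y, x).
have hK : perp N (Ker r).
  by apply: perp_syz hV (ker_short_exact rS) _; apply: projective_prod.
have [j' j'E] : exists j' : {linear K -> Ker r},
    forall x, kerval r (j' x) = lcomp (pair1 P (pcov W)) j x.
  apply: lin_lift; first exact: kerval_inj.
  by move=> w; apply: kerval_ex; rewrite /= (short_exact0 _ hse') !linear0 addr0.
have [t tE] : exists t : {linear Ker r -> Ker (pmap W)},
    forall x, a (t x) = lcomp (lpair (lcomp q (@lfst A P (pcov W)))
       (@lsnd A P (pcov W))) (kerval r) x.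
  apply: lin_lift => // w; apply/exa.
  exact: (kervalK (f := r)).
exists (Ker r), (Ker (pmap W)), j', t; split=> //; split=> [x y e|y|l].
- apply: jI; have := congr1 (kerval r) e; rewrite !j'E /=.
  by move=> /(congr1 fst).
- split=> [ty|[x <-]].
    have := tE y; rewrite ty linear0 /= => /esym[/exj[x xE] y2].
    exists x; apply: (@kerval_inj _ _ _ r); rewrite j'E /= xE -y2.
    by case: (kerval r y).
  by apply: aI; rewrite tE /= j'E /= (short_exact0 _ hse') linear0.
have [y yE] := qS (a l).1.
have [z zE] : exists z, kerval r z = (y, (a l).2).
  apply: kerval_ex; rewrite /= yE; exact: (short_exact0 l as_se).
exists z; apply: aI; rewrite tE /= zE /= yE; by case: (a l).
Qed.

Lemma perp_projective N P : projective P -> perp N P.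
Proof.
apply: (@perp_coind N (fun P => projective P)) => M hM; first exact: ext1_zero_projective.
move=> K E i p hse hE.
have [s sE] := projective_split hM (let: And3 _ _ pS := hse in pS).
have [iI ex pS] := hse.
apply: projective_retract hE; exists i.
have [r rE] : exists r : {linear E -> K},
    forall x, i (r x) = lsub (lid E) (lcomp s p) x.
  by apply: lin_lift => // w; apply/ex; rewrite linearB /= sE subrr.
by exists r => x; apply: iI; rewrite rE /= (short_exact0 _ hse) linear0 subr0.
Qed.

(** For a cover of [V] with kernel [K], the preimage of [U] is a syzygy of [W]. It maps onto [U]
    with kernel [K], so [perp_left] applies. *)
Lemma perp_ext U V W N (i : {linear U -> V}) (p : {linear V -> W}) :
  short_exact i p -> perp N U -> perp N W -> perp N V.
Proof.
move=> hse hU hW; apply: perp_intro.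
  by apply: (ext1_zero_ext hse); apply: perp_ext1_zero.
move=> K P j q hse' hP.
have [rS [j' [q' [hse1 _]]]] := kernel_comp_short_exact hse hse'.
exact: perp_left hse1 (perp_syz hW (ker_short_exact rS) hP) hU.
Qed.

Lemma pair_se U V : short_exact (pair1 U V) (@lsnd A U V).
Proof.
split=> [x y [] //|[x y] /=|y]; last by exists (0, y).
by split=> [->|[z [_ <-]]//]; exists x.
Qed.

Lemma perp_prod N U V : perp N U -> perp N V -> perp N (U * V)%type.
Proof. exact: perp_ext (pair_se U V). Qed.

(** A syzygy of [W] is the kernel of an epimorphism from [U * P] onto [V], so only Ext^1 of [W]
    itself has to be assumed. *)
Lemma perp_coker U V W N (i : {linear U -> V}) (p : {linear V -> W}) :
  short_exact i p -> perp N U -> perp N V -> ext1_zero W N -> perp N W.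
Proof.
move=> hse hU hV hW; apply: perp_intro; first exact: hW.
move=> K P j q hse' hP.
have [a [s as_se]] := mapping_cone_se hse hse' hP.
apply: (perp_left as_se _ hV); apply: perp_prod; first exact: hU.
exact: perp_projective.
Qed.

(** One extra index absorbs into the direct sum the projective summand that [syzygy_retract]
    produces. *)
Lemma retract_option_dsum (J : Type) (X : J -> lmodType A) P :
  retract (DSum X * P)%type
    (DSum (fun o : option J => if o is Some j then X j else P)).
Proof.
pose Y (o : option J) := if o is Some j then X j else P.
pose f : {linear (DSum X * P)%type -> DSum Y} :=
  lcopair (sdesc (fun j => sinj (X := Y) (Some j))) (sinj (X := Y) None).
pose gf o : {linear Y o -> (DSum X * P)%type} :=
  match o with
  | Some j => lcomp (pair1 (DSum X) P) (sinj j)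
  | None => pair2 (DSum X) P
  end.
pose g : {linear DSum Y -> (DSum X * P)%type} := sdesc gf.
have g1 x : g (sdesc (fun j => sinj (X := Y) (Some j)) x) = pair1 (DSum X) P x.
  rewrite -[LHS]/(lcomp g (sdesc (fun j => sinj (X := Y) (Some j))) x).
  move: x; apply: dsum_eq => j x /=; rewrite (sdescE (fun j => sinj (X := Y) (Some j))).
  exact: (sdescE gf (j := Some j) x).
have g2 y : g (sinj (X := Y) None y) = pair2 (DSum X) P y.
  exact: (sdescE gf (j := None) y).
exists f, g => -[x y]; rewrite /= linearD g1 g2 /=.
by apply: injective_projections; rewrite /= ?addr0 ?add0r.
Qed.

(* If M is a retract of S via (a, r), lifting a and r along the presentations
   of M and S gives x = (psi phi) x + theta (i x) on the syzygy K of M. *)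
Lemma syzygy_retract K P M (KS F S : lmodType A) (i : {linear K -> P}) (p : {linear P -> M})
    (k : {linear KS -> F}) (q : {linear F -> S}) :
  short_exact i p -> projective P -> short_exact k q -> projective F ->
  retract M S -> retract K (KS * P)%type.
Proof.
move=> hse hP hse' hF [a [r ra]].
have [iI ex pS] := hse; have [kI ex' qS] := hse'.
have [phi phiE] := hP _ _ q (lcomp a p) qS.
have [psi psiE] := hF _ _ p (lcomp r q) pS.
have [phi' phi'E] : exists f : {linear K -> KS}, forall x, k (f x) = lcomp phi i x.
  by apply: lin_lift => // w; apply/ex'; rewrite /= phiE /= (short_exact0 _ hse) linear0.
have [psi' psi'E] : exists f : {linear KS -> K}, forall x, i (f x) = lcomp psi k x.
  by apply: lin_lift => // w; apply/ex; rewrite /= psiE /= (short_exact0 _ hse') linear0.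
have [th thE] : exists f : {linear P -> K},
    forall x, i (f x) = lsub (lid P) (lcomp psi phi) x.
  by apply: lin_lift => // w; apply/ex; rewrite linearB /= psiE /= phiE /= ra subrr.
exists (lpair phi' i), (lcopair psi' th) => x /=; apply: iI.
by rewrite linearD psi'E thE /= phi'E /= addrC subrK.
Qed.

(** Retracts of direct sums of members form a class stable under syzygies: the syzygy is a retract
    of the sum of the syzygies together with one projective. *)
Lemma perp_dsum_retract N (J : Type) (X : J -> lmodType A) M :
  (forall j, perp N (X j)) -> retract M (DSum X) -> perp N M.
Proof.
move=> hX hM.
apply: (@perp_coind N (fun M => exists (J : Type) (X : J -> lmodType A),
  (forall j, perp N (X j)) /\ retract M (DSum X))); last by exists J, X.
  move=> {}M [{}J [{}X [{}hX {}hM]]]; apply: ext1_zero_retract hM _.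
  by apply: ext1_zero_dsum => j; apply: perp_ext1_zero.
move=> {}M [{}J [{}X [{}hX {}hM]]] K P i p hse hP.
have hF : projective (DSum (fun j => pcov (X j))).
  by apply: projective_dsum => j; apply: pcov_projective.
have hK := syzygy_retract hse hP
  (dsum_short_exact (fun j => pmap_se (X j))) hF hM.
exists (option J), (fun o => if o is Some j then Ker (pmap (X j)) else P).
split; last exact: retract_trans hK (retract_option_dsum _ _).
move=> [j|]; last exact: perp_projective.
exact: perp_syz (hX j) (pmap_se (X j)) (@pcov_projective (X j)).
Qed.

Lemma perp_retract N M M' : retract M M' -> perp N M' -> perp N M.
Proof.
move=> h h'; apply: (@perp_dsum_retract N unit (fun _ => M')) => //.
apply: retract_trans h _; exists (sinj (X := fun _ => M') tt), (sproj tt) => x.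
exact: sinjK.
Qed.

(** Short exact sequences are spliced here. The term is transparent because later proofs compute its
    objects and differentials. *)
Definition chain_left (N E : nat -> lmodType A)
    (i : forall n, {linear N n.+1 -> E n}) (p : forall n, {linear E n -> N n})
    (h : forall n, short_exact (i n) (p n)) : left_resolution (N 0%N).
Proof.
refine (@LeftResolution A (N 0%N) E (fun n => lcomp (i n) (p n.+1)) (p 0%N) _ _ _).
- by have [] := h 0%N.
- move=> y; have [_ ex _] := h 0%N; have [_ _ pS] := h 1%N.
  split=> [/ex[x <-]|[x <-]] /=; last by rewrite (short_exact0 _ (h 0%N)).
  by have [z <-] := pS x; exists z.
move=> n y; have [iI _ _] := h n; have [_ ex _] := h n.+1; have [_ _ pS] := h n.+2.
split=> [/= e|[x <-]] /=; last by rewrite (short_exact0 _ (h n.+1)) linear0.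
have /ex[x <-] : p n.+1 y = 0 by apply: iI; rewrite e linear0.
by have [z <-] := pS x; exists z.
Defined.

Fixpoint syz M n : lmodType A := if n is n'.+1 then Ker (pmap (syz M n')) else M.

Lemma projective_resolution M : exists Q : left_resolution M,
  forall n, projective (lobj Q n).
Proof.
exists (chain_left (fun n => pmap_se (syz M n))) => n.
exact: pcov_projective.
Qed.

Lemma truncate_aug M (Q : left_resolution M) :
  exists d : {linear lobj Q 1 -> Ker (laug Q)},
    forall x, kerval (laug Q) (d x) = ldiff Q 0 x.
Proof.
apply: lin_lift; first exact: kerval_inj.
by move=> w; apply: kerval_ex; apply/laug_exact; exists w.
Qed.

Lemma Ext1P M N : Ext_vanishes 1 M N <-> ext1_zero M N.
Proof.
split=> [h|h Q hQ f fd].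
  have [Q hQ] := projective_resolution M.
  apply: (ext1_zero_cover (ker_short_exact (@laug_surj _ _ Q))) => // f.
  have [d dE] := truncate_aug Q.
  have [|g gE] := h Q hQ (lcomp f d).
    move=> x /=; rewrite -[RHS](linear0 f); congr (f _).
    apply: (@kerval_inj _ _ _ (laug Q)); rewrite dE linear0.
    by apply/ldiff_exact; exists x.
  exists g => x; have /laug_exact[y yE] := kervalK x.
  have xE : x = d y by apply: (@kerval_inj _ _ _ (laug Q)); rewrite dE yE.
  by rewrite -yE -gE /= xE.
have [d dE] := truncate_aug Q.
have dS : surj d.
  move=> x; have /laug_exact[y yE] := kervalK x.
  by exists y; apply: (@kerval_inj _ _ _ (laug Q)); rewrite dE yE.
have [f' f'E] : exists f' : {linear Ker (laug Q) -> N}, forall x, f' (d x) = f x.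
  apply: lin_desc => // x dx.
  have /ldiff_exact[y <-] : ldiff Q 0 x = 0 by rewrite -dE dx linear0.
  exact: fd.
have [g gE] := h _ _ _ _ (ker_short_exact (@laug_surj _ _ Q)) f'.
by exists g => x; rewrite -dE gE f'E.
Qed.

Definition splice_obj P K (Q : left_resolution K) n :=
  if n is n'.+1 then lobj Q n' else P.
Definition splice_diff P K (i : {linear K -> P}) (Q : left_resolution K) n :
  {linear splice_obj P Q n.+1 -> splice_obj P Q n} :=
  match n with 0%N => lcomp i (laug Q) | n'.+1 => ldiff Q n' end.

Definition splice K P M (i : {linear K -> P}) (p : {linear P -> M})
  (h : short_exact i p) (Q : left_resolution K) : left_resolution M.
Proof.
refine (@LeftResolution A M (splice_obj P Q) (splice_diff i Q) p _ _ _).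
- by have [] := h.
- move=> y; have [_ ex _] := h.
  split=> [/ex[x <-]|[x <-]] /=; last by rewrite (short_exact0 _ h).
  by have [z <-] := @laug_surj _ _ Q x; exists z.
case=> [|n] y /=; last exact: ldiff_exact.
have [iI _ _] := h; split=> [e|/laug_exact ->]; last by rewrite linear0.
by apply/laug_exact; apply: iI; rewrite e linear0.
Defined.

Definition truncate M (Q : left_resolution M)
    (d : {linear lobj Q 1 -> Ker (laug Q)})
    (dE : forall x, kerval (laug Q) (d x) = ldiff Q 0 x) :
  left_resolution (Ker (laug Q)).
Proof.
refine (@LeftResolution A (Ker (laug Q)) (fun n => lobj Q n.+1)
  (fun n => ldiff Q n.+1) d _ _ _).
- move=> x; have /laug_exact[y yE] := kervalK x.
  by exists y; apply: (@kerval_inj _ _ _ (laug Q)); rewrite dE yE.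
- move=> y; rewrite -(@ldiff_exact A M Q 0%N y) -dE.
  split=> [->|e]; first by rewrite linear0.
  by apply: (@kerval_inj _ _ _ (laug Q)); rewrite e linear0.
by move=> n; apply: ldiff_exact.
Defined.

(** This is dimension shifting. As [Ext_vanishes] ranges over all projective resolutions, prefixing
    [P] to any resolution of a syzygy gives one direction, and truncating any resolution of [M]
    gives the other. *)
Lemma left_perpP C M : left_perp C M <-> perp C M.
Proof.
split.
  apply: (@perp_coind C (left_perp C)) => {}M h; first by apply/Ext1P/h.
  move=> K P i p hse hP [//|n] _ Q hQ f fd.
  apply: (h n.+2 isT (splice hse Q) _ f fd).
  by case.
move=> h [//|i] _; elim: i M h => [|i IH] M h; first by apply/Ext1P/perp_ext1_zero.
move=> Q hQ f fd.
have hK := perp_syz h (ker_short_exact (@laug_surj _ _ Q)) (hQ 0%N).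
have [d dE] := truncate_aug Q.
exact: (IH _ hK (truncate dE) (fun n => hQ n.+1) f fd).
Qed.

(* M is in add C: its identity factors through a finite power of C. *)
Definition fac C M := exists (I : Type) (s : seq I) (a : I -> {linear M -> C})
  (b : I -> {linear C -> M}), forall x, x = \sum_(i <- s) b i (a i x).

Lemma ext1_zero_cov M N N' : fac N N' -> ext1_zero M N -> ext1_zero M N'.
Proof.
move=> [I [s [a [b ab]]]] h K E i p hse f.
have /choice[g gE] k := h _ _ _ _ hse (lcomp (a k) f).
exists (lsum s (fun k => lcomp (b k) (g k))) => x /=.
by rewrite [RHS]ab; apply: eq_bigr => k _; rewrite gE.
Qed.

Lemma perp_cov M N N' : fac N N' -> perp N M -> perp N' M.
Proof.
move=> ab; apply: (@perp_coind N' (perp N)) => {}M h.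
  by apply: (ext1_zero_cov ab); apply: perp_ext1_zero.
by move=> K P i p hse hP; apply: perp_syz h hse hP.
Qed.

Lemma retract_fac C M : retract M C -> fac C M.
Proof.
move=> [i [r ri]]; exists unit, [:: tt], (fun _ => i), (fun _ => r) => x.
by rewrite big_seq1 ri.
Qed.
Lemma isom_fac C M : isom M C -> fac C M.
Proof. by move/isom_retract/retract_fac. Qed.
Lemma fac_refl C : fac C C.
Proof. exact: retract_fac (retract_refl C). Qed.
Lemma fac_trans B C M : fac B C -> fac C M -> fac B M.
Proof.
move=> [J [t [c [d cd]]]] [I [s [a [b ab]]]].
exists (I * J)%type, [seq (i, j) | i <- s, j <- t],
  (fun ij => lcomp (c ij.2) (a ij.1)), (fun ij => lcomp (b ij.1) (d ij.2)) => x.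
rewrite big_allpairs /= {1}(ab x); apply: eq_bigr => i _.
by rewrite {1}(cd (a i x)) linear_sum.
Qed.

Lemma dsum_fin n (X : 'I_n -> lmodType A) (x : DSum X) :
  x = \sum_(i < n) sinj i (sproj i x).
Proof.
rewrite -[LHS]/(lid (DSum X) x).
rewrite -[RHS]/(lsum (index_enum 'I_n) (fun i => lcomp (sinj i) (sproj i)) x).
move: x; apply: dsum_eq => j x /=.
rewrite (bigD1 j) //= sinjK big1 ?addr0 // => i ij.
by rewrite sinj0 ?linear0 // => e; rewrite e eqxx in ij.
Qed.

Lemma fac_dsum n C : fac C (DSum (fun _ : 'I_n => C)).
Proof.
exists 'I_n, (index_enum 'I_n), (fun i => sproj i), (fun i => sinj i).
exact: dsum_fin.
Qed.

Lemma inaddP C M : inadd C M <-> fac C M.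
Proof.
split=> [[n /retractP/retract_fac]|[I [s [a [b ab]]]]].
  by apply: fac_trans; apply: fac_dsum.
exists (size s); apply/retractP; pose t := in_tuple s.
pose f : {linear M -> DSum (fun _ : 'I_(size s) => C)} :=
  lsum (index_enum _) (fun i => lcomp (sinj (X := fun _ => C) i) (a (tnth t i))).
exists f, (sdesc (fun i => b (tnth t i))) => x.
rewrite /f /= linear_sum [RHS]ab [RHS]big_tnth.
by apply: eq_bigr => i _; rewrite sdescE.
Qed.

Lemma fac_fingen C M : fac C M -> fingen C -> fingen M.
Proof.
move=> /inaddP[n /retractP h] hC; apply: fingen_retract h _.
by apply: fingen_dsum.
Qed.

(** The classes speak of the constructed [Coker], whereas a coresolution step supplies some quotient
    with the same kernel; this compares the two. *)
Lemma quot_isom V W W' (p : {linear V -> W}) (p' : {linear V -> W'}) :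
  surj p -> surj p' -> (forall x, p x = 0 <-> p' x = 0) -> isom W W'.
Proof.
move=> pS pS' e.
have [f fE] : exists f : {linear W -> W'}, forall x, f (p x) = p' x.
  by apply: lin_desc => // x /e.
have [g gE] : exists g : {linear W' -> W}, forall x, g (p' x) = p x.
  by apply: lin_desc => // x /e.
exists f; exists g => x.
  by have [y <-] := pS x; rewrite fE gE.
by have [y <-] := pS' x; rewrite gE fE.
Qed.

Lemma sub_isom V W W' (p : {linear W -> V}) (p' : {linear W' -> V}) :
  injective p -> injective p' ->
  (forall x, (exists y, p y = x) <-> (exists y, p' y = x)) -> isom W W'.
Proof.
move=> pI pI' e.
have [f fE] : exists f : {linear W -> W'}, forall x, p' (f x) = p x.
  by apply: lin_lift => // x; apply/e; exists x.
have [g gE] : exists g : {linear W' -> W}, forall x, p (g x) = p' x.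
  by apply: lin_lift => // x; apply/e; exists x.
by exists f; exists g => x; [apply: pI; rewrite gE fE|apply: pI'; rewrite fE gE].
Qed.

Lemma ext1_zero_isom M M' N : isom M M' -> ext1_zero M N -> ext1_zero M' N.
Proof. by move=> /isom_sym/isom_retract; apply: ext1_zero_retract. Qed.

Definition chain_right (N E : nat -> lmodType A)
    (i : forall n, {linear N n -> E n}) (p : forall n, {linear E n -> N n.+1})
    (h : forall n, short_exact (i n) (p n)) : right_resolution (N 0%N).
Proof.
refine (@RightResolution A (N 0%N) E (i 0%N) (fun n => lcomp (i n.+1) (p n)) _ _ _).
- by have [] := h 0%N.
- move=> y; have [_ ex _] := h 0%N; have [iI _ _] := h 1%N.
  rewrite -(ex y); split=> /= [e|->]; last by rewrite linear0.
  by apply: iI; rewrite e linear0.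
move=> n y; have [_ _ pS] := h n; have [_ ex _] := h n.+1; have [iI _ _] := h n.+2.
split=> [/= e|[x <-]] /=; last by rewrite (short_exact0 _ (h n.+1)) linear0.
have /ex[x <-] : p n.+1 y = 0 by apply: iI; rewrite e linear0.
by have [z <-] := pS x; exists z.
Defined.

(** * One-step and coinductive descriptions of cogen* and gen* *)

Section CogenStar.
Variable C : lmodType A.

(** One step of a coresolution is packed as a type, so that choice makes it a function that can be
    iterated. *)
Record costep M (Q : lmodType A -> Prop) := CoStep {
  cs_obj : lmodType A; cs_next : lmodType A;
  cs_i : {linear M -> cs_obj}; cs_p : {linear cs_obj -> cs_next};
  cs_se : short_exact cs_i cs_p; cs_fac : fac C cs_obj;
  cs_ext : ext1_zero cs_next C; cs_Q : Q cs_next }.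

(** The tail of the sequence coresolves [Coker (raug E)]. Its first cokernel and that of [rdiff E 0]
    are quotients of [robj E 1] by the same image. *)
Lemma cogen_star_unfold M : cogen_star C M ->
  exists C' M' (f : {linear M -> C'}) (g : {linear C' -> M'}),
  [/\ short_exact f g, fac C C', ext1_zero M' C & cogen_star C M'].
Proof.
move=> [E [hE h0 h]].
exists (robj E 0), (Coker (raug E)), (raug E), (cokerproj (raug E)).
have aI : injective (raug E) by apply: raug_inj.
split; [exact: coker_short_exact|exact/inaddP/hE|exact/Ext1P|].
have pS := @cokerproj_surj _ _ _ (raug E).
have [d dE] : exists d : {linear Coker (raug E) -> robj E 1},
    forall x, d (cokerproj (raug E) x) = rdiff E 0 x.
  by apply: lin_desc => // x /coker_exact/raug_exact.
have dI : injective d.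
  apply: lin_injP => x; have [y <-] := pS x; rewrite dE => /raug_exact e.
  exact/coker_exact.
have dex : exact_at d (rdiff E 1).
  move=> y; split=> [/rdiff_exact[x <-]|[x <-]].
    by exists (cokerproj (raug E) x).
  by have [z <-] := pS x; rewrite dE; apply/rdiff_exact; exists z.
exists (@RightResolution A (Coker (raug E)) (fun n => robj E n.+1) d
  (fun n => rdiff E n.+1) dI dex (fun n => @rdiff_exact A _ E n.+1)).
split=> /=; [by move=> n; apply: hE| |by move=> n; apply: h].
apply/Ext1P; have /Ext1P := h 0%N; apply: ext1_zero_isom.
apply: (quot_isom (p := cokerproj (rdiff E 0)) (p' := cokerproj d)).
- exact: cokerproj_surj.
- exact: cokerproj_surj.
move=> x; rewrite !coker_exact /=; split=> [[y <-]|[y <-]].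
  by exists (cokerproj (raug E) y).
by have [z <-] := pS y; exists z; rewrite dE.
Qed.

Lemma cogen_star_coind (W : lmodType A -> Prop) :
  (forall M, W M -> exists C' M' (f : {linear M -> C'}) (g : {linear C' -> M'}),
     [/\ short_exact f g, fac C C', ext1_zero M' C & W M']) ->
  forall M, W M -> cogen_star C M.
Proof.
move=> hW M wM; pose T := {M | W M}.
have st (t : T) : costep (sval t) W.
  suff : exists _ : costep (sval t) W, True by move=> /cid[].
  case: t => N wN /=; have [C' [M' [f [g [h1 h2 h3 h4]]]]] := hW N wN.
  by exists (CoStep h1 h2 h3 h4).
pose next (t : T) : T := exist W (cs_next (st t)) (cs_Q (st t)).
pose t n := iter n next (exist W M wM).
pose i n : {linear sval (t n) -> cs_obj (st (t n))} := cs_i (st (t n)).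
pose p n : {linear cs_obj (st (t n)) -> sval (t n.+1)} := cs_p (st (t n)).
have h n : short_exact (i n) (p n) := cs_se (st (t n)).
pose E := chain_right h.
exists E; split=> [n||n].
- by apply/inaddP; apply: (cs_fac (st (t n))).
- apply/Ext1P; apply: (@ext1_zero_isom (sval (t 1%N))); last exact: cs_ext.
  have [_ ex pS] := h 0%N.
  apply: (quot_isom (p := p 0%N) (p' := cokerproj (raug E))) => //.
    exact: cokerproj_surj.
  by move=> x; rewrite coker_exact.
apply/Ext1P; apply: (@ext1_zero_isom (sval (t n.+2))); last exact: cs_ext.
have [_ ex pS] := h n.+1; have [_ _ pS0] := h n.
apply: (quot_isom (p := p n.+1) (p' := cokerproj (rdiff E n))) => //.
  exact: cokerproj_surj.
move=> x; rewrite coker_exact ex; split=> [[y <-]|[y <-]].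
  by have [z <-] := pS0 y; exists z.
by exists (p n y).
Qed.
End CogenStar.

Section GenStar.
Variable D : lmodType A -> Prop.

Record genstep M (Q : lmodType A -> Prop) := GenStep {
  gs_obj : lmodType A; gs_next : lmodType A;
  gs_i : {linear gs_next -> gs_obj}; gs_p : {linear gs_obj -> M};
  gs_se : short_exact gs_i gs_p; gs_D : D gs_obj;
  gs_ext : forall X, D X -> ext1_zero X gs_next; gs_Q : Q gs_next }.

Lemma gen_star_unfold M : gen_star D M ->
  exists K E (i : {linear K -> E}) (p : {linear E -> M}),
  [/\ short_exact i p, D E, forall X, D X -> ext1_zero X K & gen_star D K].
Proof.
move=> [E [hE h0 h]].
exists (Ker (laug E)), (lobj E 0), (kerval (laug E)), (laug E).
split; [exact: ker_short_exact (@laug_surj _ _ E)|exact: hE| |].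
  by move=> X hX; apply/Ext1P/h0.
have [d dE] := truncate_aug E; exists (truncate dE).
split=> /=; [by move=> n; apply: hE| |by move=> n; apply: h].
move=> X hX; apply/Ext1P; have /Ext1P := h 0%N X hX; apply: ext1_zero_cov.
apply: isom_fac; apply: (sub_isom (p := kerval d) (p' := kerval (ldiff E 0))).
- exact: kerval_inj.
- exact: kerval_inj.
move=> x; rewrite -!ker_exact -dE; split=> [->|e]; first by rewrite linear0.
by apply: (@kerval_inj _ _ _ (laug E)); rewrite e linear0.
Qed.

Lemma gen_star_coind (W : lmodType A -> Prop) :
  (forall M, W M -> exists K E (i : {linear K -> E}) (p : {linear E -> M}),
     [/\ short_exact i p, D E, forall X, D X -> ext1_zero X K & W K]) ->
  forall M, W M -> gen_star D M.
Proof.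
move=> hW M wM; pose T := {M | W M}.
have st (t : T) : genstep (sval t) W.
  suff : exists _ : genstep (sval t) W, True by move=> /cid[].
  case: t => N wN /=; have [C' [M' [f [g [h1 h2 h3 h4]]]]] := hW N wN.
  by exists (GenStep h1 h2 h3 h4).
pose next (t : T) : T := exist W (gs_next (st t)) (gs_Q (st t)).
pose t n := iter n next (exist W M wM).
pose i n : {linear sval (t n.+1) -> gs_obj (st (t n))} := gs_i (st (t n)).
pose p n : {linear gs_obj (st (t n)) -> sval (t n)} := gs_p (st (t n)).
have h n : short_exact (i n) (p n) := gs_se (st (t n)).
pose E := chain_left h.
exists E; split=> [n|X hX|n X hX].
- exact: (gs_D (st (t n))).
- apply/Ext1P; apply: (@ext1_zero_cov X (sval (t 1%N))); last exact: gs_ext.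
  apply: isom_fac; have [iI ex pS] := h 0%N.
  apply: (sub_isom (p := kerval (laug E)) (p' := i 0%N)) => //.
    exact: kerval_inj.
  by move=> x; rewrite -ker_exact; apply: ex.
apply/Ext1P; apply: (@ext1_zero_cov X (sval (t n.+2))); last exact: gs_ext.
apply: isom_fac; have [iI0 _ _] := h n; have [iI ex pS] := h n.+1.
apply: (sub_isom (p := kerval (ldiff E n)) (p' := i n.+1)) => //.
  exact: kerval_inj.
move=> x; rewrite -ker_exact -ex /=; split=> [e|->]; last by rewrite linear0.
by apply: iI0; rewrite e linear0.
Qed.
End GenStar.

End Ext.

(** * The category Y_C *)

Section Ycal.
Variable A : nzRingType.
Implicit Types B C K E U V W M N P Z L : lmodType A.

Lemma fac_prod C M N : fac C M -> fac C N -> fac C (M * N)%type.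
Proof.
move=> [I [s [a [b ab]]]] [J [t [c [d cd]]]].
exists (I + J)%type, ([seq inl i | i <- s] ++ [seq inr j | j <- t]),
  (fun k => match k with
    | inl i => lcomp (a i) (@lfst A M N) | inr j => lcomp (c j) (@lsnd A M N) end),
  (fun k => match k with
    | inl i => lcomp (pair1 M N) (b i) | inr j => lcomp (pair2 M N) (d j) end).
move=> [x y]; rewrite big_cat /= !big_map.
rewrite [X in X + _](_ : _ = pair1 M N x); last by rewrite [in RHS](ab x) linear_sum.
rewrite [X in _ + X](_ : _ = pair2 M N y); last by rewrite [in RHS](cd y) linear_sum.
by apply: injective_projections; rewrite /= ?addr0 ?add0r.
Qed.

Lemma fac_zero C M : (forall x : M, x = 0) -> fac C M.
Proof.
move=> h; exists unit, [::], (fun _ => lzero M C), (fun _ => lzero C M) => x.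
by rewrite big_nil.
Qed.

Lemma perp_fac N C M : fac C M -> perp N C -> perp N M.
Proof. by move=> /inaddP[n /retractP h] hC; apply: perp_dsum_retract h. Qed.

Lemma ext1_zero_fac N C M : fac C M -> ext1_zero C N -> ext1_zero M N.
Proof.
by move=> /inaddP[n /retractP h] hC; apply: ext1_zero_retract h _; apply: ext1_zero_dsum.
Qed.

Lemma cogen_star_fold C M C' M' (f : {linear M -> C'}) (g : {linear C' -> M'}) :
  short_exact f g -> fac C C' -> ext1_zero M' C -> cogen_star C M' -> cogen_star C M.
Proof.
move=> h1 h2 h3 h4.
apply: (@cogen_star_coind A C (fun M => exists C' M' (f : {linear M -> C'})
  (g : {linear C' -> M'}), [/\ short_exact f g, fac C C', ext1_zero M' C & cogen_star C M'])).
  move=> X [C1 [X' [u [v [k1 k2 k3 k4]]]]]; exists C1, X', u, v; split=> //.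
  exact: cogen_star_unfold.
by exists C', M', f, g.
Qed.

Section Fixed.
Variable C : lmodType A.
Hypothesis hC : perp C C.

(** The cokernel stays in ^perp C by [perp_coker]: the two other terms are there, and its Ext^1
    vanishing is part of [cogen_star]. *)
Lemma Y_unfold M : Ycal C M ->
  exists C' M' (f : {linear M -> C'}) (g : {linear C' -> M'}),
  [/\ short_exact f g, fac C C' & Ycal C M'].
Proof.
move=> [/left_perpP hM /cogen_star_unfold[C' [M' [f [g [h1 h2 h3 h4]]]]]].
exists C', M', f, g; split=> //; split=> //; apply/left_perpP.
by apply: (perp_coker h1) => //; apply: perp_fac h2 hC.
Qed.

(** The Ext^1 conditions on the cokernels come for free, since every cokernel lies in [W] and hence
    in [perp C]. *)
Lemma Y_coind (W : lmodType A -> Prop) :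
  (forall M, W M -> perp C M) ->
  (forall M, W M -> exists C' M' (f : {linear M -> C'}) (g : {linear C' -> M'}),
     [/\ short_exact f g, fac C C' & W M']) ->
  forall M, W M -> Ycal C M.
Proof.
move=> h1 h2 M wM; split; first exact/left_perpP/h1.
apply: (@cogen_star_coind A C W) wM => {}M /h2[C' [M' [f [g [k1 k2 k3]]]]].
by exists C', M', f, g; split=> //; apply/perp_ext1_zero/h1.
Qed.

Lemma Y_perp M : Ycal C M -> perp C M.
Proof. by move=> [/left_perpP]. Qed.

Lemma Y_isom M N : isom M N -> Ycal C N -> Ycal C M.
Proof.
move=> e hN; apply: (@Y_coind (fun M => exists N, isom M N /\ Ycal C N)); last by exists N.
  by move=> M1 [N1 [/isom_retract h /Y_perp]]; apply: perp_retract.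
move=> {e hN M N}M [N [[phi bphi] /Y_unfold[C' [M' [f [g [[fI ex gS] k2 k3]]]]]]].
exists C', M', (lcomp f phi), g; split=> //; last by exists M'; split=> //; apply: isom_refl.
split=> //; first by apply: inj_comp => //; apply: bij_inj.
move=> y; split=> [/ex[x <-]|[x <-]]; last by apply/ex; exists (phi x).
by have [z <-] := bij_surj bphi x; exists z.
Qed.

(* The horseshoe: an extension of the two copresentations. *)
Lemma Y_ext U V W (i : {linear U -> V}) (p : {linear V -> W}) :
  short_exact i p -> Ycal C U -> Ycal C W -> Ycal C V.
Proof.
move=> hse hU hW.
apply: (@Y_coind (fun V => exists U W (i : {linear U -> V}) (p : {linear V -> W}),
  [/\ short_exact i p, Ycal C U & Ycal C W])); last by exists U, W, i, p.
  move=> {}V [{}U [{}W [{}i [{}p [{}hse {}hU {}hW]]]]].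
  by apply: (perp_ext hse); apply: Y_perp.
move=> {}V [{}U [{}W [{}i [{}p [{}hse {}hU {}hW]]]]].
have [iI ex pS] := hse.
have [C0 [U' [f [g [fg_se hC0 hU']]]]] := Y_unfold hU.
have [C1 [W' [f' [g' [fg'_se hC1 hW']]]]] := Y_unfold hW.
have [fI fex gS] := fg_se; have [fI' fex' gS'] := fg'_se.
(* The embedding of [U] extends to [V] because Ext^1(W, C0) = 0; paired with the embedding of [W] it
   becomes injective on [V]. *)
have [h hE] := ext1_zero_cov hC0 (perp_ext1_zero (Y_perp hW)) hse f.
pose F := lpair h (lcomp f' p).
have FI : injective F.
  apply: lin_injP => v [hv /= fv].
  have /ex[u uE] : p v = 0 by apply: fI'; rewrite fv linear0.
  have u0 : u = 0 by apply: fI; rewrite -hE uE hv linear0.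
  by rewrite -uE u0 linear0.
pose q := cokerproj F; have qS : surj q := @cokerproj_surj _ _ _ F.
have qF v : q (F v) = 0 by apply/coker_exact; exists v.
have [a aE] : exists a : {linear U' -> Coker F},
    forall c, a (g c) = lcomp q (pair1 C0 C1) c.
  apply: lin_desc => // c /fex[u <-] /=; rewrite -(qF (i u)); congr (q _).
  by rewrite /= hE (short_exact0 _ hse) linear0.
have [b bE] : exists b : {linear Coker F -> W'},
    forall c, b (q c) = lcomp g' (@lsnd A C0 C1) c.
  by apply: lin_desc => // c /coker_exact[v <-] /=; rewrite (short_exact0 _ fg'_se).
exists (C0 * C1)%type, (Coker F), F, q; split.
- exact: coker_short_exact.
- exact: fac_prod.
exists U', W', a, b; split=> //; split=> [|y|w].
- apply: lin_injP => x; have [c <-] := gS x; rewrite aE => /coker_exact[v /= [vc fv]].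
  have /ex[u uE] : p v = 0 by apply: fI'; rewrite fv linear0.
  by rewrite -vc -uE hE (short_exact0 _ fg_se).
- have [[c c'] <-] := qS y; rewrite bE /=; split=> [/fex'[w <-]|[x]]; last first.
    have [d <-] := gS x; rewrite aE => /(congr1 b); rewrite !bE /= => <-.
    exact: linear0.
  have [v <-] := pS w; exists (g (c - h v)); rewrite aE /=.
  apply/eqP; rewrite -subr_eq0 -linearB; apply/eqP/coker_exact; exists (- v).
  rewrite linearN; apply: injective_projections; rewrite /= ?sub0r //.
  by rewrite addrAC subrr sub0r.
by have [c <-] := gS' w; exists (q (0, c)); rewrite bE.
Qed.

(** Embed [M] in [C0] through [M * M']. Its cokernel is an extension of [X'] by [M'], so cokernel
    times [M] is an extension of [X'] by [M * M'] and lies in Y_C. The cokernel is therefore again a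
    summand, with complement [M]. *)
Lemma Y_retract M N : retract M N -> Ycal C N -> Ycal C M.
Proof.
move=> /retractP[M' e] hN.
apply: (@Y_coind (fun M => exists M', Ycal C (M * M')%type)); last first.
- by exists M'; apply: Y_isom hN; apply: isom_sym.
- move=> {e N hN M'}M [M' /[dup] hX].
  move=> /Y_unfold[C0 [X' [f [g [fg_se hC0 hX']]]]].
  have [fI fex gS] := fg_se.
  pose f1 := lcomp f (pair1 M M').
  have f1I : injective f1 by move=> x y /fI[].
  pose q := cokerproj f1; have qS : surj q := @cokerproj_surj _ _ _ f1.
  exists C0, (Coker f1), f1, q; split=> //; first exact: coker_short_exact.
  exists M.
  pose a := lpair (lcomp q (lcomp f (lcomp (pair2 M M') (@lsnd A M M')))) (@lfst A M M').
  have [b bE] : exists b : {linear Coker f1 -> X'}, forall c, b (q c) = g c.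
    by apply: lin_desc => // c /coker_exact[m <-] /=; rewrite (short_exact0 _ fg_se).
  apply: (@Y_ext _ _ _ a (lcomp b (@lfst A (Coker f1) M))) => //; split=> [|[z m]|w].
  - apply: lin_injP => -[m m'] /= [e ->].
    have /coker_exact[m0 /fI[_ <-]] // := e.
  - have [c <-] := qS z; rewrite /= bE; split=> [/fex[[m0 m'] <-]|[[m0 m']]] /=.
      exists (m, m'); rewrite /=; congr pair.
      apply/eqP; rewrite -subr_eq0 -linearB; apply/eqP/coker_exact; exists (- m0).
      rewrite linearN /= -linearN -linearB; congr (f _).
      by apply: injective_projections; rewrite /= ?oppr0 ?sub0r ?subrr.
    by move=> [/(congr1 b) + _]; rewrite !bE => <-; rewrite (short_exact0 _ fg_se).
  by have [c <-] := gS w; exists (q c, 0); rewrite /= bE.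
move=> {e N hN M'}M [M' /Y_perp]; apply: perp_retract; exact: retract_fst.
Qed.

(** Embed [K] in [C0] through [M]. The cokernel is an extension of [M'] by [N], hence in Y_C, and
    gives the first step for [K]. *)
Lemma Y_kernel K M N (i : {linear K -> M}) (p : {linear M -> N}) :
  short_exact i p -> Ycal C M -> Ycal C N -> Ycal C K.
Proof.
move=> hse hM hN; have [iI ex pS] := hse.
have [C0 [M' [f [g [fg_se hC0 hM']]]]] := Y_unfold hM.
have [fI fex gS] := fg_se.
pose f1 := lcomp f i.
have f1I : injective f1 by apply: inj_comp.
pose q := cokerproj f1; have qS : surj q := @cokerproj_surj _ _ _ f1.
have hE : Ycal C (Coker f1).
  have [a aE] : exists a : {linear N -> Coker f1}, forall m, a (p m) = lcomp q f m.
    by apply: lin_desc => // m /ex[k <-]; apply/coker_exact; exists k.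
  have [b bE] : exists b : {linear Coker f1 -> M'}, forall c, b (q c) = g c.
    by apply: lin_desc => // c /coker_exact[k <-] /=; rewrite (short_exact0 _ fg_se).
  apply: (@Y_ext _ _ _ a b) => //; split=> [|z|w].
  - apply: lin_injP => x; have [m <-] := pS x; rewrite aE => /coker_exact[k /fI <-].
    exact: short_exact0.
  - have [c <-] := qS z; rewrite bE; split=> [/fex[m <-]|[x]].
      by exists (p m); rewrite aE.
    have [m <-] := pS x; rewrite aE => /(congr1 b); rewrite !bE /= => <-.
    exact: short_exact0.
  by have [c <-] := gS w; exists (q c); rewrite bE.
split; first by apply/left_perpP; apply: (perp_left hse); apply: Y_perp.
apply: (cogen_star_fold (coker_short_exact f1I)) => //; last by case: hE.
exact/perp_ext1_zero/Y_perp.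
Qed.

Lemma Y_fac M : fac C M -> Ycal C M.
Proof.
move: M; apply: Y_coind => M hM; first exact: perp_fac hM hC.
exists M, (Coker (lid M)), (lid M), (cokerproj (lid M)); split=> //.
  exact: coker_short_exact.
apply: fac_zero => x; have [y <-] := cokerproj_surj x.
by apply/coker_exact; exists y.
Qed.

Definition noeth := forall M K (j : {linear K -> M}),
  injective j -> fingen M -> fingen K.

Lemma Y_fingen M : noeth -> fingen C -> Ycal C M -> fingen M.
Proof.
move=> hn fC /Y_unfold[C' [M' [f [g [[fI _ _] h2 _]]]]].
by apply: (hn _ _ f fI); apply: fac_fingen h2 fC.
Qed.

Lemma Y_resolving : noeth -> fingen C ->
  (forall P, fingen P -> projective P -> Ycal C P) -> resolving (Ycal C).
Proof.
move=> hn fC hP; split=> //.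
- split=> [M|M N /isom_sym]; first exact: Y_fingen.
  exact: Y_isom.
- by move=> M N hN /retractP h; apply: Y_retract h hN.
- by move=> U V W i p hse; apply: Y_ext hse.
- by move=> M N g gS; apply: Y_kernel (ker_short_exact gS).
Qed.

Lemma Y_ext_injective : ext_injective_cogenerator (Ycal C) C.
Proof.
split; first exact/Y_fac/fac_refl.
  by move=> X [hX _].
move=> M /Y_unfold[C' [M' [f [g [h1 h2 h3]]]]].
by exists C', M', f, g; split=> //; apply/inaddP.
Qed.
End Fixed.

Lemma ext_injective_perp D C : ext_injective_cogenerator D C -> perp C C.
Proof. by move=> [h1 h2 _]; apply/left_perpP/h2. Qed.

Lemma ext_injective_sub_Y D C : ext_injective_cogenerator D C ->
  forall M, D M -> Ycal C M.
Proof.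
move=> [h1 h2 h3]; apply: Y_coind => M hM; first exact/left_perpP/h2.
have [C' [M' [f [g [k1 k2 k3]]]]] := h3 M hM.
by exists C', M', f, g; split=> //; apply/inaddP.
Qed.

Lemma Y_maximal C : noeth -> fingen C -> perp C C ->
  (forall P, fingen P -> projective P -> Ycal C P) ->
  maximal_resolving_for (Ycal C) C.
Proof.
move=> hn fC hC hP; split; [exact: Y_resolving|exact: Y_ext_injective|].
by move=> D' _ /ext_injective_sub_Y h _ M; apply: h.
Qed.

Lemma Y_add_eq C C' : fac C C' -> fac C' C -> perp C C ->
  forall M, Ycal C M -> Ycal C' M.
Proof.
move=> h h' hC; apply: Y_coind => M hM.
  exact: perp_cov h (Y_perp hM).
have [C1 [M' [f [g [h1 h2 h3]]]]] := Y_unfold hC hM.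
by exists C1, M', f, g; split=> //; apply: fac_trans h' h2.
Qed.

(** As a member of Y_C', [C] embeds in some [C0] of add C' with cokernel in Y_C' = Y_C, hence in
    ^perp C, so the embedding splits. *)
Lemma Y_eq_fac C C' : perp C C -> perp C' C' ->
  (forall M, Ycal C M <-> Ycal C' M) -> fac C' C.
Proof.
move=> hC hC' e.
have /e hY := Y_fac hC (fac_refl C).
have [C0 [M' [f [g [h1 h2 /e/Y_perp/perp_ext1_zero h3]]]]] := Y_unfold hC' hY.
have [r rE] := h3 _ _ _ _ h1 (lid C).
by apply: fac_trans h2 (retract_fac _); exists f, r.
Qed.

Lemma fingen_supp (J : Type) (X : J -> lmodType A) M (f : {linear M -> DSum X}) :
  fingen M -> exists2 s : seq {classic J}, uniq s &
  forall x j, sproj j (f x) <> 0 -> (j : {classic J}) \in s.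
Proof.
move=> [n [g gE]].
have /choice[s sE] : forall i, exists s : seq {classic J},
    forall j, sproj j (f (g i)) <> 0 -> (j : {classic J}) \in s.
  by move=> i; have [s _ h] := dsum_supp (f (g i)); exists s.
exists (undup (flatten [seq s i | i <- enum 'I_n])); first exact: undup_uniq.
move=> x j; have [a ->] := gE x; rewrite mem_undup => h.
apply: contrapT => /negP hj; apply: h; rewrite !linear_sum big1 // => i _.
rewrite !linearZ; apply: contrapT => h; case/negP: hj.
apply/flattenP; exists (s i); first by apply: map_f; rewrite mem_enum.
by apply: sE => e; apply: h; rewrite /= e scaler0.
Qed.

Lemma fingen_dsum_sum (J : Type) (X : J -> lmodType A) M (f : {linear M -> DSum X}) :
  fingen M -> exists s : seq J, forall x, f x = \sum_(j <- s) sinj j (sproj j (f x)).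
Proof.
move=> /(fingen_supp f)[s us h]; exists s => x.
by apply: dsum_sumE => // j; apply: h.
Qed.

(* The evaluation M -> C^Hom(M,C) lands in a finite subsum of C^(J). *)
Lemma left_approx C M : product_complete C -> fingen M ->
  exists n (f : {linear M -> DSum (fun _ : 'I_n => C)}),
  forall h : {linear M -> C}, exists t : {linear DSum (fun _ : 'I_n => C) -> C},
  forall x, h x = t (f x).
Proof.
move=> pc fM.
pose H := {linear M -> C}; pose CH := DProd (fun _ : H => C).
have [J /retractP[e [r re]]] : inAdd C CH.
  by apply: pc; exists H; apply/retractP/retract_refl.
pose phi := lcomp e (ptuple (X := fun _ : H => C) (fun h => h)).
have [s sE] := fingen_dsum_sum phi fM.
pose t := in_tuple s.
exists (size s), (lsum (index_enum _)
  (fun i => lcomp (sinj (X := fun _ => C) i) (lcomp (sproj (tnth t i)) phi))) => h.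
exists (sdesc (fun i => lcomp (pproj (X := fun _ : H => C) h)
  (lcomp r (sinj (X := fun _ => C) (tnth t i))))) => x.
rewrite -(ptupleE (X := fun _ : H => C) (fun h => h) h x) -[ptuple _ x]re.
rewrite -[e _]/(phi x) sE !linear_sum [LHS]big_tnth.
by apply: eq_bigr => i _; rewrite sdescE.
Qed.

Lemma inProd_ext C E M (T : lmodType A) (f : {linear M -> T}) : inProd C E ->
  (forall h : {linear M -> C}, exists t : {linear T -> C}, forall x, h x = t (f x)) ->
  forall h : {linear M -> E}, exists t : {linear T -> E}, forall x, h x = t (f x).
Proof.
move=> [I /retractP[i [r ri]]] hf h.
have /choice[t tE] k := hf (lcomp (pproj k) (lcomp i h)).
exists (lcomp r (ptuple t)) => x /=; rewrite -[LHS]ri; congr (r _).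
by apply: dprod_ext => k; rewrite ptupleE -tE.
Qed.

Lemma inProd_dsum C n : inProd C (DSum (fun _ : 'I_n => C)).
Proof.
exists 'I_n; apply/retractP; exists (sincl _).
exists (lsum (index_enum _) (fun i => lcomp (sinj (X := fun _ => C) i)
  (pproj (X := fun _ : 'I_n => C) i))) => x /=.
rewrite [RHS]dsum_fin; apply: eq_bigr => i _; by rewrite pproj_sincl.
Qed.

Lemma wakamatsu_perp C : wakamatsu_cotilting C -> perp C C.
Proof.
move=> [h _]; apply: (@perp_retract _ _ _ (DProd (fun _ : unit => C))).
  exists (ptuple (X := fun _ : unit => C) (fun _ => lid C)), (pproj tt) => x.
  by rewrite ptupleE.
by apply/left_perpP => i; apply: h.
Qed.

(** * From Wakamatsu cotilting modules to projectives in Y_C *)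

Section Wakamatsu.
Variable C : lmodType A.
Hypotheses (fC : fingen C) (pc : product_complete C) (wC : wakamatsu_cotilting C).

(** Every syzygy in the Prod C-resolution of the injective cogenerator satisfies both conditions;
    unfolding the first one passes to the next syzygy. *)
Let acyc N := gen_star (inProd C) N /\ forall X, inProd C X -> ext1_zero X N.

(** The hypothesis on [M] is inherited by the cokernel of its left approximation: a map to [N] lifts
    to Prod C, extends there along the approximation, and is pushed back to [N]. *)
Lemma cogen_star_of_acyclic M : fingen M ->
  (forall N, acyc N -> ext1_zero M N) -> cogen_star C M.
Proof.
move=> fM hM; have hC := wakamatsu_perp wC.
have [_ [Q [_ cogQ /gen_star_unfold[K [E [k [p [hse hE hK gK]]]]]]]] := wC.
apply: (@cogen_star_coind A C
  (fun M => fingen M /\ forall N, acyc N -> ext1_zero M N)); last by [].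
move=> {fM hM}M [fM hM].
have [n [f fE]] := left_approx pc fM.
have hT : inProd C (DSum (fun _ : 'I_n => C)) := inProd_dsum C n.
have facT : fac C (DSum (fun _ : 'I_n => C)) := @fac_dsum A n C.
(* Each map from [M] to [Q] lifts to [E] in Prod C and so factors through [f]; as [Q] cogenerates,
   an element killed by [f] is zero. *)
have fI : injective f.
  apply: lin_injP => x fx; have [I [j jI]] := cogQ M; apply: jI; rewrite linear0.
  apply: dprod_ext => a; rewrite linear0.
  have [g gE] := ext1_zero_lift hse (hM K (conj gK hK)) (lcomp (pproj a) j).
  have [t tE] := inProd_ext hE fE g.
  by have := gE x; rewrite tE fx !linear0 /= => <-.
exists (DSum (fun _ : 'I_n => C)), (Coker f), f, (cokerproj f).
have hcok N : ext1_zero (DSum (fun _ : 'I_n => C)) N ->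
    (forall h : {linear M -> N}, exists t : {linear DSum (fun _ : 'I_n => C) -> N},
      forall x, h x = t (f x)) -> ext1_zero (Coker f) N.
  move=> hN hext; apply: (ext1_zero_coker (coker_short_exact fI) hN) => h.
  by have [t tE] := hext h; exists t.
split=> //.
- exact: coker_short_exact.
- by apply: hcok fE; apply: ext1_zero_fac facT (perp_ext1_zero hC).
split.
  by apply: fingen_surj (@cokerproj_surj _ _ _ f) _; apply: fac_fingen facT fC.
move=> N [/gen_star_unfold[K' [E' [k' [p' [hse' hE' hK' gK']]]]] hN].
apply: hcok; first exact: hN.
move=> h; have [g gE] := ext1_zero_lift hse' (hM K' (conj gK' hK')) h.
have [t tE] := inProd_ext hE' fE g.
by exists (lcomp p' t) => x; rewrite /= -tE gE.
Qed.

Lemma wakamatsu_projective P : fingen P -> projective P -> Ycal C P.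
Proof.
move=> fP hP; split; first exact/left_perpP/perp_projective.
by apply: cogen_star_of_acyclic => // N _; apply: ext1_zero_projective.
Qed.

Lemma wakamatsu_maximal : noeth -> maximal_resolving_for (Ycal C) C.
Proof.
move=> hn; apply: Y_maximal => //; first exact: wakamatsu_perp.
exact: wakamatsu_projective.
Qed.
End Wakamatsu.

End Ycal.

(** * Chain conditions, Baer's criterion and Morita duality *)

Section Chains.
Variable A : nzRingType.
Implicit Types M N K : lmodType A.

Definition acc M := forall K : nat -> M -> Prop, (forall n, issub (K n)) ->
  (forall n x, K n x -> K n.+1 x) -> exists n, forall m x, K m x -> K n x.
Definition dcc M := forall K : nat -> M -> Prop, (forall n, issub (K n)) ->
  (forall n x, K n.+1 x -> K n x) -> exists n, forall m x, K n x -> K m x.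

Lemma noeth_acc M : noeth A -> fingen M -> acc M.
Proof.
move=> hn fM K hK inc.
have mono n m x : (n <= m)%N -> K n x -> K m x.
  by move=> /subnK <-; elim: (m - n)%N => //= k IH /IH; apply: inc.
pose P x := exists n, K n x.
have hP : issub P.
  split; first by exists 0%N; apply: (hK 0%N).1.
  move=> a x y [n kx] [m ky]; exists (maxn n m); apply: (hK _).2.
    exact: mono (leq_maxl n m) kx.
  exact: mono (leq_maxr n m) ky.
have [k [g gE]] : fingen (subm hP) := hn _ _ _ (@subval_inj _ _ _ hP) fM.
have /choice[N NE] i : exists n, K n (subval hP (g i)) := subvalP (g i).
exists (\max_i N i)%N => m x kx.
have [z <-] : exists z, subval hP z = x by apply: subval_ex; exists m.
have [a ->] := gE z; rewrite linear_sum; apply: issub_sum => // i.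
rewrite linearZ; apply: issubZ => //.
exact: mono (leq_bigmax i) (NE i).
Qed.

(** If no member were minimal, iterating a chosen strictly smaller member would give an infinite
    strict descent. *)
Lemma dcc_min M (F : (M -> Prop) -> Prop) : dcc M ->
  (forall E, F E -> issub E) -> (exists E, F E) ->
  exists2 E, F E & forall E', F E' -> (forall x, E' x -> E x) -> forall x, E x -> E' x.
Proof.
move=> hM hF [E0 FE0]; apply: contrapT => hno.
have st (t : {E | F E}) : {t' : {E | F E} |
    (forall x, sval t' x -> sval t x) /\ exists x, sval t x /\ ~ sval t' x}.
  apply: cid; apply: contrapT => h; apply: hno; case: t h => E FE h; exists E => //.
  move=> E' FE' sub x Ex; apply: contrapT => nE'x; apply: h.
  by exists (exist _ E' FE'); split=> //; exists x.
pose t n := iter n (fun t => sval (st t)) (exist _ E0 FE0).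
have [n|n x|n nE] := hM (fun n => sval (t n)).
- by apply: hF; apply: svalP.
- exact: (svalP (st (t n))).1.
have [x [xn nx]] := (svalP (st (t n))).2.
by apply: nx; apply: (nE n.+1).
Qed.
End Chains.

(** * Baer's criterion for injectivity *)

Section Baer.
Variables (A : nzRingType) (N : lmodType A).
Local Open Scope classical_set_scope.

(** For a submodule of [M * N], the fibre over 0 decides whether it is the graph of a partial
    map. *)
Let functional (M : lmodType A) (G : set (M * N)) := forall n, G (0, n) -> n = 0.

Lemma baer : (forall (K : lmodType A) (j : {linear K -> reg A}) (f : {linear K -> N}),
    injective j -> exists g : {linear reg A -> N}, forall x, g (j x) = f x) ->
  injective_module N.
Proof.
move=> hN X Y j f jI.
pose base : set (Y * N) := [set z | exists x, z = (j x, f x)].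
pose ok (G : set (Y * N)) := [/\ issub (M := (Y * N)%type) G,
  functional G & base `<=` G].
have okb : ok base.
  split=> // [|n [x [/esym jx ->]]].
    split; first by exists 0; rewrite !linear0.
    by move=> a _ _ [x ->] [y ->]; exists (a *: x + y); rewrite !linearP.
  have -> : x = 0 by apply: jI; rewrite jx linear0.
  exact: linear0.
have [|G [PG Gmax]] := @Zorn_bigcup _ (fun G => G = set0 \/ ok G).
  move=> F FP tot.
  have [[G0 [FG0 okG0]]|hno] := pselect (exists G, F G /\ ok G); last first.
    left; apply/seteqP; split=> // z [G FG Gz].
    by have [e|okG] := FP _ FG; [rewrite e in Gz|case: hno; exists G].
  right; split=> [|n [G FG Gn]|z bz].
  - split; first by exists G0 => //; case: okG0 => -[].
    move=> a x y [G1 F1 x1] [G2 F2 y2].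
    have [s|s] := tot _ _ F1 F2.
      have [e|[[_ h] _ _]] := FP _ F2; first by rewrite e in y2.
      by exists G2 => //; apply: h => //; apply: s.
    have [e|[[_ h] _ _]] := FP _ F1; first by rewrite e in x1.
    by exists G1 => //; apply: h => //; apply: s.
  - have [e|[_ h _]] := FP _ FG; first by rewrite e in Gn.
    exact: h.
  - by exists G0 => //; case: okG0 => _ _; apply.
have okG : ok G.
  case: PG => // G0; exfalso; apply: (Gmax base); last by right.
  rewrite G0; split=> //; first by move=> /(_ (0, 0)); apply; exists 0; rewrite !linear0.
have [Gs Gf Gb] := okG.
have uniq y n n' : G (y, n) -> G (y, n') -> n = n'.
  move=> h h'; apply/eqP; rewrite -subr_eq0; apply/eqP/Gf.
  by have := issubB Gs h h'; rewrite -[_ - _]/(y - y, n - n') subrr.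
have dom y0 : exists n, G (y0, n).
  apply: contrapT => hy0.
  (* The scalars carrying [y0] into the domain form a left ideal. The partial map on it extends to
     the ring, and the image of 1 becomes the value at [y0]. *)
  pose I (a : reg A) := exists n, G ((a : A) *: y0, n).
  have hI : issub I.
    split; first by exists 0; rewrite scale0r; apply: Gs.1.
    move=> a x y [n Gx] [m Gy]; exists (a *: n + m).
    have := Gs.2 a _ _ Gx Gy.
    by rewrite -[_ + _]/(a *: (x *: y0) + y *: y0, a *: n + m) scalerA -scalerDl.
  have /choice[h hE] (z : subm hI) : exists n, G ((subval hI z : A) *: y0, n).
    exact: (subvalP z).
  have hl : linear h.
    move=> a x y; apply: uniq (hE _) _.
    have := Gs.2 a _ _ (hE x) (hE y).
    rewrite -[_ + _]/(a *: ((subval hI x : A) *: y0) + (subval hI y : A) *: y0,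
      a *: h x + h y) scalerA -scalerDl.
    by rewrite linearP.
  have [g gE] := hN _ _ (mklin hl) (@subval_inj _ _ _ hI).
  pose n0 := g (reg1 A).
  have gn0 a : g a = (a : A) *: n0 by rewrite [in LHS](regE a) linearZ.
  pose G' : set (Y * N) := [set z | exists (a : A) w, G w /\
     z = (w.1 + a *: y0, w.2 + a *: n0)].
  have sub : G `<=` G'.
    by move=> [y n] Gyn; exists 0, (y, n); rewrite !scale0r !addr0.
  apply: (Gmax G'); last first.
    right; split=> [|n|z /Gb/sub//].
    - split; first exact/sub/Gs.1.
      move=> c _ _ [a [w [Gw ->]]] [b [v [Gv ->]]].
      exists (c * a + b), (c *: w + v); split; first exact: Gs.2.
      apply: injective_projections => /=.
        by rewrite scalerDr !scalerA scalerDl addrACA.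
      by rewrite scalerDr !scalerA scalerDl addrACA.
    move=> [a [[y m] [Gw [/esym e ->]]]] /=.
    have Ga : G (a *: y0, - m).
      have := issubZ (-1) Gs Gw.
      rewrite -[_ *: _]/(-1 *: y, -1 *: m) !scaleN1r.
      by have /= -> : - y = a *: y0 by apply/eqP; rewrite eqr_oppLR -addr_eq0 -e.
    have [z zE] : exists z, subval hI z = a by apply: subval_ex; exists (- m).
    have := gE z; rewrite zE gn0 /= => ->.
    have -> : h z = - m by have := hE z; rewrite zE => /uniq; apply.
    by rewrite subrr.
  split=> // s; apply: hy0; exists n0; apply: s; exists 1, (0, 0).
  by rewrite !scale1r !add0r; split=> //; apply: Gs.1.
have [g gE] := choice dom.
have gl : linear g.
  by move=> a x y; apply: uniq (gE _) _; apply: (Gs.2 a _ _ (gE x) (gE y)).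
exists (mklin gl) => x; apply: uniq (gE _) _; apply: Gb; by exists x.
Qed.
End Baer.

(** With [f = D p] for [p : M -> M/K], the functor [D'] turns the cokernel of [f] into the kernel of
    [D' f], which [eta] identifies with [K]. So [K] is an image of the finitely generated
    [D' (Coker f)]. The functors are abstract so that both sides of the duality are covered. *)
Lemma dual_noeth (A B : nzRingType) (D : lmodType A -> lmodType B)
  (Dm : forall M M' : lmodType A, {linear M -> M'} -> {linear D M' -> D M})
  (D' : lmodType B -> lmodType A)
  (Dm' : forall M M' : lmodType B, {linear M -> M'} -> {linear D' M' -> D' M})
  (eta : forall M : lmodType A, {linear M -> D' (D M)}) :
  (forall M, fingen M -> fingen (D M)) ->
  (forall M, fingen M -> fingen (D' M)) ->
  (forall M, fingen M -> bijective (eta M)) ->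
  (forall (M M' : lmodType A) (h : {linear M -> M'}), fingen M -> fingen M' ->
     forall x, eta M' (h x) = Dm' _ _ (Dm _ _ h) (eta M x)) ->
  (forall (X Y : lmodType B) (f : {linear X -> Y}) phi,
     Dm' _ _ f phi = 0 <-> exists psi, Dm' _ _ (cokerproj f) psi = phi) ->
  noeth A.
Proof.
move=> fD fD' eta_bij nat lex M K j jI fM.
pose p := cokerproj j.
have pS : surj p := @cokerproj_surj _ _ _ j.
have fN : fingen (Coker j) by apply: fingen_surj pS fM.
pose f := Dm _ _ p; pose h := Dm' _ _ (cokerproj f).
have fZ : fingen (Coker f).
  by apply: fingen_surj (@cokerproj_surj _ _ _ f) _; apply: fD.
have [g [eg ge]] := lin_inv (eta_bij M fM).
have [t tE] : exists t : {linear D' (Coker f) -> K}, forall z, j (t z) = lcomp g h z.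
  apply: lin_lift => // z; apply/coker_exact; rewrite -/p /=.
  apply: (bij_inj (eta_bij _ fN)); rewrite nat // ge linear0.
  by apply/lex; exists z.
apply: (@fingen_surj _ _ _ t _ (fD' _ fZ)).
move=> k; have /lex[z zE] : Dm' _ _ f (eta M (j k)) = 0.
  rewrite -nat //; have -> : p (j k) = 0 by apply/coker_exact; exists k.
  exact: linear0.
by exists z; apply: jI; rewrite tE /= -/h /h zE eg.
Qed.

(** * Chain conditions and injectivity of U from a Morita duality *)

Section Duality.
Variables (S R : nzRingType) (U : bimodule S R).

Lemma HomR_lin (M : rmodType R) (f : HomR U M) :
  exists g : {linear M -> bim_right U}, forall x, g x = val f x.
Proof. by have /asboolP fl := valP f; exists (mklin fl). Qed.
Lemma HomS_lin (N : lmodType S) (f : HomS U N) :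
  exists g : {linear N -> bim_left U}, forall x, g x = val f x.
Proof. by have /asboolP fl := valP f; exists (mklin fl). Qed.
Lemma HomR_mk (M : rmodType R) (g : {linear M -> bim_right U}) :
  exists f : HomR U M, forall x, val f x = g x.
Proof.
have gl : (g : M -> bim_right U) \in @homR_pred S R U M.
  by apply/asboolP => a x y; rewrite linearP.
by exists (Sub (g : M -> bim_right U) gl).
Qed.
Lemma HomS_mk (N : lmodType S) (g : {linear N -> bim_left U}) :
  exists f : HomS U N, forall x, val f x = g x.
Proof.
have gl : (g : N -> bim_left U) \in @homS_pred S R U N.
  by apply/asboolP => a x y; rewrite linearP.
by exists (Sub (g : N -> bim_left U) gl).
Qed.
Lemma HomR_ext (M : rmodType R) (f g : HomR U M) :
  (forall x, val f x = val g x) -> f = g.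
Proof. by move=> h; apply: val_inj; apply: functional_extensionality_dep. Qed.
Lemma HomS_ext (M : lmodType S) (f g : HomS U M) :
  (forall x, val f x = val g x) -> f = g.
Proof. by move=> h; apply: val_inj; apply: functional_extensionality_dep. Qed.
Lemma HomR_val0 (M : rmodType R) (f : HomR U M) : val f 0 = 0 :> bim_right U.
Proof. by have [g <-] := HomR_lin f; rewrite linear0. Qed.
Lemma HomS_val0 (M : lmodType S) (f : HomS U M) : val f 0 = 0 :> bim_left U.
Proof. by have [g <-] := HomS_lin f; rewrite linear0. Qed.

Definition homRm (M M' : rmodType R) (h : {linear M -> M'}) :
  {linear HomR U M' -> HomR U M} := HomR_map (U := U) h.
Definition homSm (M M' : lmodType S) (h : {linear M -> M'}) :
  {linear HomS U M' -> HomS U M} := HomS_map (U := U) h.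

Lemma homR_lex (X Y : rmodType R) (f : {linear X -> Y}) phi :
  homRm f phi = 0 <-> exists psi, homRm (cokerproj f) psi = phi.
Proof.
split=> [e|[psi <-]]; last first.
  apply: HomR_ext => x.
  have fx : cokerproj f (f x) = 0 by apply/coker_exact; exists x.
  by rewrite /= fx HomR_val0.
have [g gE] := HomR_lin phi.
have [h hE] : exists h : {linear Coker f -> bim_right U},
    forall y, h (cokerproj f y) = g y.
  apply: lin_desc; first exact: cokerproj_surj.
  move=> y /coker_exact[x <-]; rewrite gE.
  by rewrite -[LHS]/(val (homRm f phi) x) e.
have [psi psiE] := HomR_mk h; exists psi; apply: HomR_ext => y.
by rewrite -gE -hE; apply: psiE.
Qed.

Lemma homS_lex (X Y : lmodType S) (f : {linear X -> Y}) phi :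
  homSm f phi = 0 <-> exists psi, homSm (cokerproj f) psi = phi.
Proof.
split=> [e|[psi <-]]; last first.
  apply: HomS_ext => x.
  have fx : cokerproj f (f x) = 0 by apply/coker_exact; exists x.
  by rewrite /= fx HomS_val0.
have [g gE] := HomS_lin phi.
have [h hE] : exists h : {linear Coker f -> bim_left U},
    forall y, h (cokerproj f y) = g y.
  apply: lin_desc; first exact: cokerproj_surj.
  move=> y /coker_exact[x <-]; rewrite gE.
  by rewrite -[LHS]/(val (homSm f phi) x) e.
have [psi psiE] := HomS_mk h; exists psi; apply: HomS_ext => y.
by rewrite -gE -hE; apply: psiE.
Qed.

Hypothesis dual : hom_duality U.

Lemma noethR : noeth R^c.
Proof.
have [h1 h2 [eta [h3 h4]] _] := dual.
exact: (dual_noeth (Dm := homRm) (Dm' := homSm) h1 h2 h3 h4 homS_lex).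
Qed.

Lemma noethS : noeth S.
Proof.
have [h1 h2 _ [theta [h3 h4]]] := dual.
exact: (dual_noeth (Dm := homSm) (Dm' := homRm) h2 h1 h3 h4 homR_lex).
Qed.

(** The natural isomorphism [eta] is not assumed to be evaluation. Naturality along [elt x : R -> M]
    still shows that [eta] kills [x], because Hom(elt x, U) vanishes. *)
Lemma U_cogen_fingen (M : rmodType R) (x : M) : fingen M ->
  (forall f : {linear M -> bim_right U}, f x = 0) -> x = 0.
Proof.
move=> fM hx; have [_ _ [eta [eta_bij nat]] _] := dual.
apply: (bij_inj (eta_bij M fM)); rewrite linear0.
rewrite -{1}(elt1 x) nat //; last exact: fingen_reg.
apply: HomS_ext => f /=.
suff -> : HomR_map (elt x) f = 0 by rewrite HomS_val0.
apply: HomR_ext => a /=; have [g <-] := HomR_lin f.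
by rewrite linearZ /= hx scaler0.
Qed.

(** A descending chain in [M] has an ascending chain of annihilators in the noetherian S-module
    Hom(M, U); equal annihilators force equal submodules because [U] cogenerates the finitely
    generated quotients of [M]. *)
Lemma dcc_fingen (M : rmodType R) : fingen M -> dcc M.
Proof.
move=> fM K hK dec.
pose L n (f : HomR U M) := forall x, K n x -> val f x = 0 :> bim_right U.
have [h1 _ _ _] := dual.
have [|n f Lf x kx|n nE] := noeth_acc noethS (h1 M fM) (K := L).
- move=> n; split=> [x _ //|s f g Lf Lg x kx].
  rewrite -[LHS]/(lact s (val f x) + val g x : bim_right U) Lf // Lg // addr0.
  by apply: (addIr (lact s 0)); rewrite -lactDr addr0 add0r.
- by apply: Lf; apply: dec.
exists n => m x kx.
have /coker_exact[y <-] : cokerproj (subval (hK m)) x = 0; last exact: subvalP.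
apply: U_cogen_fingen; first exact: fingen_surj (@cokerproj_surj _ _ _ _) fM.
move=> g; have [f fE] := HomR_mk (lcomp g (cokerproj (subval (hK m)))).
rewrite -[LHS]/(lcomp g (cokerproj (subval (hK m))) x) -fE; apply: (nE m f) kx.
move=> y ky; rewrite fE /=.
suff -> : cokerproj (subval (hK m)) y = 0 by rewrite linear0.
by apply/coker_exact; apply: subval_ex.
Qed.

Lemma acc_fingen (M : rmodType R) : fingen M -> acc M.
Proof. exact: noeth_acc noethR. Qed.

(** By Baer it suffices that restriction [r] to a right ideal [K] is onto. An element of Hom(Coker
    r, U) corresponds to some [k] in [K] with [j k = 0], so it vanishes; then its double dual
    [Coker r] is zero. *)
Lemma U_injective : injective_module (bim_right U).
Proof.
apply: baer => K j f jI.
have [h1 h2 [eta [eta_bij nat]] [theta [theta_bij _]]] := dual.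
have fM := fingen_reg R^c.
have fK : fingen K := noethR jI fM.
pose r := homRm j.
have fZ : fingen (Coker r).
  by apply: fingen_surj (@cokerproj_surj _ _ _ r) _; apply: h1.
have D0 (psi : HomS U (Coker r)) : psi = 0.
  have [k kE] := bij_surj (eta_bij K fK) (homSm (cokerproj r) psi).
  have k0 : k = 0.
    apply: jI; rewrite linear0; apply: (bij_inj (eta_bij _ fM)).
    rewrite nat // linear0 kE; apply/(homS_lex r); by exists psi.
  have e : homSm (cokerproj r) psi = 0 by rewrite -kE k0 linear0.
  apply: HomS_ext => z; have [y <-] := cokerproj_surj z.
  exact: (congr1 (fun t : HomS U (HomR U K) => val t y) e).
have Z0 (z : Coker r) : z = 0.
  apply: (bij_inj (theta_bij _ fZ)); apply: HomR_ext => psi.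
  by rewrite (D0 psi) !HomR_val0.
have [phi phiE] := HomR_mk f.
have /coker_exact[g gE] := Z0 (cokerproj r phi).
have [g' g'E] := HomR_lin g; exists g' => x.
by rewrite g'E -phiE -gE.
Qed.

(** A nonzero element is detected on the cyclic submodule it generates, and injectivity extends the
    detecting map to [N]. *)
Lemma U_cogenerator : cogenerator (bim_right U).
Proof.
move=> N; exists {linear N -> bim_right U}.
exists (ptuple (X := fun _ : {linear N -> bim_right U} => bim_right U) (fun h => h)).
apply: lin_injP => x e.
have ex (f : {linear N -> bim_right U}) : f x = 0.
  rewrite -(ptupleE (X := fun _ : {linear N -> bim_right U} => bim_right U)
    (fun h => h) f x) e.
  exact: linear0.
pose P y := exists a, elt x a = y.
have hP : issub P.
  split; first by exists 0; rewrite linear0.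
  by move=> a _ _ [b <-] [c <-]; exists (a *: b + c); rewrite linearP.
have [z zE] : exists z, subval hP z = x.
  by apply: subval_ex; exists (reg1 _); rewrite elt1.
have fZ : fingen (subm hP).
  have [t tE] : exists t : {linear reg R^c -> subm hP},
      forall a, subval hP (t a) = elt x a.
    apply: lin_lift; first exact: subval_inj.
    by move=> a; apply: subval_ex; exists a.
  apply: (@fingen_surj _ _ _ t _ (fingen_reg _)).
  move=> y; have [a aE] := subvalP y; exists a.
  by apply: (@subval_inj _ _ _ hP); rewrite tE.
rewrite -zE (_ : z = 0) ?linear0 //.
apply: U_cogen_fingen => // f.
have [g gE] := U_injective f (@subval_inj _ _ _ hP).
by rewrite -gE zE ex.
Qed.
End Duality.

(** * Fitting's lemma and the Krull-Schmidt theorem *)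

Section KrullSchmidt.
Variable A : nzRingType.
Implicit Types B C M N X Y Z : lmodType A.

Fixpoint lpow M (t : {linear M -> M}) n : {linear M -> M} :=
  if n is n'.+1 then lcomp t (lpow t n') else lid M.

Lemma lpowD M (t : {linear M -> M}) m n x :
  lpow t (m + n) x = lpow t m (lpow t n x).
Proof. by elim: m => //= m ->. Qed.

Lemma lpow_le M (t : {linear M -> M}) m n x : (m <= n)%N ->
  lpow t m x = 0 -> lpow t n x = 0.
Proof. by move=> /subnK <- e; rewrite lpowD e linear0. Qed.

Lemma nonzeroPn M : ~ nonzero M -> forall x : M, x = 0.
Proof. by move=> h x; apply: contrapT => xn; apply: h; exists x. Qed.

Lemma fitting M (t : {linear M -> M}) : acc M -> dcc M -> indecomposable M ->
  bijective t \/ exists n, forall x, lpow t n x = 0.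
Proof.
move=> hacc hdcc [_ indec].
have [n|n x|n1 n1E] := hacc (fun n x => lpow t n x = 0).
- split=> [|a x y ex ey]; first exact: linear0.
  by rewrite linearP ex ey scaler0 addr0.
- by apply: lpow_le.
have [n|n x [y <-]|n2 n2E] := hdcc (fun n x => exists y, lpow t n y = x).
- split=> [|a _ _ [x <-] [y <-]]; first by exists 0; rewrite linear0.
  by exists (a *: x + y); rewrite linearP.
- by exists (t y); rewrite -addn1 lpowD.
(* At this exponent both the kernels and the images of the powers are stable, so [M] is the direct
   sum of the two and one of them is zero. *)
pose n := (n1 + n2)%N.
have kE m x : lpow t m x = 0 -> lpow t n x = 0.
  by move=> /n1E; apply: lpow_le; apply: leq_addr.
have iE m x : (exists y, lpow t n y = x) -> exists y, lpow t m y = x.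
  by move=> [y <-]; apply: n2E; exists (lpow t n1 y); rewrite -lpowD addnC.
have hK : issub (fun x => lpow t n x = 0).
  split=> [|a x y ex ey]; first exact: linear0.
  by rewrite linearP ex ey scaler0 addr0.
have hI : issub (fun x => exists y, lpow t n y = x).
  split=> [|a _ _ [x <-] [y <-]]; first by exists 0; rewrite linear0.
  by exists (a *: x + y); rewrite linearP.
have dec x : exists y, lpow t n (x - lpow t n y) = 0.
  have [|y yE] := iE (n + n)%N (lpow t n x); first by exists x.
  by exists y; rewrite linearB -lpowD yE subrr.
have cap x : lpow t n x = 0 -> (exists y, lpow t n y = x) -> x = 0.
  by move=> e [y yE]; rewrite -yE; apply: (kE (n + n)%N); rewrite lpowD yE.
have iso : isom M (subm hK * subm hI)%type.
  apply: isom_sym; exists (lcopair (subval hK) (subval hI)); apply: inj_surj_bij.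
    apply: lin_injP => -[x y] /= e.
    have hy := subvalP y; have hx := subvalP x; rewrite /= in hx hy.
    have xE : subval hK x = - subval hI y by apply/eqP; rewrite -addr_eq0 e.
    have y0 : subval hI y = 0.
      by apply: cap => //; rewrite -[subval hI y]opprK -xE linearN hx oppr0.
    have -> : y = 0 by apply: (@subval_inj _ _ _ hI); rewrite y0 linear0.
    by have -> : x = 0 by apply: (@subval_inj _ _ _ hK); rewrite xE y0 oppr0 linear0.
  move=> x; have [y yE] := dec x.
  have [a aE] := subval_ex hK yE.
  have [b bE] : exists b, subval hI b = lpow t n y by apply: subval_ex; exists y.
  by exists (a, b); rewrite /= aE bE subrK.
have [/nonzeroPn K0|/contrapT nzK] := pselect (~ nonzero (subm hK)).
  have K0' x : lpow t n x = 0 -> x = 0.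
    by move=> /(subval_ex hK)[z <-]; rewrite (K0 z) linear0.
  left; apply: inj_surj_bij.
    by apply: lin_injP => x tx; apply: K0'; apply: (kE 1%N).
  move=> x; have [y /K0'/eqP] := dec x; rewrite subr_eq0 => /eqP xE.
  by have [|z zE] := iE 1%N x; [exists y|exists z].
right; exists n => x.
have /nonzeroPn I0 : ~ nonzero (subm hI) by move=> h; apply: (indec _ _ iso).
have [z <-] : exists z, subval hI z = lpow t n x by apply: subval_ex; exists x.
by rewrite (I0 z) linear0.
Qed.

Lemma nilpotent_sub_bij M (u : {linear M -> M}) n : (forall x, lpow u n x = 0) ->
  bijective (lsub (lid M) u).
Proof.
move=> un; apply: inj_surj_bij.
  apply: lin_injP => x /= /eqP; rewrite subr_eq0 => /eqP xE.
  rewrite -(un x); elim: n {un} => //= m <-; exact: xE.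
move=> x; exists (\sum_(k < n) lpow u k x).
suff tel m : lsub (lid M) u (\sum_(k < m) lpow u k x) = x - lpow u m x.
  by rewrite tel un subr0.
elim: m => [|m IH]; first by rewrite big_ord0 linear0 subrr.
by rewrite big_ord_recr linearD IH /= addrA subrK.
Qed.

(** By Fitting, either [g^-1 f_i] is bijective or it is nilpotent. In the second case [1 - g^-1 f_i]
    is invertible, so the sum of the remaining terms is still bijective and induction applies. *)
Lemma local_sum M (I : Type) (s : seq I) (f : I -> {linear M -> M})
    (g : {linear M -> M}) : acc M -> dcc M -> indecomposable M ->
  bijective g -> (forall x, g x = \sum_(i <- s) f i x) -> exists i, bijective (f i).
Proof.
move=> ha hd hM; elim: s g => [|i s IH] g bg gE.
  have [[x xn] _] := hM; case: xn; apply: (bij_inj bg).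
  by rewrite linear0 gE big_nil.
have [h|nb] := pselect (bijective (f i)); first by exists i.
have [g' [gg' g'g]] := lin_inv bg.
have [hb|[n hn]] := fitting (lcomp g' (f i)) ha hd hM.
  case: nb; apply: (@eq_bij _ _ (g \o (g' \o f i))); first exact: bij_comp.
  by move=> x /=; rewrite g'g.
have bu := nilpotent_sub_bij hn.
apply: (IH (lcomp g (lsub (lid M) (lcomp g' (f i))))); first exact: bij_comp.
by move=> x /=; rewrite linearB g'g gE big_cons addrC addKr.
Qed.

Lemma indec_iso X Y (a : {linear X -> Y}) (b : {linear Y -> X}) :
  nonzero X -> indecomposable Y -> bijective (lcomp b a) -> bijective a.
Proof.
move=> nX [_ hY] /lin_inv[c [cK Kc]].
pose r := lcomp c b.
have ra x : r (a x) = x by apply: cK.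
have [q qE] : exists q : {linear Y -> Ker r},
    forall x, kerval r (q x) = lsub (lid Y) (lcomp a r) x.
  apply: lin_lift; first exact: kerval_inj.
  by move=> w; apply: kerval_ex; rewrite linearB /= -[c (b (a _))]/(r (a _)) ra subrr.
have iso : isom Y (X * Ker r)%type.
  exists (lpair r q); exists (lcopair a (kerval r)) => [x|[x y]] /=.
    by rewrite qE /= addrC subrK.
  have rx : r (a x + kerval r y) = x by rewrite linearD ra kervalK addr0.
  congr pair; first exact: rx.
  apply: (@kerval_inj _ _ _ r); rewrite qE /= -[c (b _)]/(r (a x + kerval r y)) rx.
  by rewrite addrC addKr.
have /nonzeroPn K0 : ~ nonzero (Ker r) by move=> h; apply: (hY _ _ iso).
exists r => // y; have := qE y; rewrite (K0 (q y)) linear0 => /esym/eqP.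
by rewrite subr_eq0 => /eqP.
Qed.

(** [fac] is the case of the identity map; allowing arbitrary maps makes the notion closed under
    sums and compositions. *)
Definition factors_through C M N (f : M -> N) := exists (I : Type) (s : seq I)
  (a : I -> {linear M -> C}) (b : I -> {linear C -> N}),
  forall x, f x = \sum_(i <- s) b i (a i x).

Lemma factors_through_comp C M N M' N' (f : M -> N) (g : {linear M' -> M})
    (h : {linear N -> N'}) :
  factors_through C f -> factors_through C (fun x => h (f (g x))).
Proof.
move=> [I [s [a [b ab]]]]; exists I, s, (fun i => lcomp (a i) g), (fun i => lcomp h (b i)).
by move=> x; rewrite ab linear_sum.
Qed.
Lemma factors_through_add C M N (f g : M -> N) :
  factors_through C f -> factors_through C g ->
  factors_through C (fun x => f x + g x).
Proof.
move=> [I [s [a [b ab]]]] [J [t [c [d cd]]]].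
exists (I + J)%type, ([seq inl i | i <- s] ++ [seq inr j | j <- t]),
  (fun k => match k with inl i => a i | inr j => c j end),
  (fun k => match k with inl i => b i | inr j => d j end) => x.
by rewrite big_cat /= !big_map ab cd.
Qed.
Lemma factors_through_sum C M N (I : Type) (s : seq I) (f : I -> M -> N) :
  (forall i, factors_through C (f i)) -> factors_through C (fun x => \sum_(i <- s) f i x).
Proof.
move=> h; elim: s => [|i s [J [t [c [d cd]]]]].
  by exists unit, [::], (fun _ => lzero M C), (fun _ => lzero C N) => x; rewrite !big_nil.
have [K [u [a [b ab]]]] := factors_through_add (h i) (ex_intro _ J (ex_intro _ t
  (ex_intro _ c (ex_intro _ d cd)))).
by exists K, u, a, b => x; rewrite big_cons ab.
Qed.

Lemma fac_fin C n (X : 'I_n -> lmodType A) : (forall i, fac C (X i)) -> fac C (DSum X).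
Proof.
move=> h.
have [I [s [a [b ab]]]] : factors_through C (fun x => \sum_(i < n) sinj i (sproj i x : X i)).
  apply: factors_through_sum => i.
  exact: (@factors_through_comp _ _ _ _ _ _ (sproj i) (sinj i) (h i)).
by exists I, s, a, b => x; rewrite -ab -dsum_fin.
Qed.

Lemma fac_dsum_indec n (X : 'I_n -> lmodType A) Z : acc Z -> dcc Z ->
  indecomposable Z -> (forall i, indecomposable (X i)) -> fac (DSum X) Z ->
  exists j, isom Z (X j).
Proof.
move=> ha hd hZ hX [I [s [a [b ab]]]].
have bid : bijective (lid Z) by exists id.
have [|[i j] bij] := @local_sum Z _ [seq (i, j) | i <- s, j <- enum 'I_n]
  (fun ij => lcomp (lcomp (b ij.1) (sinj ij.2)) (lcomp (sproj ij.2) (a ij.1)))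
  (lid Z) ha hd hZ bid.
  move=> x; rewrite big_allpairs /= [LHS]ab; apply: eq_bigr => i _.
  by rewrite {1}(dsum_fin (a i x)) linear_sum big_enum.
exists j; exists (lcomp (sproj j) (a i)); apply: indec_iso bij => //.
by case: hZ.
Qed.

(** Each summand of one module is isomorphic to a summand of the other. As the summands are pairwise
    non-isomorphic, both index maps are injective, and counting makes them bijective. *)
Lemma basic_isom C C' : fingen C -> fingen C' ->
  (forall M, fingen M -> acc M) -> (forall M, fingen M -> dcc M) ->
  basic C -> basic C' -> fac C C' -> fac C' C -> isom C C'.
Proof.
move=> fC fC' ha hd [_ [n [X [iC hX nX]]]] [_ [m [Y [iC' hY nY]]]] CC' C'C.
have match_ D D' k l (V : 'I_k -> lmodType A) (W : 'I_l -> lmodType A) :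
    fingen D -> isom D (DSum V) -> isom D' (DSum W) -> fac D' D ->
    (forall i, indecomposable (V i)) -> (forall i, indecomposable (W i)) ->
    forall i, exists j, isom (V i) (W j).
  move=> fD iD iD' fDD hV hW i.
  have rV : retract (V i) D.
    apply: (@retract_trans _ _ (DSum V)); last exact/isom_retract/isom_sym.
    by exists (sinj i), (sproj i) => x; rewrite sinjK.
  have fV := fingen_retract rV fD.
  apply: fac_dsum_indec => //; [exact: ha|exact: hd|].
  apply: fac_trans (isom_fac iD') _; apply: fac_trans fDD _; exact: retract_fac.
have /choice[f fE] := match_ _ _ _ _ _ _ fC iC iC' C'C hX hY.
have /choice[g gE] := match_ _ _ _ _ _ _ fC' iC' iC CC' hY hX.
have fI : injective f.
  move=> i j e; apply: contrapT => /nX; apply; apply: isom_trans (fE i) _.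
  by rewrite e; apply: isom_sym.
have gI : injective g.
  move=> i j e; apply: contrapT => /nY; apply; apply: isom_trans (gE i) _.
  by rewrite e; apply: isom_sym.
have nm : n = m.
  apply/eqP; rewrite eqn_leq.
  by have := leq_card f fI; have := leq_card g gI; rewrite !card_ord => -> ->.
have fS j : exists i, f i = j.
  have le : (#|'I_m| <= #|'I_n|)%N by rewrite !card_ord nm.
  by have /codomP[i ->] := inj_card_onto fI le j; exists i.
apply: isom_trans iC (isom_trans _ (isom_sym iC')).
pose phi i := sval (cid (fE i)).
have phiB i : bijective (phi i) := svalP (cid (fE i)).
pose F : {linear DSum X -> DSum Y} :=
  sdesc (fun i => lcomp (sinj (X := Y) (f i)) (phi i)).
have FE i x : sproj (f i) (F x) = phi i (sproj i x).
  rewrite -[LHS]/(lcomp (sproj (f i)) F x) -[RHS]/(lcomp (phi i) (sproj i) x).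
  move: x; apply: dsum_eq => j x /=; rewrite sdescE /=.
  have [e|e] := pselect (j = i).
    by move: x; case: _ / (esym e) => x; rewrite !sinjK.
  by rewrite !sinj0 ?linear0 // => /fI.
exists F; apply: inj_surj_bij.
  apply: lin_injP => x Fx; apply: dsum_ext => i; apply: (bij_inj (phiB i)).
  by rewrite -FE Fx !linear0.
apply: dsum_ind.
  split; first by exists 0; rewrite linear0.
  by move=> a _ _ [x <-] [y <-]; exists (a *: x + y); rewrite linearP.
move=> j; have [i <-] := fS j => y; have [x <-] := bij_surj (phiB i) y.
by exists (sinj i x); rewrite sdescE.
Qed.

(** A failure propagates to ever smaller quotients. Each is kept with its map from [M], so that the
    strictly growing kernels form a chain in one noetherian module. *)
Lemma fingen_ind (P : lmodType A -> Prop) : noeth A ->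
  (forall M, fingen M ->
     (forall N (f : {linear M -> N}), surj f -> ~ injective f -> P N) -> P M) ->
  forall M, fingen M -> P M.
Proof.
move=> hn step M fM; apply: contrapT => nPM.
pose T := {N : lmodType A & {linear M -> N}}.
pose ok (t : T) := surj (projT2 t) /\ ~ P (projT1 t).
have next (t : {t | ok t}) : {t' : {t | ok t} |
    (forall x, projT2 (sval t) x = 0 -> projT2 (sval t') x = 0) /\
    exists x, projT2 (sval t') x = 0 /\ projT2 (sval t) x <> 0}.
  apply: cid; case: t => -[N f] [/= fS nPN]; apply: contrapT => h; apply: nPN.
  apply: step => [|N' g gS gI]; first exact: fingen_surj fS fM.
  apply: contrapT => nPN'; apply: h.
  have okt : ok (existT _ N' (lcomp g f)).
    split=> //= y; have [z <-] := gS y; have [x <-] := fS z; by exists x.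
  exists (exist _ _ okt); split=> /= [x ->|]; first exact: linear0.
  apply: contrapT => h; apply: gI; apply: lin_injP => z gz.
  have [x xE] := fS z; apply: contrapT => zn; apply: h; exists x.
  by rewrite xE.
have ok0 : ok (existT _ M (lid M)) by split=> // x; exists x.
pose t n := iter n (fun t => sval (next t)) (exist _ _ ok0).
have [n|n x|n nE] := noeth_acc hn fM (K := fun n x => projT2 (sval (t n)) x = 0).
- split=> [|a x y ex ey]; first exact: linear0.
  by rewrite linearP ex ey scaler0 addr0.
- exact: (svalP (next (t n))).1.
have [x [xn nx]] := (svalP (next (t n))).2.
by apply: nx; apply: (nE n.+1).
Qed.

(** A module that is not indecomposable splits into two proper quotients of itself. A factorisation
    of the identity is recorded instead of a direct sum, which is all that comparing add-closures
    requires. *)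
Lemma indec_decomposition M : noeth A -> fingen M ->
  exists (I : finType) (X : I -> lmodType A) (a : forall i, {linear M -> X i})
    (b : forall i, {linear X i -> M}),
  [/\ forall i, indecomposable (X i), forall i, fac M (X i) &
      forall x, x = \sum_i b i (a i x)].
Proof.
move=> hn; move: M; apply: fingen_ind => // M fM IH.
have [nz|/nonzeroPn M0] := pselect (nonzero M); last first.
  exists void, (fun _ => M), (fun _ => lid M), (fun _ => lid M); split=> [[]|[]|x].
  by rewrite big_pred0 // => -[].
have [hM|] := pselect (indecomposable M).
  exists unit, (fun _ => M), (fun _ => lid M), (fun _ => lid M); split=> // [_|x].
    exact: fac_refl.
  by rewrite (big_pred1 tt) // => -[].
move=> nM; have [M1 [M2 [iM [[x1 n1] [x2 n2]]]]] :
    exists M1 M2, isom M (M1 * M2)%type /\ (nonzero M1 /\ nonzero M2).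
  apply: contrapT => h; apply: nM; split=> // M1 M2 iM nz12; apply: h.
  by exists M1, M2.
have [phi /lin_inv[psi [phiK psiK]]] := iM.
pose p1 := lcomp (@lfst A M1 M2) phi; pose p2 := lcomp (@lsnd A M1 M2) phi.
have p1S : surj p1 by move=> y; exists (psi (y, 0)); rewrite /= psiK.
have p2S : surj p2 by move=> y; exists (psi (0, y)); rewrite /= psiK.
have p1I : ~ injective p1.
  move=> inj; apply: n2; have /inj e : p1 (psi (0, x2)) = p1 0.
    by rewrite /= psiK linear0.
  by have := congr1 (fun z => (phi z).2) e; rewrite psiK linear0.
have p2I : ~ injective p2.
  move=> inj; apply: n1; have /inj e : p2 (psi (x1, 0)) = p2 0.
    by rewrite /= psiK linear0.
  by have := congr1 (fun z => (phi z).1) e; rewrite psiK linear0.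
have [I1 [X1 [a1 [b1 [h1 f1 ab1]]]]] := IH M1 p1 p1S p1I.
have [I2 [X2 [a2 [b2 [h2 f2 ab2]]]]] := IH M2 p2 p2S p2I.
pose X (k : I1 + I2) := match k with inl i => X1 i | inr j => X2 j end.
pose a k : {linear M -> X k} :=
  match k with inl i => lcomp (a1 i) p1 | inr j => lcomp (a2 j) p2 end.
pose b k : {linear X k -> M} :=
  match k with inl i => lcomp psi (lcomp (pair1 M1 M2) (b1 i))
     | inr j => lcomp psi (lcomp (pair2 M1 M2) (b2 j)) end.
exists (I1 + I2)%type, X, a, b; split=> [[]//|[i|j]|x].
- apply: fac_trans (f1 i); apply: retract_fac.
  exact: retract_trans (@retract_fst A M1 M2) (isom_retract (isom_sym iM)).
- apply: fac_trans (f2 j); apply: retract_fac.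
  exact: retract_trans (@retract_snd A M1 M2) (isom_retract (isom_sym iM)).
have xE : x = psi (pair1 M1 M2 (p1 x)) + psi (pair2 M1 M2 (p2 x)).
  rewrite -linearD -[LHS]phiK; congr (psi _).
  by apply: injective_projections; rewrite /= ?addr0 ?add0r.
rewrite big_sumType [LHS]xE; congr (_ + _).
  by rewrite [in LHS](ab1 (p1 x)) !linear_sum.
by rewrite [in LHS](ab2 (p2 x)) !linear_sum.
Qed.

Lemma basic_version C : noeth A -> fingen C -> nonzero C ->
  exists C0, [/\ basic C0, fac C C0 & fac C0 C].
Proof.
move=> hn fC nC.
have [I [X [a [b [hX fX ab]]]]] := indec_decomposition hn fC.
(* The representative of an isomorphism class is its member of least rank in the enumeration of
   [I]. *)
pose rep i := [forall j, (enum_rank j < enum_rank i)%N ==> ~~ `[< isom (X j) (X i) >]].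
have repE i : exists2 j, rep j & isom (X j) (X i).
  have Pi : `[< isom (X i) (X i) >] by apply/asboolP/isom_refl.
  case: (@arg_minnP I i (fun j => `[< isom (X j) (X i) >])
    (fun j => nat_of_ord (enum_rank j)) Pi) => j /asboolP ji jmin.
  exists j => //; apply/forallP => k; apply/implyP => kj; apply/asboolPn => kj'.
  have /jmin : `[< isom (X k) (X i) >] by apply/asboolP; apply: isom_trans kj' ji.
  by rewrite leqNgt kj.
pose X0 (k : 'I_#|rep|) := X (enum_val k).
have f0 : fac (DSum X0) C.
  have [J [s [c [d cd]]]] : factors_through (DSum X0) (fun x => \sum_i b i (a i x)).
    apply: factors_through_sum => i.
    apply: (@factors_through_comp _ (X i) (X i) _ _ (fun x => x) (a i) (b i)).
    have [j rj ji] := repE i.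
    have jE : X0 (enum_rank_in rj j) = X j by rewrite /X0 enum_rankK_in.
    change (fac (DSum X0) (X i)).
    apply: fac_trans (isom_fac (isom_sym ji)); rewrite -jE; apply: retract_fac.
    by exists (sinj (enum_rank_in rj j)), (sproj (enum_rank_in rj j)) => x; rewrite sinjK.
  by exists J, s, c, d => x; rewrite -cd -ab.
exists (DSum X0); split=> //; last by apply: fac_fin => k; apply: fX.
split.
  apply: contrapT => /nonzeroPn z; have [x xn] := nC; apply: xn.
  have [J [s [c [d cd]]]] := f0; rewrite [LHS]cd big1 // => i _.
  by rewrite (z (c i x)) linear0.
exists #|rep|, X0; split; [exact: isom_refl|by move=> k; apply: hX|].
have lt k l : (enum_rank (enum_val k) < enum_rank (enum_val l))%N ->
    ~ isom (X0 k) (X0 l).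
  move=> lt; have /forallP/(_ (enum_val k)) : rep (enum_val l) := enum_valP l.
  by rewrite lt /= => /asboolPn.
move=> k l kl iso.
case: (ltngtP (enum_rank (enum_val k)) (enum_rank (enum_val l))) => [/lt//|/lt|].
  by apply; apply: isom_sym.
by move=> /val_inj/enum_rank_inj/enum_val_inj.
Qed.

(** The chain is Prod C0 in Prod C in Add C in Add C0; replacing each copy by finitely many
    multiplies the index set by ['I_n] or ['I_m]. *)
Lemma pc_transfer C C0 : fac C C0 -> fac C0 C -> product_complete C ->
  product_complete C0.
Proof.
move=> /inaddP[n /retractP[i [r ri]]] /inaddP[m /retractP[j [q qj]]] pc M.
move=> [I /retractP MI].
have [J /retractP MJ] : inAdd C M.
  apply: pc; exists (I * 'I_n)%type; apply/retractP; apply: retract_trans MI _.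
  exists (ptuple (X := fun _ : I * 'I_n => C)
    (fun k => lcomp (sproj k.2) (lcomp i (pproj k.1)))).
  exists (ptuple (X := fun _ : I => C0) (fun x => lcomp r (lsum (index_enum _)
    (fun k => lcomp (sinj (X := fun _ => C) k)
      (pproj (X := fun _ : I * 'I_n => C) (x, k)))))) => x.
  apply: dprod_ext => k; rewrite ptupleE /= -[RHS]ri; congr (r _).
  by rewrite [RHS]dsum_fin; apply: eq_bigr => l _; rewrite ptupleE.
exists (J * 'I_m)%type; apply/retractP; apply: retract_trans MJ _.
pose f : {linear DSum (fun _ : J => C) -> DSum (fun _ : J * 'I_m => C0)} :=
  sdesc (fun x => lsum (index_enum _) (fun k => lcomp (sinj (X := fun _ => C0) (x, k))
    (lcomp (sproj k) j))).
pose g : {linear DSum (fun _ : J * 'I_m => C0) -> DSum (fun _ : J => C)} :=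
  sdesc (fun y => lcomp (sinj (X := fun _ => C) y.1)
    (lcomp q (sinj (X := fun _ => C0) y.2))).
exists f, g => x; rewrite -[LHS]/(lcomp g f x) -[RHS]/(lid _ x); move: x.
apply: dsum_eq => x c /=; rewrite sdescE /= linear_sum /g.
under eq_bigr => k _ do rewrite sdescE /=.
by rewrite -!linear_sum -dsum_fin qj.
Qed.

End KrullSchmidt.

(** * Nilpotent semigroups and splitting of direct sums in products *)

Section NilSemigroup.
Variables (A : nzRingType) (M : lmodType A) (J : {linear M -> M} -> Prop).

(** The elements annihilated by all n-fold products from [J]: an ascending, socle-like series. *)
Fixpoint killed n (x : M) : Prop :=
  if n is n'.+1 then forall s, J s -> killed n' (s x) else x = 0.

Lemma killed_sub n : issub (killed n).
Proof.
elim: n => [|n IH] /=; first by split=> // a x y -> ->; rewrite scaler0 addr0.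
split=> [s _|a x y kx ky s js]; first by rewrite linear0; apply: IH.1.
by rewrite linearP; apply: IH.2; [apply: kx|apply: ky].
Qed.

Hypothesis J_mul : forall s t, J s -> J t -> exists u, J u /\ forall x, u x = s (t x).
Hypothesis J_nil : forall s, J s -> exists n, forall x, lpow s n x = 0.
Hypotheses (Macc : acc M) (Mdcc : dcc M).

Lemma killed_inc n x : killed n x -> killed n.+1 x.
Proof.
case: n => [->|n kx]; first by move=> s _; rewrite linear0.
move=> s js t jt; have [u [ju <-]] := J_mul jt js.
exact: kx.
Qed.

(* If the killed submodules stop at K < M, a minimal J-stable E > K and an
   a in J with a E + K minimal satisfy a J a E <= K and E = J a E + K,
   whence a E <= K. *)
Lemma nil_semigroup : exists n, forall x, killed n x.
Proof.
have [n nE] := Macc killed_sub killed_inc; exists n.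
pose K := killed n; have Ks : issub K := killed_sub n.
have Kinv s x : J s -> K x -> K (s x) by move=> js kx; apply: killed_inc kx s js.
have Kstab x : (forall s, J s -> K (s x)) -> K x by move=> h; apply: (nE n.+1).
have Kpow s m x : J s -> K x -> K (lpow s m x).
  by move=> js kx; elim: m => //= m IH; apply: Kinv.
apply: contrapT => /existsNP[x0 nx0].
pose F1 (E : M -> Prop) := [/\ issub E, forall s x, J s -> E x -> E (s x),
  forall x, K x -> E x & exists x, E x /\ ~ K x].
have [| |E [Es Einv KE [e0 [Ee0 nKe0]]] Emin] := @dcc_min A M F1 Mdcc.
- by move=> E [].
- by exists (fun _ => True); split=> //; exists x0.
pose F2 (P : M -> Prop) := exists a, [/\ J a, exists x, E x /\ ~ K (a x) &
  forall y, P y <-> exists x k, [/\ E x, K k & y = a x + k]].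
have F2mk a : J a -> (exists x, E x /\ ~ K (a x)) ->
    F2 (fun y => exists x k, [/\ E x, K k & y = a x + k]).
  by move=> ja h; exists a; split.
have F2ne : exists P, F2 P.
  have [a [ja nKa]] : exists a, J a /\ ~ K (a e0).
    apply: contrapT => h; apply: nKe0; apply: Kstab => s js.
    by apply: contrapT => nK; apply: h; exists s.
  by eexists; apply: (F2mk a ja); exists e0.
have F2s P : F2 P -> issub P.
  move=> [a [ja aE PE]]; split.
    apply/PE; exists 0, 0; rewrite linear0 addr0.
    by split; [exact: Es.1|exact: Ks.1|].
  move=> c y y' /PE[x [k [Ex Kk ->]]] /PE[x' [k' [Ex' Kk' ->]]]; apply/PE.
  exists (c *: x + x'), (c *: k + k'); split; [exact: Es.2|exact: Ks.2|].
  by rewrite linearP scalerDr addrACA.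
have [P [a [ja [x1 [Ex1 nKx1]] PE]] Pmin] := dcc_min Mdcc F2s F2ne.
(* Otherwise, with [v = a s] and [u = a s a], minimality of [a E + K] gives [a E] inside
   [v a E + K]. Iterating, [a E] lies in [v^m a E + K], which is [K] once [v^m = 0], against the
   choice of [a]. *)
have asa s x : J s -> E x -> K (a (s (a x))).
  move=> js Ex; apply: contrapT => nK.
  have [v [jv vE]] := J_mul ja js; have [u [ju uE]] := J_mul jv ja.
  have nKu : exists x, E x /\ ~ K (u x) by exists x; rewrite uE vE.
  have uP z : (exists x k, [/\ E x, K k & z = u x + k]) -> P z.
    move=> [y' [k [Ey' Kk ->]]]; apply/PE; exists (s (a y')), k; split=> //.
      by apply: (Einv) => //; apply: Einv.
    by rewrite uE vE.
  have sub y : E y -> exists y' k, [/\ E y', K k & a y = v (a y') + k].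
    move=> Ey; have Pay : P (a y).
      by apply/PE; exists y, 0; rewrite addr0; split=> //; apply: Ks.1.
    have [y' [k [Ey' Kk e]]] := Pmin _ (F2mk u ju nKu) uP (a y) Pay.
    by exists y', k; rewrite -uE.
  have iter m y : E y -> exists y' k, [/\ E y', K k & a y = lpow v m (a y') + k].
    move=> Ey; elim: m => [|m [y' [k [Ey' Kk e]]]].
      by exists y, 0; rewrite addr0; split=> //; apply: Ks.1.
    have [y2 [k2 [Ey2 Kk2 e2]]] := sub y' Ey'.
    exists y2, (lpow v m k2 + k); split=> //.
      by apply: issubD => //; apply: Kpow.
    by rewrite e e2 linearD addrA -[lpow v m (v _)](lpowD v m 1) addn1.
  have [m vm] := J_nil jv.
  have [y [k [_ Kk e]]] := iter m x1 Ex1.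
  by apply: nKx1; rewrite e vm add0r.
(* [E1] is the submodule generated by [J a E] and [K]. It is J-stable and larger than [K], so it is
   all of [E], and [a] maps its generators into [K]. *)
pose E1 y := forall Q : M -> Prop, issub Q ->
  (forall s x, J s -> E x -> Q (s (a x))) -> (forall k, K k -> Q k) -> Q y.
have E1s : issub E1.
  split=> [Q Qs _ _|c y y' Ey Ey' Q Qs h1 h2]; first exact: Qs.1.
  by apply: Qs.2; [apply: Ey|apply: Ey'].
have [s [js nKs]] : exists s, J s /\ ~ K (s (a x1)).
  apply: contrapT => h; apply: nKx1; apply: Kstab => s js.
  by apply: contrapT => nK; apply: h; exists s.
have FE1 : F1 E1.
  split=> // [t y jt Ey Q Qs h1 h2|k Kk Q Qs h1 h2|].
  - apply: (Ey (fun y => Q (t y))) => [|t' x jt' Ex|k Kk].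
    + split=> [|c z z' Qz Qz']; first by rewrite linear0; apply: Qs.1.
      by rewrite linearP; apply: Qs.2.
    + by have [u [ju <-]] := J_mul jt jt'; apply: h1.
    + by apply: h2; apply: Kinv.
  - exact: h2.
  - by exists (s (a x1)); split=> // Q Qs h1 h2; apply: h1.
have E1E y : E1 y -> E y.
  by apply=> // t x jt Ex; apply: (Einv) => //; apply: Einv.
have EE1 := Emin E1 FE1 E1E.
apply: nKx1; apply: (EE1 x1 Ex1 (fun y => K (a y))) => [|t x jt Ex|k Kk].
- split=> [|c z z' Kz Kz']; first by rewrite linear0; apply: Ks.1.
  by rewrite linearP; apply: Ks.2.
- exact: asa.
- exact: Kinv.
Qed.
End NilSemigroup.

(** * Splitting a locally split family of copies of C inside a direct sum *)

Section SplitSum.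
Variables (A : nzRingType) (C : lmodType A) (n : nat) (X : 'I_n -> lmodType A).
Variables (eps : forall i, {linear X i -> C}) (pr : forall i, {linear C -> X i}).
Hypothesis pr_eps : forall i x, pr i (eps i x) = x.
Hypothesis pr_eps0 : forall i j x, i <> j -> pr j (eps i x) = 0.
Hypothesis eps_pr : forall c, c = \sum_i eps i (pr i c).
Hypothesis X_indec : forall i, indecomposable (X i).
Hypothesis X_acc : forall i, acc (X i).
Hypothesis X_dcc : forall i, dcc (X i).
Hypotheses (C_acc : acc C) (C_dcc : dcc C).

(** Matrices with a single entry, a non-isomorphism between components. They form a multiplicative
    semigroup with no sums, which is what [nil_semigroup] expects. *)
Let rad (s : {linear C -> C}) := exists i j (f : {linear X i -> X j}),
  ~ bijective f /\ forall c, s c = eps j (f (pr i c)).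

Lemma lzero_nbij i (Y : lmodType A) : ~ bijective (lzero (X i) Y).
Proof.
by move=> /bij_inj inj; have [[x xn] _] := X_indec i; apply: xn; apply: inj.
Qed.

(** A product of entries is zero or a composite of non-isomorphisms, again one since a split
    monomorphism into an indecomposable is bijective. Off-diagonal entries square to zero; diagonal
    ones are nilpotent by Fitting. *)
Lemma rad_nil : exists m, forall c, killed rad m c.
Proof.
apply: nil_semigroup => // [s t|s].
  move=> [i [j [f [nf sE]]]] [k [l [h [nh tE]]]].
  have [e|il] := pselect (l = i).
    case: _ / e f nf sE => f nf sE.
    exists (lcomp (eps j) (lcomp (lcomp f h) (pr k))); split; last first.
      by move=> c /=; rewrite sE tE pr_eps.
    exists k, j, (lcomp f h); split=> // bfh; apply: nh.
    have [c [cK _]] := lin_inv bfh.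
    apply: (@indec_iso _ _ _ h (lcomp c f)) => //; first by case: (X_indec k).
    by exists id => x; apply: cK.
  exists (lzero C C); split; last first.
    by move=> c /=; rewrite sE tE pr_eps0 // !linear0.
  exists k, j, (lzero _ _); split; first exact: lzero_nbij.
  by move=> c /=; rewrite linear0.
move=> [i [j [f [nf sE]]]].
have [e|ij] := pselect (j = i); last first.
  by exists 2 => c /=; rewrite !sE pr_eps0 // !linear0.
case: _ / (esym e) f nf sE => f nf sE.
have [//|[m fm]] := fitting f (@X_acc i) (@X_dcc i) (X_indec i).
suff h k c : lpow s k.+1 c = eps i (lpow f k.+1 (pr i c)).
  by exists m.+1 => c; rewrite h /= fm !linear0.
by elim: k => [|k IH] /=; [exact: sE|rewrite sE [s _]IH pr_eps].
Qed.

Variables (I J : Type).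
Let M : lmodType A := DSum (fun _ : J => C).
Variables (g : I -> {linear C -> M}) (w : I -> {linear M -> C}).
Hypothesis wg : forall x c, w x (g x c) = c.
Hypothesis wg0 : forall x y c, x <> y -> w x (g y c) = 0.

(** Indices of indecomposable pieces of [M]: those of the given copies [g x] on the left, those of
    the standard summands on the right. *)
Let T : Type := ((I + J) * 'I_n)%type.
Let Z (t : T) : lmodType A := X t.2.
Let v (t : T) : {linear Z t -> M} :=
  match t.1 with
  | inl x => lcomp (g x) (eps t.2)
  | inr j => lcomp (sinj (X := fun _ => C) j) (eps t.2)
  end.

(** Such a dual family shows that the pieces listed in [s] are independent and that their sum is a
    summand of [M]. *)
Let dual_on (s : seq {classic T}) := exists u : forall t, {linear M -> Z t},
  (forall t : T, (t : {classic T}) \in s -> forall z, u t (v t z) = z) /\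
  (forall t t' : T, (t : {classic T}) \in s -> (t' : {classic T}) \in s -> t <> t' ->
     forall z, u t (v t' z) = 0).

Let good (B : set T) := forall s : seq {classic T},
  (forall t : T, (t : {classic T}) \in s -> B t) -> dual_on s.

Let B0 : set T := fun t => if t.1 is inl _ then True else False.

Lemma good_base : good B0.
Proof.
move=> s sB.
exists (fun t => match t.1 with inl x => lcomp (pr t.2) (w x) | inr _ => lzero _ _ end).
split=> [[[x|j] i] /sB//= _ z|[[x|j] i] [[x'|j'] i'] /sB// _ /sB// _ ne z] /=.
  by rewrite wg pr_eps.
have [e|xx'] := pselect (x = x'); last by rewrite wg0 // linear0.
rewrite /v /= e wg pr_eps0 // => ei; apply: ne; by rewrite e ei.
Qed.

Lemma good_max : exists B, [/\ good B, forall t, B0 t -> B t &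
  forall t, ~ B t -> ~ good (fun t' => B t' \/ t' = t)].
Proof.
(* Zorn is applied to sets whose union with [B0] is good, so that the empty chain is settled by
   [good_base]. *)
have [|B [gB Bmax]] := @Zorn_bigcup T (fun B => good (fun t => B t \/ B0 t)).
  move=> F FP tot s sF.
  (* A finite list involves finitely many members of the chain, hence is covered, up to [B0], by a
     single one. *)
  have [G [hG sG]] : exists G : set T, (F G \/ G = set0) /\
      forall t : T, (t : {classic T}) \in s -> G t \/ B0 t.
    elim: s sF => [|t s IH] sF; first by exists set0; split=> //; right.
    have [|G [hG sG]] := IH; first by move=> t' t's; apply: sF; rewrite in_cons t's orbT.
    have [[G' FG' G't]|Bt] := sF t (mem_head _ _); last first.
      by exists G; split=> // t'; rewrite in_cons => /orP[/eqP ->|/sG//]; right.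
    have [FG|G0] := hG; last first.
      exists G'; split; first by left.
      move=> t'; rewrite in_cons => /orP[/eqP ->|/sG[]]; [by left|by rewrite G0|by right].
    have [GG'|G'G] := tot _ _ FG FG'.
      exists G'; split; first by left.
      by move=> t'; rewrite in_cons => /orP[/eqP ->|/sG[/GG'|]]; [left|left|right].
    exists G; split; first by left.
    by move=> t'; rewrite in_cons => /orP[/eqP ->|/sG//]; left; apply: G'G.
  have [FG|G0] := hG; first exact: (FP _ FG).
  by apply: good_base => t /sG; rewrite G0 => -[].
exists (fun t => B t \/ B0 t); split=> // [t|t nB gt]; first by right.
apply: (Bmax (fun t' => B t' \/ t' = t)).
  split; last by move=> h; apply: nB; left; apply: h; right.
  by move=> t' h; left.
move=> s sB; apply: gt => t' /sB[[h|h]|h]; [by left; left|by right|by left; right].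
Qed.

(** [v'] is the part of [v t] left after projecting away the pieces in [s]; a left inverse for it on
    [M] supplies the missing dual map. *)
Lemma dual_extend (s : seq {classic T}) (t : T) (u : forall t, {linear M -> Z t}) :
  (forall t : T, (t : {classic T}) \in s -> forall z, u t (v t z) = z) ->
  (forall t t' : T, (t : {classic T}) \in s -> (t' : {classic T}) \in s -> t <> t' ->
     forall z, u t (v t' z) = 0) ->
  uniq s -> (t : {classic T}) \notin s ->
  forall b : {linear M -> Z t},
  bijective (lcomp b (lsub (v t)
    (lsum s (fun k : T => lcomp (v k) (lcomp (u k) (v t)))))) ->
  dual_on (t :: s).
Proof.
move=> u1 u0 us ts b; set v' := lsub _ _ => /lin_inv[th [thK _]].
(* [q] kills the pieces in [s] and sends [v t] to [v'], so [th b q] is dual to [t]; the old dual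
   maps are then corrected to vanish on [v t]. *)
pose q : {linear M -> M} := lsub (lid M) (lsum s (fun k : T => lcomp (v k) (u k))).
have qt z : q (v t z) = v' z by [].
have qs (l : T) : (l : {classic T}) \in s -> forall z, q (v l z) = 0.
  move=> ls z; rewrite /q /= (bigD1_seq (l : {classic T})) //= u1 // big1_seq.
    by rewrite addr0 subrr.
  by move=> k /andP[/eqP kl ks]; rewrite u0 ?linear0.
pose ut : {linear M -> Z t} := lcomp th (lcomp b q).
have utt z : ut (v t z) = z by rewrite /ut /= -[LHS]/(th (b (q (v t z)))) qt thK.
have uts (l : T) : (l : {classic T}) \in s -> forall z, ut (v l z) = 0.
  by move=> ls z; rewrite -[LHS]/(th (b (q (v l z)))) qs // !linear0.
pose u' (k : T) : {linear M -> Z k} :=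
  match pselect (t = k) with
  | left e => eq_rect t (fun k => {linear M -> Z k}) ut k e
  | right _ => lsub (u k) (lcomp (u k) (lcomp (v t) ut))
  end.
have u't : u' t = ut.
  by rewrite /u'; case: pselect => // e; rewrite (Prop_irrelevance e (erefl t)).
have u'k k x : t <> k -> u' k x = u k x - u k (v t (ut x)).
  by rewrite /u'; case: pselect.
have nt (k : T) : (k : {classic T}) \in s -> t <> k.
  by move=> ks e; move: ts; rewrite e ks.
exists u'; split=> [k|k l]; rewrite !in_cons.
  move=> /orP[/eqP -> z|ks z]; first by rewrite u't utt.
  by rewrite (u'k _ _ (nt k ks)) uts // (linear0 (v t)) (linear0 (u k)) subr0 u1.
move=> /orP[/eqP ->|ks] /orP[/eqP ->|ls] ne z //.
- by rewrite u't uts.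
- by rewrite (u'k _ _ (nt k ks)) utt subrr.
- by rewrite (u'k _ _ (nt k ks)) uts // (linear0 (v t)) (linear0 (u k)) subr0 u0.
Qed.

Section Maximal.
Variable B : set T.
Hypotheses (B_good : good B) (B_base : forall t, B0 t -> B t)
  (B_max : forall t, ~ B t -> ~ good (fun t' => B t' \/ t' = t)).

Let span (y : M) := forall Q : M -> Prop, issub Q ->
  (forall t, B t -> forall z, Q (v t z)) -> Q y.

Lemma span_sub : issub span.
Proof.
split=> [Q Qs _|c y y' Ey Ey' Q Qs h]; first exact: Qs.1.
by apply: Qs.2; [apply: Ey|apply: Ey'].
Qed.

(** For [t] outside [B], maximality gives a finite list without dual family; its members other than
    [t] do have one. By [dual_extend] the residue of [v t] modulo their span therefore has no left
    inverse. *)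
Lemma span_mod_rad t : exists v' : {linear Z t -> M},
  (forall z, span (v t z - v' z)) /\
  forall b : {linear M -> Z t}, ~ bijective (lcomp b v').
Proof.
have [Bt|nBt] := pselect (B t).
  exists (lzero _ _); split=> [z|b]; first by rewrite /= subr0 => Q Qs h; apply: h.
  move=> /bij_inj inj; have [[x xn] _] := X_indec t.2; apply: xn; apply: inj.
  by rewrite /= !linear0.
have /existsNP[s' /not_implyP[s'B ns']] := B_max nBt.
pose s := [seq k : {classic T} <- undup s' | k != t].
have sB (k : T) : (k : {classic T}) \in s -> B k.
  rewrite mem_filter mem_undup => /andP[/eqP kt /s'B[]//].
have us : uniq s by rewrite filter_uniq // undup_uniq.
have ts : (t : {classic T}) \notin s by rewrite mem_filter eqxx.
have [u [u1 u0]] := B_good sB.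
exists (lsub (v t) (lsum s (fun k : T => lcomp (v k) (lcomp (u k) (v t))))).
split=> [z|b bij].
  rewrite /= opprB addrCA subrr addr0 => Q Qs h.
  have {}h : forall k : T, (k : {classic T}) \in s -> Q (v k (u k (v t z))).
    by move=> k /sB Bk; apply: h.
  rewrite big_seq; elim/big_ind: _ => //; first exact: Qs.1.
  by move=> x y; apply: issubD.
have [u' [u'1 u'0]] := dual_extend u1 u0 us ts bij.
have s's (k : T) : (k : {classic T}) \in s' -> (k : {classic T}) \in (t : {classic T}) :: s.
  by move=> ks; rewrite in_cons mem_filter mem_undup ks andbT orbN.
apply: ns'; exists u'; split=> [k /s's|k l /s's h /s's]; first exact: u'1.
exact: u'0.
Qed.

(** Modulo the span, each piece of [sinj j c] may be replaced by its residue, whose coordinates come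
    from [c] by maps in [rad]. If [c] is killed by k+1 factors they are killed by k, and [rad_nil]
    starts the induction. *)
Lemma span_full y : span y.
Proof.
have [m hm] := rad_nil.
have key k j c : killed rad k c -> span (sinj (X := fun _ : J => C) j c).
  elim: k j c => [|k IH] j c; first by move=> ->; rewrite linear0; apply: span_sub.1.
  move=> kc; rewrite (eps_pr c) linear_sum; apply: (issub_sum (P := span)); first exact: span_sub.
  move=> i; pose t : T := (inr j, i).
  have [v' [v'E v'rad]] := span_mod_rad t.
  rewrite -[sinj j _]/(v t (pr i c)) -[v t _](subrK (v' (pr i c))).
  apply: (issubD (P := span)); [exact: span_sub|exact: v'E|].
  have [s ->] := dsum_sum (v' (pr i c)); apply: (issub_sum (P := span)); first exact: span_sub.
  move=> j'; rewrite (eps_pr (sproj j' _)) linear_sum.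
  apply: (issub_sum (P := span)); first exact: span_sub.
  move=> i'; pose f := lcomp (lcomp (pr i') (sproj j')) v'.
  have nf : ~ bijective f.
    move=> /lin_inv[f' [f'K Kf']].
    apply: (v'rad (lcomp f' (lcomp (pr i') (sproj j')))); exists id => x; exact: f'K.
  pose s1 : {linear C -> C} := lcomp (eps i') (lcomp f (pr i)).
  by apply: (IH j' (s1 c)); apply: kc; exists i, i', f.
by move: y; apply: dsum_ind => [|j x]; [exact: span_sub|exact: key (hm x)].
Qed.

(** [M] is now the direct sum of the pieces in [B], which include all pieces of the [g x]; [rho]
    keeps those and drops the others. *)
Lemma split_of_maximal : exists rho : {linear M -> DSum (fun _ : I => C)},
  forall x c, rho (g x c) = sinj x c.
Proof.
pose TB := {t | B t}.
pose ZB (t : TB) := Z (sval t).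
pose Phi : {linear DSum ZB -> M} := sdesc (fun t : TB => v (sval t)).
have PhiE (t : TB) z : Phi (sinj t z) = v (sval t) z.
  exact: (sdescE (fun t : TB => v (sval t))).
have PhiS : surj Phi.
  move=> y; apply: (@span_full y (fun y => exists x, Phi x = y)) => [|t Bt z].
    split; first by exists 0; rewrite linear0.
    by move=> a _ _ [x <-] [y' <-]; exists (a *: x + y'); rewrite linearP.
  by exists (sinj (X := ZB) (exist _ t Bt) z); rewrite PhiE.
have svI (t t' : TB) : sval t = sval t' -> t = t'.
  case: t t' => [t Bt] [t' Bt'] /= e; move: Bt'; rewrite -e => Bt'.
  by rewrite (Prop_irrelevance Bt Bt').
have PhiI : injective Phi.
  apply: lin_injP => z Phiz; have [s us hs] := dsum_supp z.
  pose sv (t : {classic TB}) : {classic T} := sval (t : TB).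
  have [|u [u1 u0]] := @B_good (map sv s).
    by move=> t /mapP[t' _ ->]; apply: (svalP (t' : TB)).
  rewrite [LHS](dsum_sumE us hs) big1_seq // => t /= ts.
  suff -> : sproj t z = 0 by rewrite linear0.
  have ts' : sv t \in map sv s by apply: map_f.
  have : u (sval t) (Phi z) = 0 by rewrite Phiz linear0.
  rewrite {1}(dsum_sumE us hs) linear_sum linear_sum (bigD1_seq t) //=.
  rewrite PhiE u1 // big1_seq ?addr0 // => k /andP[kt ks].
  rewrite PhiE u0 //; first exact: (map_f sv).
  by move=> /esym/svI e; case/eqP: kt.
have [Psi [PhiK PsiK]] := lin_inv (inj_surj_bij PhiI PhiS).
pose th (t : TB) : {linear ZB t -> DSum (fun _ : I => C)} :=
  match (sval t).1 with
  | inl x => lcomp (sinj (X := fun _ => C) x) (eps (sval t).2)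
  | inr _ => lzero _ _
  end.
exists (lcomp (sdesc th) Psi) => x c /=.
have gE : g x c = Phi (\sum_i sinj (X := ZB)
    (exist _ ((inl x, i) : T) (@B_base (inl x, i) Logic.I)) (pr i c)).
  rewrite linear_sum [in LHS](eps_pr c) linear_sum.
  by apply: eq_bigr => i _; rewrite PhiE.
rewrite gE PhiK linear_sum [RHS](congr1 (sinj x) (eps_pr c)) linear_sum.
by apply: eq_bigr => i _; rewrite sdescE.
Qed.
End Maximal.

Lemma split_family : exists rho : {linear M -> DSum (fun _ : I => C)},
  forall x c, rho (g x c) = sinj x c.
Proof.
by have [B [gB bB mB]] := good_max; apply: (split_of_maximal gB bB mB).
Qed.
End SplitSum.

(** The copies of [C] in C^(I), sent into C^(J) through C^I, are separated by the coordinates of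
    C^I. The retraction of C^(J) onto C^(I) then restricts to C^I. *)
Lemma dsum_in_prod (A : nzRingType) (C : lmodType A) n (X : 'I_n -> lmodType A) :
  isom C (DSum X) -> (forall i, indecomposable (X i)) -> fingen C ->
  (forall M : lmodType A, fingen M -> acc M) ->
  (forall M : lmodType A, fingen M -> dcc M) ->
  product_complete C -> forall I : Type, inProd C (DSum (fun _ : I => C)).
Proof.
move=> [phi /lin_inv[psi [phiK psiK]]] hX fC ha hd pc I.
have [J /retractP[e [r re]]] : inAdd C (DProd (fun _ : I => C)).
  by apply: pc; exists I; apply/retractP/retract_refl.
have fX i : fingen (X i).
  apply: fingen_retract fC; exists (lcomp psi (sinj i)), (lcomp (sproj i) phi) => x.
  by rewrite /= psiK sinjK.
pose eps i := lcomp psi (sinj i); pose pr i := lcomp (sproj i) phi.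
pose g x := lcomp e (lcomp (sincl (fun _ : I => C)) (sinj (X := fun _ : I => C) x)).
pose w x := lcomp (pproj (X := fun _ : I => C) x) r.
have h1 i x : pr i (eps i x) = x by rewrite /= psiK sinjK.
have h2 i j x : i <> j -> pr j (eps i x) = 0 by move=> ij; rewrite /= psiK sinj0.
have h3 c : c = \sum_i eps i (pr i c) by rewrite -linear_sum -dsum_fin phiK.
have h4 x c : w x (g x c) = c by rewrite /= re pproj_sincl sinjK.
have h5 x y c : x <> y -> w x (g y c) = 0.
  by move=> xy; rewrite /= re pproj_sincl sinj0 // => /esym.
have [rho rhoE] := split_family h1 h2 h3 hX (fun i => ha _ (fX i))
  (fun i => hd _ (fX i)) (ha _ fC) (hd _ fC) h4 h5.
exists I; apply/retractP; exists (sincl _), (lcomp rho e) => x.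
rewrite -[LHS]/(lcomp (lcomp rho e) (sincl _) x) -[RHS]/(lid _ x); move: x.
apply: dsum_eq => x c /=; exact: rhoE.
Qed.

(** * The correspondence *)

Section Converse.
Variable A : nzRingType.
Implicit Types C M N L Q X : lmodType A.
Hypothesis A_noeth : noeth A.

(** The kernel of a finitely generated projective presentation is finitely generated, so a map from
    it meets finitely many copies of [C] and extends coordinatewise. *)
Lemma ext1_zero_dsum_right C L (I : Type) : fingen L -> ext1_zero L C ->
  ext1_zero L (DSum (fun _ : I => C)).
Proof.
move=> fL hL; have [P [p [hP fP pS]]] := fingen_projective_cover fL.
apply: (ext1_zero_cover (ker_short_exact pS) hP) => f.
have fK : fingen (Ker p) := A_noeth (@kerval_inj _ _ _ p) fP.
have [s sE] := fingen_dsum_sum f fK.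
have /choice[g gE] x := hL _ _ _ _ (ker_short_exact pS) (lcomp (sproj x) f).
exists (lsum s (fun x => lcomp (sinj (X := fun _ : I => C) x) (g x))) => y /=.
by rewrite [RHS]sE; apply: eq_bigr => x _; rewrite gE.
Qed.

Section Fixed.
Variable C : lmodType A.
Hypotheses (fC : fingen C) (C_perp : perp C C) (C_pc : product_complete C).
Hypothesis C_sums : forall I : Type, inProd C (DSum (fun _ : I => C)).
Hypothesis Y_reg : Ycal C (reg A).

(** The test modules [L] are finitely generated because [ext1_zero_dsum_right] gives Ext^1(L, C^(I))
    = 0 for those. *)
Let acyc N := forall L, fingen L -> ext1_zero L C -> cogen_star C L -> ext1_zero L N.

Lemma acyc_gen_star Q : acyc Q -> gen_star (inProd C) Q.
Proof.
move: Q; apply: gen_star_coind => N hN.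
pose H := {linear C -> N}; pose S := DSum (fun _ : H => C).
pose p : {linear S -> N} := sdesc (X := fun _ : H => C) (fun h => h).
have lift C1 : fac C C1 -> forall h : {linear C1 -> N},
    exists h' : {linear C1 -> S}, forall x, p (h' x) = h x.
  move=> [J [s [a [b ab]]]] h.
  exists (lsum s (fun i => lcomp (sinj (X := fun _ : H => C) (lcomp h (b i))) (a i))).
  move=> x; rewrite /= linear_sum [in RHS](ab x) linear_sum.
  by apply: eq_bigr => i _; rewrite /p (sdescE (fun h : H => h)).
(* A map from [L] to [N] first extends to [C1] in add C, since the cokernel is again a test module,
   and then lifts to the sum by construction of [S]. *)
have ext L : cogen_star C L -> forall h : {linear L -> N},
    exists h' : {linear L -> S}, forall x, p (h' x) = h x.
  move=> /cogen_star_unfold[C1 [L' [f [g [hse hC1 hL' cL']]]]] h.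
  have fL' : fingen L'.
    by have [_ _ gS] := hse; apply: fingen_surj gS _; apply: fac_fingen hC1 fC.
  have [h1 h1E] := hN L' fL' hL' cL' _ _ _ _ hse h.
  have [h2 h2E] := lift C1 hC1 h1.
  by exists (lcomp h2 f) => x; rewrite /= h2E.
(* The regular module is in Y_C, so the maps [elt y] lift and every [y] is reached. *)
have pS : surj p.
  move=> y; have [h hE] := ext _ Y_reg.2 (elt y).
  by exists (h (reg1 A)); rewrite hE elt1.
exists (Ker p), S, (kerval p), p; split.
- exact: ker_short_exact.
- exact: C_sums.
(* Product-completeness turns [X] into a summand of copies of [C], and for [C] the lifting property
   of [p] decides. *)
- move=> X /C_pc[J /retractP h]; apply: ext1_zero_retract h _; apply: ext1_zero_dsum => _.
  apply: (ext1_zero_kernel (ker_short_exact pS)); last exact: lift (fac_refl C).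
  exact: ext1_zero_dsum_right fC (perp_ext1_zero C_perp).
move=> L fL hL cL; apply: (ext1_zero_kernel (ker_short_exact pS)); last exact: ext.
exact: ext1_zero_dsum_right.
Qed.

Lemma cotilting_of_generated Q : injective_module Q -> cogenerator Q ->
  wakamatsu_cotilting C.
Proof.
move=> iQ cQ; split=> [I i hi|].
  have [J /retractP h] : inAdd C (DProd (fun _ : I => C)).
    by apply: C_pc; exists I; apply/retractP/retract_refl.
  have /left_perpP : perp C (DProd (fun _ : I => C)) by apply: perp_dsum_retract h.
  by apply.
by exists Q; split=> //; apply: acyc_gen_star => L _ _ _; apply: ext1_zero_injective.
Qed.
End Fixed.

Hypothesis A_dcc : forall M, fingen M -> dcc M.
Variable Q : lmodType A.
Hypotheses (Q_inj : injective_module Q) (Q_cogen : cogenerator Q).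

Lemma maximal_pc_resolving_Y D : maximal_pc_resolving D ->
  exists2 C, bpw_cotilting C & forall M, D M <-> Ycal C M.
Proof.
move=> [C pc [[[Dfg _] _ _ _ Dproj] hei hmax]].
have A_acc M : fingen M -> acc M by apply: noeth_acc.
have [DC _ Dcog] := hei.
have fC := Dfg _ DC; have hC := ext_injective_perp hei.
have DY := ext_injective_sub_Y hei.
have hP P : fingen P -> projective P -> Ycal C P by move=> fP pP; apply/DY/Dproj.
have YD : forall M, Ycal C M -> D M.
  by apply: hmax DY; [apply: Y_resolving|apply: Y_ext_injective].
(* The regular module embeds in a member of add C, which would vanish with [C], contradicting 1 <>
   0. *)
have nzC : nonzero C.
  apply: contrapT => /nonzeroPn C0.
  have [C' [M' [f [g [[fI _ _] /inaddP[I [s [a [b ab]]]] _]]]]] :=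
    Dcog _ (Dproj _ (@fingen_reg A) (@projective_reg A)).
  have /fI/eqP : f (reg1 A) = f 0.
    by rewrite linear0 [LHS]ab big1 // => i _; rewrite (C0 (a i _)) linear0.
  by apply/negP; apply: oner_neq0.
have [B [bB CB BC]] := basic_version A_noeth fC nzC.
have fB := fac_fingen CB fC.
have hB : perp B B by apply: perp_fac CB (perp_cov CB hC).
have pcB := pc_transfer CB BC pc.
have YE M : Ycal C M <-> Ycal B M by split; apply: Y_add_eq.
exists B; last by move=> M; rewrite -YE; split; [apply: DY|apply: YD].
split=> //; apply: (cotilting_of_generated fB hB pcB _ _ Q_inj Q_cogen).
  have [_ [n [X [iX hX _]]]] := bB.
  exact: dsum_in_prod iX hX fB A_acc A_dcc pcB.
by apply/YE/hP; [apply: fingen_reg|apply: projective_reg].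
Qed.
End Converse.

Theorem theorem1p5 (R : nzRingType) (hR : right_morita R) :
  [/\ forall C : rmodType R,
        bpw_cotilting C -> maximal_pc_resolving (Ycal C),
      forall C C' : rmodType R, bpw_cotilting C -> bpw_cotilting C' ->
        (isom C C' <-> forall M : rmodType R, Ycal C M <-> Ycal C' M)
    & forall D : rmodType R -> Prop, maximal_pc_resolving D ->
        exists2 C : rmodType R, bpw_cotilting C
          & forall M : rmodType R, D M <-> Ycal C M].
Proof.
have [S [U dual]] := hR.
have nR := noethR dual.
split=> [C [fC _ pc wC]|C C' [fC bC _ wC] [fC' bC' _ wC']|D].
- by exists C => //; apply: wakamatsu_maximal.
- have hC := wakamatsu_perp wC; have hC' := wakamatsu_perp wC'.
  split=> [iCC' M|e].
    have CC' : fac C C' by apply/isom_fac/isom_sym.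
    have C'C : fac C' C by apply: isom_fac.
    by split; apply: Y_add_eq.
  (* Equality of the two classes places each module in the add-closure of the other, by [Y_eq_fac]
     in both directions. *)
  apply: basic_isom => //.
  + exact: acc_fingen dual.
  + exact: dcc_fingen dual.
  + by apply: Y_eq_fac => // M; split=> /e.
  + exact: Y_eq_fac.
apply: maximal_pc_resolving_Y nR _ _ (U_injective dual) (U_cogenerator dual) D.
exact: dcc_fingen dual.
Qed.
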